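(* Let $\chi_1,\chi_2\ge 0$, let $\theta_1,\theta_2\in\mathbb{R}\setminus\pi\mathbb{Z}$, and let $\boldsymbol a,\boldsymbol b$ be pure quaternions with $\boldsymbol a^2=\boldsymbol b^2=-1$. For every $f\in L^2_{\chi_1,\chi_2}(\mathbb R^2;\mathbb H)$, $$\big\|\mathcal{F}_{\chi_1,\chi_2}^{\theta_1,\theta_2;-\boldsymbol a,-\boldsymbol b}\{f\}\big\|^2_{2,\mathbb H,\chi_1,\chi_2}=\|f\|^2_{2,\mathbb H,\chi_1,\chi_2},$$ where $\mathcal{F}_{\chi_1,\chi_2}^{\theta_1,\theta_2;-\boldsymbol a,-\boldsymbol b}$ is the fractional two-sided quaternionic Dunkl transform.
   Context: $\mathbb H$ is the real quaternion algebra with modulus $|\cdot|_{\mathbb H}$. The measure on $\mathbb R^2$ is $d\mu_{\chi_1,\chi_2}(x)=|x_1|^{2\chi_1+1}|x_2|^{2\chi_2+1}dx_1dx_2$, $\|f\|_{p,\mathbb H,\chi_1,\chi_2}=\big(\int|f|_{\mathbb H}^p\,d\mu_{\chi_1,\chi_2}\big)^{1/p}$, and $L^p_{\chi_1,\chi_2}(\mathbb R^2;\mathbb H)$ is the space of measurable $f:\mathbb R^2\to\mathbb H$ for which this is finite. For a pure quaternion $q$ with $q^2=-1$, real $u,s$ and $\chi\ge0$, the rank-one Dunkl kernel is $$E_\chi(u,qs)=\frac{\Gamma(\chi+1)}{\sqrt\pi\,\Gamma(\chi+\frac12)}\int_{-1}^1 e^{q\,u s t}(1-t^2)^{\chi-\frac12}(1+t)\,dt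 .$$ Put $E^{\boldsymbol a}_{\chi_1,\theta_1}(x_1,y_1)=e^{-\frac{\boldsymbol a}{2}(x_1^2+y_1^2)\cot\theta_1}E_{\chi_1}\!\big(x_1,-\boldsymbol a\tfrac{y_1}{\sin\theta_1}\big)$, $E^{\boldsymbol b}_{\chi_2,\theta_2}(x_2,y_2)=E_{\chi_2}\!\big(x_2,-\boldsymbol b\tfrac{y_2}{\sin\theta_2}\big)e^{-\frac{\boldsymbol b}{2}(x_2^2+y_2^2)\cot\theta_2}$, and, with $q_1=\boldsymbol a$, $q_2=\boldsymbol b$, $\hat\theta_i=\operatorname{sgn}(\sin\theta_i)$, $$c^{\theta_i}_{\chi_i}=\frac{e^{q_i(\chi_i+1)(\hat\theta_i\pi/2-\theta_i)}}{|\sin\theta_i|^{\chi_i+1}}\cdot\frac{1}{2^{\chi_i+1}\Gamma(\chi_i+1)} .$$ The fractional two-sided quaternionic Dunkl transform of $f\in L^1_{\chi_1,\chi_2}(\mathbb R^2;\mathbb H)$ is $$\mathcal{F}_{\chi_1,\chi_2}^{\theta_1,\theta_2;-\boldsymbol a,-\boldsymbol b}\{f\}(y)=c^{\theta_1}_{\chi_1}c^{\theta_2}_{\chi_2}\int_{\mathbb R^2}E^{\boldsymbol a}_{\chi_1,\theta_1}(x_1,y_1)\,f(x_1,x_2)\,E^{\boldsymbol b}_{\chi_2,\theta_2}(x_2,y_2)\,d\mu_{\chi_1,\chi_2}(x).$$ On $L^2_{\chi_1,\chi_2}(\mathbb R^2;\mathbb H)$ it is understood as the continuous extension from $L^1\cap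 L^2$ (the identity on $L^1\cap L^2$ being part of the assertion). *)

(* Defs.v *)
From HB Require Import structures.
From mathcomp Require Import all_boot all_order all_algebra.
From mathcomp Require Import all_classical all_reals all_analysis.
From mathcomp Require Import measurable_realfun ring.

Set Implicit Arguments.
Unset Strict Implicit.
Unset Printing Implicit Defensive.

Import Order.TTheory GRing.Theory Num.Theory.
Import numFieldNormedType.Exports.

Local Open Scope classical_set_scope.
Local Open Scope ring_scope.

(** * Real quaternions *)

(* [Quat a b c d] is a + b i + c j + d k. *)
Record quat (R : Type) := Quat { qre : R; qi : R; qj : R; qk : R }.
Arguments qre {R} _.
Arguments qi {R} _.
Arguments qj {R} _.
Arguments qk {R} _.

Section QuatRing.
Variable R : realType.
Implicit Types p q r : quat R.

Definition tuple_of_quat q : R * R * R * R := (qre q, qi q, qj q, qk q).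
Definition quat_of_tuple (t : R * R * R * R) : quat R :=
  Quat t.1.1.1 t.1.1.2 t.1.2 t.2.

Lemma tuple_of_quatK : cancel tuple_of_quat quat_of_tuple.
Proof. by case. Qed.

HB.instance Definition _ := Choice.copy (quat R) (can_type tuple_of_quatK).

Lemma quatP p q :
  qre p = qre q -> qi p = qi q -> qj p = qj q -> qk p = qk q -> p = q.
Proof. by case: p => ????; case: q => ???? /= -> -> -> ->. Qed.

Definition quat_zero : quat R := Quat 0 0 0 0.
Definition quat_one : quat R := Quat 1 0 0 0.
Definition quat_opp q := Quat (- qre q) (- qi q) (- qj q) (- qk q).
Definition quat_add p q :=
  Quat (qre p + qre q) (qi p + qi q) (qj p + qj q) (qk p + qk q).
Definition quat_mul p q :=
  Quat (qre p * qre q - qi p * qi q - qj p * qj q - qk p * qk q)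
       (qre p * qi q + qi p * qre q + qj p * qk q - qk p * qj q)
       (qre p * qj q - qi p * qk q + qj p * qre q + qk p * qi q)
       (qre p * qk q + qi p * qj q - qj p * qi q + qk p * qre q).
Definition quat_scale (a : R) q := Quat (a * qre q) (a * qi q) (a * qj q) (a * qk q).

Lemma quat_addA : associative quat_add.
Proof. by move=> p q r; apply: quatP => /=; ring. Qed.
Lemma quat_addC : commutative quat_add.
Proof. by move=> p q; apply: quatP => /=; ring. Qed.
Lemma quat_add0 : left_id quat_zero quat_add.
Proof. by move=> p; apply: quatP => /=; ring. Qed.
Lemma quat_addN : left_inverse quat_zero quat_opp quat_add.
Proof. by move=> p; apply: quatP => /=; ring. Qed.

HB.instance Definition _ :=
  GRing.isZmodule.Build (quat R) quat_addA quat_addC quat_add0 quat_addN.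

Lemma quat_mulA : associative quat_mul.
Proof. by move=> p q r; apply: quatP => /=; ring. Qed.
Lemma quat_mul1q : left_id quat_one quat_mul.
Proof. by move=> p; apply: quatP => /=; ring. Qed.
Lemma quat_mulq1 : right_id quat_one quat_mul.
Proof. by move=> p; apply: quatP => /=; ring. Qed.
Lemma quat_mulDl : left_distributive quat_mul quat_add.
Proof. by move=> p q r; apply: quatP => /=; ring. Qed.
Lemma quat_mulDr : right_distributive quat_mul quat_add.
Proof. by move=> p q r; apply: quatP => /=; ring. Qed.
Lemma quat_one_neq0 : quat_one != 0 :> quat R.
Proof. by apply/eqP => -[/eqP]; rewrite oner_eq0. Qed.

HB.instance Definition _ := GRing.Zmodule_isNzRing.Build (quat R)
  quat_mulA quat_mul1q quat_mulq1 quat_mulDl quat_mulDr quat_one_neq0.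

Lemma quat_scaleA a b q : quat_scale a (quat_scale b q) = quat_scale (a * b) q.
Proof. by apply: quatP => /=; ring. Qed.
Lemma quat_scale1 : left_id 1 quat_scale.
Proof. by move=> q; apply: quatP => /=; ring. Qed.
Lemma quat_scaleDr : right_distributive quat_scale +%R.
Proof. by move=> a p q; apply: quatP => /=; ring. Qed.
Lemma quat_scaleDl q : {morph quat_scale^~ q : a b / a + b}.
Proof. by move=> a b; apply: quatP => /=; ring. Qed.

HB.instance Definition _ := GRing.Zmodule_isLmodule.Build R (quat R)
  quat_scaleA quat_scale1 quat_scaleDr quat_scaleDl.

Definition qmod q : R :=
  Num.sqrt (qre q ^+ 2 + qi q ^+ 2 + qj q ^+ 2 + qk q ^+ 2).

Definition pure_quat q := qre q = 0.

Definition qlim (u : nat -> quat R) : quat R :=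
  Quat (limn (qre \o u)) (limn (qi \o u)) (limn (qj \o u)) (limn (qk \o u)).

Definition qexp q : quat R :=
  qlim (fun n => \sum_(0 <= k < n) (k`!%:R^-1 *: q ^+ k)).

End QuatRing.

(** * Quaternion-valued functions on a measure space *)

Section QuatFun.
Context d (T : measurableType d) (R : realType).
Variable mu : {measure set T -> \bar R}.
Implicit Types f : T -> quat R.

Definition qmeasurable f :=
  [/\ measurable_fun [set: T] (fun x => qre (f x)),
      measurable_fun [set: T] (fun x => qi (f x)),
      measurable_fun [set: T] (fun x => qj (f x)) &
      measurable_fun [set: T] (fun x => qk (f x))].

Definition qintegral (D : set T) f : quat R :=
  Quat (\int[mu]_(x in D) qre (f x)) (\int[mu]_(x in D) qi (f x))
       (\int[mu]_(x in D) qj (f x)) (\int[mu]_(x in D) qk (f x)).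

Definition qLnorm (p : R) f : \bar R :=
  Lnorm mu p%:E (fun x => (qmod (f x))%:E).

Definition qLp (p : R) f := qmeasurable f /\ (qLnorm p f < +oo)%E.

End QuatFun.

(** * The weighted measure on the plane *)

Section DunklMeasure.
Variable R : realType.

Definition dunkl_weight (chi1 chi2 : R) (x : R * R) : R :=
  `|x.1| `^ (2 * chi1 + 1) * `|x.2| `^ (2 * chi2 + 1).

Definition dunkl_measure (chi1 chi2 : R) :
    set (measurableTypeR R * measurableTypeR R) -> \bar R := fun A =>
  (\int[(@lebesgue_measure R \x @lebesgue_measure R)%E]_(x in A)
     (dunkl_weight chi1 chi2 x)%:E)%E.

Variables chi1 chi2 : R.

Lemma dunkl_weight_ge0 x : 0 <= dunkl_weight chi1 chi2 x.
Proof. by rewrite mulr_ge0// powR_ge0. Qed.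

Lemma measurable_dunkl_weight : measurable_fun
  [set: measurableTypeR R * measurableTypeR R] (dunkl_weight chi1 chi2).
Proof.
apply: measurable_funM.
  apply: (measurableT_comp (@measurable_powR R _)).
  exact: (measurableT_comp (@normr_measurable R _) measurable_fst).
apply: (measurableT_comp (@measurable_powR R _)).
exact: (measurableT_comp (@normr_measurable R _) measurable_snd).
Qed.

Let dunkl_measure0 : dunkl_measure chi1 chi2 set0 = 0%E.
Proof. by rewrite /dunkl_measure integral_set0. Qed.

Let dunkl_measure_ge0 A : (0 <= dunkl_measure chi1 chi2 A)%E.
Proof. by apply: integral_ge0 => x _; rewrite lee_fin dunkl_weight_ge0. Qed.

Let dunkl_measure_sigma_additive : semi_sigma_additive (dunkl_measure chi1 chi2).
Proof.
move=> /= F mF tF mUF; rewrite /dunkl_measure; apply: cvg_toP.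
  apply: ereal_nondecreasing_is_cvgn => m n mn.
  apply: lee_sum_nneg_natr => // k _ _; apply: integral_ge0 => /= x _.
  by rewrite lee_fin dunkl_weight_ge0.
rewrite ge0_integral_bigcup//=.
- apply/measurable_funTS/measurableT_comp => //=.
  exact: measurable_dunkl_weight.
- by move=> x _; rewrite lee_fin dunkl_weight_ge0.
Qed.

HB.instance Definition _ := isMeasure.Build _ _ _ (dunkl_measure chi1 chi2)
  dunkl_measure0 dunkl_measure_ge0 dunkl_measure_sigma_additive.

End DunklMeasure.

(** * The fractional two-sided quaternionic Dunkl transform *)

Section DunklTransform.
Variable R : realType.
Local Notation mu := (@lebesgue_measure R).

Definition Gamma (x : R) : R :=
  \int[mu]_(t in `]0, +oo[) (t `^ (x - 1) * expR (- t)).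

(* The second argument is the quaternion [q s], so that
   [(u * t) *: w] is the exponent q u s t of the integrand. *)
Definition dunkl_kernel (chi u : R) (w : quat R) : quat R :=
  (Gamma (chi + 1) / (Num.sqrt pi * Gamma (chi + 2^-1))) *:
  qintegral mu `[-1, 1] (fun t : R =>
    ((1 - t ^+ 2) `^ (chi - 2^-1) * (1 + t)) *: qexp ((u * t) *: w)).

Definition cot (theta : R) : R := cos theta / sin theta.

Definition chirp (q : quat R) (theta x y : R) : quat R :=
  qexp (- (2^-1 * (x ^+ 2 + y ^+ 2) * cot theta) *: q).

Definition frac_kernel_left (a : quat R) (chi theta x y : R) : quat R :=
  chirp a theta x y * dunkl_kernel chi x (- (y / sin theta) *: a).

Definition frac_kernel_right (b : quat R) (chi theta x y : R) : quat R :=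
  dunkl_kernel chi x (- (y / sin theta) *: b) * chirp b theta x y.

Definition frac_const (q : quat R) (chi theta : R) : quat R :=
  ((`|sin theta| `^ (chi + 1))^-1 * (2 `^ (chi + 1) * Gamma (chi + 1))^-1) *:
  qexp (((chi + 1) * (Num.sg (sin theta) * pi / 2 - theta)) *: q).

Variables (chi1 chi2 theta1 theta2 : R) (a b : quat R).

Definition frac_dunkl (f : R * R -> quat R) (y : R * R) : quat R :=
  frac_const a chi1 theta1 * frac_const b chi2 theta2 *
  qintegral (dunkl_measure chi1 chi2) [set: R * R] (fun x : R * R =>
    frac_kernel_left a chi1 theta1 x.1 y.1 * f x *
    frac_kernel_right b chi2 theta2 x.2 y.2).

Local Notation L p := (qLp (dunkl_measure chi1 chi2) p).
Local Notation norm2 := (qLnorm (dunkl_measure chi1 chi2) 2).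

(* [F] represents a continuous map of L^2 to itself extending the integral
   formula on the intersection of L^1 and L^2.  Functions are not quotiented by
   a.e. equality; [frac_dunkl_ext_continuous] at distance 0 makes [F] compatible
   with it. *)
Record is_frac_dunkl_L2 (F : (R * R -> quat R) -> R * R -> quat R) : Prop := {
  frac_dunkl_ext_L2 : forall f : R * R -> quat R, L 2 f -> L 2 (F f);
  frac_dunkl_ext_continuous : forall f : R * R -> quat R, L 2 f ->
    forall e : R, 0 < e -> exists2 d : R, 0 < d &
    forall g : R * R -> quat R, L 2 g -> (norm2 (g \- f)%R < d%:E)%E ->
      (norm2 (F g \- F f)%R < e%:E)%E;
  frac_dunkl_ext_agree : forall f : R * R -> quat R, L 1 f -> L 2 f ->
    {ae dunkl_measure chi1 chi2, forall y, F f y = frac_dunkl f y}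
}.

End DunklTransform.

(* Main.v *)
Require Import Defs.
From HB Require Import structures.
From mathcomp Require Import all_boot all_order all_algebra.
From mathcomp Require Import all_classical all_reals all_analysis.
From mathcomp Require Import measurable_realfun ring lra.

(* On the real line write the Dunkl kernel as A + q B with A even and B odd, both
   integrals against (1-t^2)^(chi-1/2).  The real transform with kernel A + B maps
   x^s exp(-p x^2/2), s = 0 or 1, to a Gaussian of the same shape, which reduces
   its Plancherel identity on the span of these functions to the scaling of
   Gaussian moments.  The span is dense for the gauge int |f| + f^2: functions
   phi(x^2) exp(-x^2) are reached from exp(-M exp(-m x^2)), whose pointwise limits
   are indicators of rays, by a Dynkin class argument.  For quaternion-valued f the
   identity |P + qQ|^2 + |P - qQ|^2 = 2|P|^2 + 2|Q|^2, where P is the even and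
   Q the odd part of the transform, transfers the real identity to left and right
   quaternionic kernels; the chirps are unimodular and drop out.  The planar
   transform is the composition of a left transform in x_1 and a right transform in
   x_2, so Fubini gives the isometry on the intersection of L^1 and L^2, and a
   Riesz-Fischer argument extends it to L^2. *)

Import Order.TTheory GRing.Theory Num.Theory.
Import numFieldNormedType.Exports.
Local Open Scope classical_set_scope.
Local Open Scope ring_scope.

Set Implicit Arguments.
Unset Strict Implicit.
Unset Printing Implicit Defensive.

(** * Weighted measures and changes of variables *)

(** The obstacle is noncommutativity: multiplication by a pure unit a mixes the four coordinates, so
    the coordinates of the transform of f are not transforms of the coordinates of f. A real kernel
    acts on each coordinate separately; hence A + B, the analogue of the Hartley kernel cos + sin.
    Both A + B and A + a B split into an even and an odd part in y, and adding the square norms at y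
    and -y leaves 2|P|^2 + 2|Q|^2, which does not see the factor a. No Bessel function and no Beta
    integral is evaluated. The substitution u = x t replaces the integral against the kernel by an
    ordinary cosine or sine integral of a Gaussian, and Gaussian moments enter only through their
    scaling, so that their values cancel. The gauge is adapted to bounded kernels: its L^1 half
    makes the transform an absolutely convergent integral at every point, continuous in f, while its
    L^2 half carries the isometry. *)

Section density.
Context d (T : measurableType d) (R : realType).
Variables (mu nu : {measure set T -> \bar R}) (w : T -> R).
Hypothesis mw : measurable_fun [set: T] w.
Hypothesis w0 : forall x, 0 <= w x.
Hypothesis nuE : forall A, measurable A -> nu A = (\int[mu]_(x in A) (w x)%:E)%E.
Local Open Scope ereal_scope.
Import HBNNSimple.

(** Both sides are monotone limits along the same simple functions, and on the preimage of a single
    value the identity is [nuE]. *)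
Lemma ge0_integral_density (f : T -> \bar R) : measurable_fun setT f ->
  (forall x, 0 <= f x) -> \int[nu]_x f x = \int[mu]_x (f x * (w x)%:E).
Proof.
move=> mf f0.
pose f_ := nnsfun_approx measurableT mf.
have cvf x : (EFin \o f_^~ x) n @[n --> \oo] --> f x.
  by apply: cvg_nnsfun_approx.
have ndf x : {homo (fun n => f_ n x) : n m / (n <= m)%N >-> (n <= m)%R}.
  by move=> n m nm; exact/lefP/nd_nnsfun_approx.
transitivity (limn (fun n => \int[nu]_x (f_ n x)%:E)).
  rewrite -monotone_convergence//.
  - by apply: eq_integral => y _; apply/esym/cvg_lim => //; exact: cvf.
  - by move=> n; exact/measurable_EFinP/measurable_funP.
  - by move=> n y _; rewrite lee_fin.
  - by move=> y _ m n mn; rewrite lee_fin ndf.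
transitivity (limn (fun n => \int[mu]_x ((f_ n x)%:E * (w x)%:E))); last first.
  rewrite -monotone_convergence//.
  - apply: eq_integral => y _; apply/cvg_lim => //.
    by apply: cvgeZr => //; exact: cvf.
  - move=> n; apply: emeasurable_funM; apply/measurable_EFinP => //.
  - by move=> n y _; rewrite mule_ge0// lee_fin.
  - by move=> y _ m n mn; rewrite lee_wpmul2r// lee_fin// ndf.
congr (limn _); apply/funext => n.
under eq_integral do rewrite fimfunE -fsumEFin//.
under [RHS]eq_integral => x _.
  rewrite fimfunE -fsumEFin// ge0_mule_fsuml//; last first.
    by move=> r; rewrite nnfun_muleindic_ge0.
  over.
rewrite ge0_integral_fsum//; last 2 first.
- by move=> y; exact/measurable_EFinP/measurable_funM.
- by move=> y x _; rewrite nnfun_muleindic_ge0.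
rewrite ge0_integral_fsum//; last 2 first.
- move=> y; apply: emeasurable_funM; apply/measurable_EFinP => //.
  exact: measurable_funM.
- move=> y x _; apply: mule_ge0; last by rewrite lee_fin.
  by rewrite EFinM nnfun_muleindic_ge0.
apply: eq_fsbigr => r; rewrite inE => -[t _ <-].
under eq_integral do rewrite EFinM.
rewrite ge0_integralZl_EFin//; last exact/measurable_EFinP.
rewrite integral_indic// setIT nuE//.
under [RHS]eq_integral do rewrite EFinM -muleA.
rewrite ge0_integralZl_EFin//; last 2 first.
- by move=> x _; apply: mule_ge0; rewrite lee_fin.
- by apply: emeasurable_funM; apply/measurable_EFinP.
congr (_ * _).
rewrite integral_mkcond; apply: eq_integral => x _.
by rewrite patchE indicE; case: ifPn => xr; rewrite ?mul1e ?mul0e.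
Qed.

End density.

Section weighted_lebesgue.
Variable R : realType.
Variable w : {mfun R >-> R}.
Local Open Scope ereal_scope.
Local Notation leb := (@lebesgue_measure R).

(* The absolute value makes every measurable weight admissible. *)
Definition wleb (A : set (measurableTypeR R)) : \bar R :=
  \int[leb]_(x in A) (`|w x|%R)%:E.

Lemma measurable_wleb_density : measurable_fun [set: R] (fun x => `|w x|%R).
Proof. exact: measurableT_comp. Qed.

Let wleb0 : wleb set0 = 0. Proof. by rewrite /wleb integral_set0. Qed.

Let wleb_ge0 A : 0 <= wleb A.
Proof. by apply: integral_ge0 => x _; rewrite lee_fin. Qed.

Let wleb_sigma_additive : semi_sigma_additive wleb.
Proof.
move=> /= F mF tF mUF; rewrite /wleb; apply: cvg_toP.
  apply: ereal_nondecreasing_is_cvgn => m n mn.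
  apply: lee_sum_nneg_natr => // k _ _; apply: integral_ge0 => /= x _.
  by rewrite lee_fin.
rewrite ge0_integral_bigcup//=.
- apply/measurable_funTS/measurable_EFinP.
  exact: measurable_wleb_density.
Qed.

HB.instance Definition _ := isMeasure.Build _ _ _ wleb
  wleb0 wleb_ge0 wleb_sigma_additive.

Let wleb_sigma_finite : sigma_finite [set: measurableTypeR R] wleb.
Proof.
(* The cut at |w| <= n matters: for chi < 1/2 the weight (1 - t^2)^(chi - 1/2) is unbounded, and its
   integrability is derived later from Tonelli's theorem, which already asks for
   sigma-finiteness. *)
pose F (n : nat) := `[(- n%:R)%R, n%:R]%classic `&` [set x : R | (`|w x| <= n%:R)%R].
have mF n : measurable (F n).
  apply: measurableI => //.
  rewrite (_ : [set x | _] = (fun x => `|w x|%R) @^-1` `]-oo, n%:R]%classic).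
    rewrite -[X in measurable X]setTI.
    exact: (measurable_wleb_density measurableT (measurable_itv `]-oo, (n%:R:R)])).
  by apply/seteqP; split => x /=; rewrite in_itv.
exists F => [|n].
  apply/esym; rewrite -subTset => x _.
  exists (maxn (Num.bound x) (Num.bound (w x))) => //.
  have bnd (y : R) k : (Num.bound y <= k)%N -> (`|y| <= k%:R)%R.
    by move=> yk; rewrite (le_trans (ltW (unstable.ltr_norm_bound y)))// ler_nat.
  by split => /=; rewrite ?in_itv/= -?ler_norml bnd ?leq_maxl ?leq_maxr.
split; first exact: mF.
rewrite /wleb (@le_lt_trans _ _ (\int[leb]_(x in F n) (n%:R)%:E))//.
  apply: ge0_le_integral => //.
  - exact: mF.
  - apply/measurable_funTS/measurable_EFinP.
    exact: measurable_wleb_density.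
  - by move=> x [_ /=]; rewrite lee_fin.
rewrite integral_cst//=; last exact: mF.
rewrite lte_mul_pinfty ?lee_fin//.
rewrite (le_lt_trans (@le_measure _ _ _ leb _ `[(- n%:R)%R, n%:R]%classic _ _ _))//.
- by apply/mem_set; exact: mF.
- exact/mem_set.
- exact: subIsetl.
- rewrite [ltLHS](lebesgue_measure_itv `[(- n%:R)%R, n%:R])/=.
  by case: ifP => // _; rewrite -EFinB ltry.
Qed.

HB.instance Definition _ := Measure_isSigmaFinite.Build _ _ _ wleb
  wleb_sigma_finite.

Lemma ge0_integral_wleb (f : R -> \bar R) : measurable_fun [set: R] f ->
  (forall x, 0 <= f x) -> \int[wleb]_x f x = \int[leb]_x (f x * (`|w x|%R)%:E).
Proof.
by move=> mf f0; apply: ge0_integral_density => //; exact: measurable_wleb_density.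
Qed.

End weighted_lebesgue.

Section change_of_variables.
Variable R : realType.
Variables phi dphi : R -> R.
Hypothesis phi_drv : forall x, is_derive x (1 : R) phi (dphi x).
Hypothesis dphi_cont : continuous dphi.
Hypothesis dphi_ge0 : forall x, 0 <= dphi x.
Hypothesis phi_incr : {mono phi : x y / x <= y}.
Hypothesis phi_surj : forall y, exists x, phi x = y.
Local Notation leb := (@lebesgue_measure R).
Local Open Scope ereal_scope.

(** The pushforward under [phi] of the measure with density [dphi] gives ]a, b] the mass b - a by
    the fundamental theorem of calculus, so it is Lebesgue measure by uniqueness. *)
Lemma ge0_change_of_variables (f : R -> \bar R) : measurable_fun [set: R] f ->
  (forall x, 0 <= f x) ->
  \int[leb]_y f y = \int[leb]_x (f (phi x) * (dphi x)%:E).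
Proof.
move=> mf f0.
have mdphi : measurable_fun [set: R] dphi by exact: continuous_measurable_fun.
have cphi : continuous phi.
  by move=> x; apply/differentiable_continuous/derivable1_diffP; case: (phi_drv x).
have mphi : @measurable_fun _ _ (measurableTypeR R) (measurableTypeR R) setT phi.
  exact: continuous_measurable_fun.
pose w : {mfun R >-> R} := mfun_Sub (mem_set mdphi).
pose nu : {measure set (measurableTypeR R) -> \bar R} :=
  measure_function_pushforward__canonical__measure_function_Measure (wleb w) mphi.
have <- : \int[nu]_y f y = \int[leb]_y f y.
  apply: eq_measure_integral => /= A mA _; apply/esym.
  apply: (@lebesgue_measure_unique _ nu) => // _ [[a b]] _ <-.
  rewrite /nu/=.
  have [alpha alphaE] := phi_surj a; have [beta betaE] := phi_surj b.
  transitivity (wleb w `]alpha, beta]%classic); last first.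
    rewrite /pushforward; congr (wleb w _).
    by apply/seteqP; split => x /=;
      rewrite !in_itv/= -alphaE -betaE !ltNge !phi_incr.
  rewrite [LHS](lebesgue_measure_itv `]a, b])/= lte_fin.
  have [ab|ba] := ltP a b; last first.
    rewrite /wleb set_itv_ge ?integral_set0// bnd_simp -leNgt.
    by rewrite -phi_incr alphaE betaE.
  have {}ab : (alpha < beta)%R by rewrite ltNge -phi_incr -ltNge alphaE betaE.
  rewrite /wleb integral_itv_obnd_cbnd; last first.
    by apply/measurable_funTS/measurable_EFinP; exact: measurableT_comp.
  under eq_integral do rewrite ger0_norm//.
  rewrite (@continuous_FTC2 _ _ phi)//.
  - by rewrite alphaE betaE.
  - exact: continuous_subspaceT.
  - split; first by move=> x _; case: (phi_drv x).
    + by apply: cvg_at_right_filter; exact: cphi.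
    + by apply: cvg_at_left_filter; exact: cphi.
  - by move=> x _; rewrite derive1E; apply: (@derive_val _ _ _ _ _ _ _ (phi_drv x)).
rewrite [LHS](ge0_integral_pushforward mphi (wleb w) measurableT)//.
rewrite preimage_setT ge0_integral_wleb//.
- by apply: eq_integral => x _; rewrite /w /= ger0_norm.
- exact: measurableT_comp.
- by move=> x /=.
Qed.

End change_of_variables.

Section real_line.
Variable R : realType.
Local Notation leb := (@lebesgue_measure R).
Local Open Scope ereal_scope.
Implicit Types f : R -> \bar R.

Lemma ge0_integral_opp f : measurable_fun [set: R] f -> (forall x, 0 <= f x) ->
  \int[leb]_x f (- x)%R = \int[leb]_x f x.
Proof.
move=> mf f0.
have mN : @measurable_fun _ _ (measurableTypeR R) (measurableTypeR R) setT -%R.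
  exact: measurable_funN.
rewrite -[LHS](ge0_integral_pushforward mN leb measurableT)//.
by apply: eq_measure_integral => /= A mA _; exact: lebesgue_measureN.
Qed.

Lemma ge0_integral_scale f (a : R) : a != 0%R ->
  measurable_fun [set: R] f -> (forall x, 0 <= f x) ->
  \int[leb]_x f (a * x)%R = (`|a|^-1)%:E * \int[leb]_x f x.
Proof.
move=> a0 mf f0.
wlog {a0} a0 : a / (0 < a)%R => [hwlog|].
  move: a0; rewrite neq_lt => /orP[a0|a0]; last by rewrite hwlog.
  rewrite -normrN -hwlog ?oppr_gt0//.
  rewrite -[RHS]ge0_integral_opp//; last first.
    apply: (measurableT_comp mf); exact: measurable_funM.
  by apply: eq_integral => x _; rewrite mulrNN.
rewrite (@ge0_change_of_variables _ (fun x => a * x)%R (cst a) _ _ _ _ _ f)//.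
- under [X in _ * X]eq_integral do rewrite muleC /=.
  rewrite ge0_integralZl_EFin//; last 2 first.
  + by apply: (measurableT_comp mf); exact: measurable_funM.
  + exact: ltW.
  by rewrite muleA -EFinM gtr0_norm// mulVf ?mul1e// gt_eqF.
- move=> x; have := @is_deriveZ _ _ _ (id : R -> R) a x (1%R : R) (1%R : R) _.
    move=> /(_ (is_derive_id _ _)).
  by rewrite /= scaler1.
- by move=> x; exact: cst_continuous.
- by move=> x; exact: ltW.
- by move=> x y; rewrite ler_pM2l.
- by move=> y; exists (a^-1 * y)%R; rewrite mulrA divff ?mul1r// gt_eqF.
Qed.

Lemma ge0_integral_translate f (a : R) :
  measurable_fun [set: R] f -> (forall x, 0 <= f x) ->
  \int[leb]_x f (x + a)%R = \int[leb]_x f x.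
Proof.
move=> mf f0.
rewrite [RHS](@ge0_change_of_variables _ (fun x => x + a)%R (cst 1%R) _ _ _ _ _ f)//.
- by under [RHS]eq_integral do rewrite mule1.
- move=> x; have := @is_deriveD _ _ _ (id : R -> R) (cst a) x (1%R : R) (1%R : R) 0%R.
    move=> /(_ (is_derive_id _ _) (is_derive_cst _ _ _)).
  by rewrite addr0.
- by move=> x; exact: cst_continuous.
- by move=> x y; rewrite lerD2r.
- by move=> y; exists (y - a)%R; rewrite subrK.
Qed.

Lemma ge0_integral_norm f : measurable_fun [set: R] f -> (forall x, 0 <= f x) ->
  \int[leb]_x f `|x|%R = 2%:E * \int[leb]_(x in `[0%R, +oo[) f x.
Proof.
move=> mf f0.
have mfn : measurable_fun [set: R] (fun x => f `|x|%R) by exact: measurableT_comp.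
rewrite -(setUv `[0%R, +oo[%classic) ge0_integral_setU//=; last 3 first.
- exact: measurableC.
- by rewrite setUv.
- exact/disj_setPCl.
rewrite mule_natl mule2n; congr (_ + _).
  by apply: eq_integral => x; rewrite inE/= in_itv/= andbT => x0; rewrite ger0_norm.
rewrite setCitvr integral_itv_bndo_bndc; last exact: measurable_funTS.
rewrite ge0_integration_by_substitution0//.
by apply: eq_integral => x; rewrite inE/= in_itv/= => x0; rewrite ler0_norm.
Qed.

(** The map x |x| is an increasing C^1 bijection of the line that agrees with the square on the
    positive half-line, so the change of variables applies to squaring. At 0 the derivative comes
    from Caratheodory's criterion, elsewhere from the local formula sgn(x) y^2. *)
Lemma is_derive_sqr_signed (x : R) :
  is_derive x (1%R : R) (fun x : R => x * `|x|)%R (2 * `|x|)%R.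
Proof.
have [->|x0] := eqVneq x 0%R.
  apply/is_derive1_caratheodory; exists (fun z => `|z|%R); split.
  - by move=> z; rewrite normr0 mulr0 !subr0 mulrC.
  - exact: norm_continuous.
  - by rewrite normr0 mulr0.
have xsg : \forall y \near x, (Num.sg x * y ^+ 2 = y * `|y|)%R.
  move: x0; rewrite neq_lt => /orP[x0|x0].
    near=> y; rewrite ltr0_sg// ltr0_norm; first by rewrite expr2; ring.
    by near: y; exact: lt_nbhsl.
  near=> y; rewrite gtr0_sg// gtr0_norm; first by rewrite expr2; ring.
  by near: y; exact: lt_nbhsr.
apply: (near_eq_is_derive xsg).
have := @is_deriveZ _ _ _ ((id : R -> R) ^+ 2)%R (Num.sg x) x (1%R : R) _
  (is_deriveX 2 (is_derive_id _ _)).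
rewrite /GRing.scale/= mulr1 expr1 mulrCA -normrEsg.
by apply.
Unshelve. all: by end_near. Qed.

Lemma ge0_integral_sqr f : measurable_fun [set: R] f -> (forall x, 0 <= f x) ->
  \int[leb]_x (f (x ^+ 2)%R * `|x|%:E) = \int[leb]_(x in `[0%R, +oo[) f x.
Proof.
move=> mf f0.
have mfn : measurable_fun [set: R] (fun x => f `|x|%R) by exact: measurableT_comp.
(* The even extension of f is used: its integral over the line is twice that over the half-line, and
   the derivative 2|x| brings the same factor 2 to the other side. *)
have := @ge0_change_of_variables _ (fun x => x * `|x|)%R (fun x => 2 * `|x|)%R
   is_derive_sqr_signed _ _ _ _ _ mfn (fun=> f0 _).
rewrite ge0_integral_norm// => /(_ _ _ _ _)/esym H.
have H2 : 2%:E * \int[leb]_x (f (x ^+ 2)%R * `|x|%:E) =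
          2%:E * \int[leb]_(x in `[0%R, +oo[) f x.
  rewrite -H.
  - rewrite -ge0_integralZl_EFin//.
    + apply: eq_integral => x _; rewrite normrM normr_id -expr2.
      by rewrite real_normK ?num_real// EFinM muleCA.
    + by move=> x _; rewrite mule_ge0.
    + apply: emeasurable_funM; last exact/measurable_EFinP.
      by apply: (measurableT_comp mf); exact: measurable_funX.
  - move=> x; apply: (@cvgM _ R); first exact: cvg_cst.
    exact: (@norm_continuous _ R).
  - by move=> x; rewrite mulr_ge0.
  - move=> x y.
    have [x0|x0] := ltP x 0%R; have [y0|y0] := ltP y 0%R; rewrite ?(ltr0_norm x0) ?(ltr0_norm y0) ?(ger0_norm x0) ?(ger0_norm y0).
    + by apply/idP/idP => xy; nra.
    + by apply/idP/idP => xy; nra.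
    + by apply/idP/idP => xy; nra.
    + by apply/idP/idP => xy; nra.
  - move=> y; exists (Num.sg y * Num.sqrt `|y|)%R.
    rewrite normrM (ger0_norm (sqrtr_ge0 _)) mulrACA -expr2 sqr_sqrtr//.
    have [->|y0] := eqVneq y 0%R; first by rewrite normr0 mulr0.
    by rewrite normr_sg y0 mulr1 -numEsg.
have := congr1 (fun z => (2^-1)%:E * z) H2.
by rewrite !muleA -!EFinM mulVf// !mul1e.
Qed.

End real_line.

(** * Gaussian and Gamma integrals *)

Section gaussian.
Variable R : realType.
Local Notation leb := (@lebesgue_measure R).
Local Open Scope ereal_scope.

Definition gs (p x : R) : R := expR (- (p / 2 * x ^+ 2)).

Lemma gs_ge0 p x : (0 <= gs p x)%R. Proof. exact: expR_ge0. Qed.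

Lemma gsN p x : gs p (- x) = gs p x. Proof. by rewrite /gs sqrrN. Qed.

Lemma gsD p q x : (gs p x * gs q x = gs (p + q) x)%R.
Proof. by rewrite /gs -expRD; congr expR; rewrite -opprD !mulrDl. Qed.

Lemma continuous_gs p : continuous (gs p).
Proof.
move=> x; apply: (@continuous_comp _ _ _ (fun x : R => - (p / 2 * x ^+ 2))%R expR).
  apply: (@cvgN R R^o); apply: (@cvgM R); first exact: cvg_cst.
  exact: exprn_continuous.
exact: continuous_expR.
Qed.

Lemma measurable_gs p : measurable_fun [set: R] (gs p).
Proof.
apply: measurableT_comp => //; apply: measurable_funN.
by apply: measurable_funM => //; exact: measurable_funX.
Qed.

Lemma integral_gs p : (0 < p)%R -> \int[leb]_x (gs p x)%:E = (Num.sqrt (2 / p * pi))%:E.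
Proof.
move=> p0; pose a : R := Num.sqrt (p / 2).
have a0 : (0 < a)%R by rewrite sqrtr_gt0 divr_gt0.
transitivity (\int[leb]_x (gauss_fun (a * x))%:E).
  apply: eq_integral => x _; rewrite /gs /gauss_fun exprMn sqr_sqrtr//.
  by rewrite divr_ge0// ltW.
rewrite (ge0_integral_scale (f := EFin \o gauss_fun)) ?gt_eqF//=.
- rewrite integralT_gauss -EFinM gtr0_norm// /a -sqrtrV ?divr_ge0 ?ltW// invf_div.
  by rewrite -sqrtrM// divr_ge0// ltW.
- by apply/measurable_EFinP; exact: measurable_gauss_fun.
- by move=> x; rewrite lee_fin gauss_fun_ge0.
Qed.

Lemma measurable_norm_powR (q : R) :
  measurable_fun [set: R] (fun x : R => `|x| `^ q)%R.
Proof.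
apply: (measurableT_comp (@measurable_powR R _)).
exact: (@normr_measurable R setT).
Qed.

(** Half of the Gaussian exponent absorbs the power, the other half remains for integrability. *)
Lemma powR_le_gs (q p : R) : (0 <= q)%R -> (0 < p)%R ->
  exists2 C, (0 <= C)%R & forall x, (`|x| `^ q * gs p x <= C * gs (p / 2) x)%R.
Proof.
move=> q0 p0; pose n := Num.bound q.
have qn : (q <= n%:R)%R by rewrite ltW// (le_lt_trans (ler_norm _))// unstable.ltr_norm_bound.
have C0 : (0 <= n.+1`!%:R * (p / 4) ^- n.+1)%R.
  by rewrite mulr_ge0// invr_ge0 exprn_ge0// divr_ge0// ltW.
(* The summand 1 serves |x| <= 1. For |x| > 1, |x|^q <= (x^2)^(n+1), and z^(n+1)/(n+1)! <= exp z
   with z = p x^2/4 gives the other summand. *)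
exists (1 + n.+1`!%:R * (p / 4) ^- n.+1)%R; first by rewrite addr_ge0.
move=> x; rewrite -(_ : gs (p / 2) x * gs (p / 2) x = gs p x)%R; last first.
  by rewrite gsD -splitr.
rewrite mulrA ler_wpM2r ?gs_ge0//.
rewrite /gs expRN ler_pdivrMr ?expR_gt0//.
set z := (p / 2 / 2 * x ^+ 2)%R.
have z0 : (0 <= z)%R by rewrite /z mulr_ge0 ?sqr_ge0// !divr_ge0// ltW.
have [x1|x1] := leP `|x|%R 1%R.
  rewrite (@le_trans _ _ 1%R)//.
    by have := ge0_ler_powR q0 (normr_nneg x) (ler01 : 1%R \in Num.nneg) x1; rewrite powR1.
  rewrite mulrDl mul1r (@le_trans _ _ (expR z))//; first by rewrite -expR0 ler_expR.
  by rewrite lerDl mulr_ge0 ?expR_ge0.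
rewrite (@le_trans _ _ (n.+1`!%:R * (p / 4) ^- n.+1 * expR z))%R//; last first.
  by rewrite mulrDl lerDr mul1r expR_ge0.
rewrite (@le_trans _ _ (`|x| `^ n%:R))%R//.
  by rewrite ler_powR// ltW.
rewrite powR_mulrn// (@le_trans _ _ ((x ^+ 2) ^+ n.+1)%R)//.
  rewrite -real_normK ?num_real// -exprM ler_weXn2l ?(ltW x1)//.
  by rewrite mul2n -addnn (leq_trans (leqnSn n))// leq_addr.
have := expR_ge1Dxn n z0.
move=> /(le_trans _) => /(_ (z ^+ n.+1 / n.+1`!%:R)%R); rewrite lerDr ler01 => /(_ isT).
rewrite ler_pdivrMr ?ltr0n ?fact_gt0// => zn.
rewrite mulrAC ler_pdivlMr ?exprn_gt0 ?divr_gt0// -exprMn [leRHS]mulrC.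
have -> : (x ^+ 2 * (p / 4) = z)%R by rewrite /z; clear; field.
exact: zn.
Qed.

Lemma integral_powR_gs_lty (q p : R) : (0 <= q)%R -> (0 < p)%R ->
  \int[leb]_x (`|x| `^ q * gs p x)%:E < +oo.
Proof.
move=> q0 p0; have [C C0 Cq] := powR_le_gs q0 p0.
apply: (@le_lt_trans _ _ (\int[leb]_x (C%:E * (gs (p / 2) x)%:E))).
  apply: ge0_le_integral => //.
  - by move=> x _; rewrite lee_fin mulr_ge0// ?powR_ge0// gs_ge0.
  - apply/measurable_EFinP/measurable_funM; last exact: measurable_gs.
    exact: measurable_norm_powR.
  - by apply: emeasurable_funM => //; apply/measurable_EFinP; exact: measurable_gs.
  - by move=> x _; rewrite -EFinM lee_fin.
rewrite ge0_integralZl_EFin//.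
- by rewrite integral_gs ?divr_gt0// -EFinM ltry.
- by move=> x _; rewrite lee_fin gs_ge0.
- apply/measurable_EFinP; exact: measurable_gs.
Qed.

End gaussian.

Lemma ge0_integral_gt0 d (T : measurableType d) (R : realType)
    (mu : {measure set T -> \bar R}) (D : set T) (f : T -> \bar R) :
  measurable D -> (0 < mu D)%E -> measurable_fun D f ->
  (forall x, D x -> (0 < f x)%E) -> (0 < \int[mu]_(x in D) f x)%E.
Proof.
move=> mD D0 mf f0; rewrite lt_neqAle; apply/andP; split; last first.
  by apply: integral_ge0 => t Dt; exact/ltW/f0.
apply/eqP => /esym e0.
have : (\int[mu]_(x in D) `|f x| = 0)%E.
  by rewrite -[RHS]e0; apply: eq_integral => t /[!inE] Dt; rewrite gee0_abs// ltW// f0.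
move=> /(ae_eq_integral_abs mu mD mf) [N [mN N0 sN]].
have : (mu D <= mu N)%E.
  apply: le_measure; rewrite ?inE// => t Dt; apply: sN => /= /(_ Dt) f0t.
  by move: (f0 _ Dt); rewrite f0t ltxx.
by rewrite N0 leNgt D0.
Qed.

(** * The Gamma integral: finiteness and positivity *)

Section gamma.
Variable R : realType.
Local Notation leb := (@lebesgue_measure R).
Local Open Scope ereal_scope.

(** Kept in the extended reals because [Gamma] returns 0 on a divergent integral; finiteness has to
    be settled before the two are identified. *)
Definition egamma (s : R) : \bar R :=
  \int[leb]_(t in `]0%R, +oo[) (t `^ (s - 1) * expR (- t))%:E.

Lemma measurable_gamma_integrand (s : R) :
  measurable_fun [set: R] (fun t => t `^ (s - 1) * expR (- t))%R.
Proof.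
apply: measurable_funM; first exact: measurable_powR.
by apply: measurableT_comp => //; exact: measurable_funN.
Qed.

(** Substituting t = x^2 gives a Gaussian moment of order 2s - 1, nonnegative exactly when s >= 1/2.
    The arguments chi + 1/2 and chi + 1 that occur later lie in this range. *)
Lemma egamma_lty s : (2^-1 <= s)%R -> egamma s < +oo.
Proof.
move=> s2; rewrite /egamma integral_itv_obnd_cbnd; last first.
  apply/measurable_funTS/measurable_EFinP; exact: measurable_gamma_integrand.
rewrite -ge0_integral_sqr; last 2 first.
  apply/measurable_EFinP; exact: measurable_gamma_integrand.
  by move=> x; rewrite lee_fin mulr_ge0// ?powR_ge0// expR_ge0.
apply: (@le_lt_trans _ _ (\int[leb]_x (`|x| `^ (2 * s - 1) * gs 2 x)%:E)).
  apply: ge0_le_integral => //.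
  - by move=> x _; rewrite -EFinM lee_fin !mulr_ge0// ?powR_ge0// expR_ge0.
  - under eq_fun do rewrite -EFinM.
    apply/measurable_EFinP/measurable_funM => //.
    by apply: (measurableT_comp (measurable_gamma_integrand s)); exact: measurable_funX.
  - apply/measurable_EFinP/measurable_funM; last exact: measurable_gs.
    exact: measurable_norm_powR.
  - move=> x _; rewrite -EFinM lee_fin.
    (* Exponents are added by [powRD], which asks for a nonzero base here; at 0 the factor |x| makes
       the left side vanish. *)
    have [->|x0] := eqVneq x 0%R.
      by rewrite normr0 mulr0 mulr_ge0// ?powR_ge0// gs_ge0.
    rewrite /gs divff// mul1r mulrAC ler_wpM2r ?expR_ge0//.
    rewrite -real_normK ?num_real// -powR_mulrn// -powRrM.
    rewrite -[X in (_ * X)%R]powRr1// -powRD; last by rewrite normr_eq0 x0 implybT.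
    by rewrite le_eqVlt; apply/orP; left; apply/eqP; congr powR; ring.
apply: integral_powR_gs_lty => //; lra.
Qed.

Lemma egamma_gt0 s : 0 < egamma s.
Proof.
apply: ge0_integral_gt0 => //.
- by rewrite [ltRHS](lebesgue_measure_itv `]0%R, +oo[)/= ltry sube0 ltry.
- apply/measurable_funTS/measurable_EFinP; exact: measurable_gamma_integrand.
- move=> t; rewrite /= in_itv/= andbT => t0.
  by rewrite lte_fin mulr_gt0// ?powR_gt0// expR_gt0.
Qed.

Lemma GammaE (s : R) : (2^-1 <= s)%R -> (Gamma s)%:E = egamma s.
Proof.
move=> s2; rewrite /Gamma/Rintegral fineK// ge0_fin_numE ?egamma_lty//.
exact/ltW/egamma_gt0.
Qed.

Lemma Gamma_gt0 (s : R) : (2^-1 <= s)%R -> (0 < Gamma s)%R.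
Proof. by move=> s2; rewrite -lte_fin GammaE// egamma_gt0. Qed.

End gamma.

(** * The Dunkl kernel on Gaussians *)

Section curried_tonelli.
Variable R : realType.
Variables m1 m2 : {sigma_finite_measure set (measurableTypeR R) -> \bar R}.
Variable F : R -> R -> \bar R.
Hypothesis mF : measurable_fun [set: R * R] (fun z => F z.1 z.2).
Hypothesis F0 : forall x y, (0 <= F x y)%E.
Local Open Scope ereal_scope.

Lemma measurable_integral1 : measurable_fun [set: R] (fun x => \int[m2]_y F x y).
Proof.
exact: (@measurable_fun_fubini_tonelli_F _ _ (measurableTypeR R)
  (measurableTypeR R) _ m2 (fun z => F z.1 z.2) mF (fun z => F0 z.1 z.2)).
Qed.

Lemma tonelli_swap :
  \int[m1]_x \int[m2]_y F x y = \int[m2]_y \int[m1]_x F x y.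
Proof.
exact: (@fubini_tonelli _ _ (measurableTypeR R) (measurableTypeR R) _ m1 m2
  (fun z => F z.1 z.2) mF (fun z => F0 z.1 z.2)).
Qed.

End curried_tonelli.

Section key_identity.
Variable R : realType.
Variable chi : R.
Hypothesis chi_ge0 : 0 <= chi.
Local Notation leb := (@lebesgue_measure R).

(* [powR] of a negative number is 1, hence the explicit cut-off. *)
Definition rpow (r : R) : R := if 0 <= r then r `^ (chi - 2^-1) else 0.
Definition bw (t : R) : R := rpow (1 - t ^+ 2).
Definition dw (x : R) : R := `|x| `^ (2 * chi + 1).

Lemma rpow_ge0 r : 0 <= rpow r.
Proof. by rewrite /rpow; case: ifP => // _; exact: powR_ge0. Qed.

Lemma bw_ge0 t : 0 <= bw t. Proof. exact: rpow_ge0. Qed.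

Lemma dw_ge0 x : 0 <= dw x. Proof. exact: powR_ge0. Qed.

Lemma bwN t : bw (- t) = bw t. Proof. by rewrite /bw sqrrN. Qed.

Lemma dwN x : dw (- x) = dw x. Proof. by rewrite /dw normrN. Qed.

Lemma measurable_rpow : measurable_fun [set: R] rpow.
Proof.
apply: measurable_fun_ifT; [exact: measurable_fun_ler|exact: measurable_powR|].
exact: measurable_cst.
Qed.

Lemma measurable_bw : measurable_fun [set: R] bw.
Proof.
apply: (measurableT_comp measurable_rpow).
by apply: measurable_funB => //; exact: measurable_funX.
Qed.

Lemma measurable_dw : measurable_fun [set: R] dw.
Proof. exact: measurable_norm_powR. Qed.

HB.instance Definition _ := isMeasurableFun.Build _ _ _ _ bw measurable_bw.
HB.instance Definition _ := isMeasurableFun.Build _ _ _ _ dw measurable_dw.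

(* |x|^(2 chi + 1) dx, and (1 - t^2)^(chi - 1/2) dt on [-1, 1]. *)
Definition nu := wleb dw.
Definition om := wleb bw.
HB.instance Definition _ := SigmaFiniteMeasure.on nu.
HB.instance Definition _ := SigmaFiniteMeasure.on om.

Local Open Scope ereal_scope.

Lemma ge0_integral_nu (f : R -> \bar R) : measurable_fun [set: R] f ->
  (forall x, 0 <= f x) -> \int[nu]_x f x = \int[leb]_x (f x * (dw x)%:E).
Proof.
move=> mf f0; rewrite ge0_integral_wleb//.
by apply: eq_integral => x _; rewrite ger0_norm// dw_ge0.
Qed.

Lemma ge0_integral_om (f : R -> \bar R) : measurable_fun [set: R] f ->
  (forall x, 0 <= f x) -> \int[om]_x f x = \int[leb]_x (f x * (bw x)%:E).
Proof.
move=> mf f0; rewrite ge0_integral_wleb//.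
by apply: eq_integral => x _; rewrite ger0_norm// bw_ge0.
Qed.

(** What is left of the integral once r = x^2 - u^2 is separated from u. Its value is a Gamma
    integral, found in [key_constE]. *)
Definition key_const (p : R) : \bar R := \int[leb]_r (rpow r * expR (- (p / 2 * r)))%:E.

(** Homogeneity: |x|^(2 chi + 1) = x^2 (x^2)^(chi - 1/2), and the second factor merges with (1 -
    (u/x)^2)^(chi - 1/2). *)
Lemma dw_bw (x u : R) : (x != 0 -> dw x * bw (x^-1 * u) = x ^+ 2 * rpow (x ^+ 2 - u ^+ 2))%R.
Proof.
move=> x0; have x20 : (0 < x ^+ 2)%R by rewrite exprn_even_gt0.
rewrite /dw /bw /rpow.
have -> : (x ^+ 2 - u ^+ 2 = x ^+ 2 * (1 - (x^-1 * u) ^+ 2))%R by field.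
rewrite pmulr_rge0//; case: ifPn => [r0|_]; last by rewrite !mulr0.
rewrite [in RHS]powRM ?(ltW x20)// [RHS]mulrA; congr (_ * _)%R.
rewrite -real_normK ?num_real// -powR_mulrn// -powRrM -powRD; last first.
  by rewrite normr_eq0 x0 implybT.
by congr powR; field.
Qed.

(** Substitute u = x t: the factor x^2 of [dw_bw] divided by the Jacobian |x| leaves the single |x|
    that the substitution r = x^2 needs. At x = 0 the weight vanishes, since 2 chi + 1 is not 0. *)
Lemma key_inner (phi : R -> \bar R) (x : R) : measurable_fun [set: R] phi ->
  (forall u, 0 <= phi u) ->
  (dw x)%:E * \int[om]_t phi (x * t)%R =
  `|x|%:E * \int[leb]_u (phi u * (rpow (x ^+ 2 - u ^+ 2))%:E).
Proof.
move=> mphi phi0.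
have [->|x0] := eqVneq x 0%R.
  rewrite /dw normr0 powR0 ?mul0e//; apply: lt0r_neq0; move: chi_ge0; lra.
have mxt : measurable_fun [set: R] (fun t => phi (x * t)%R).
  by apply: (measurableT_comp mphi); exact: measurable_funM.
rewrite (ge0_integral_om mxt (fun t => phi0 _)).
have mf : measurable_fun [set: R] (fun t => phi (x * t)%R * (bw t)%:E).
  by apply: emeasurable_funM => //; apply/measurable_EFinP; exact: measurable_bw.
have f0 t : 0 <= phi (x * t)%R * (bw t)%:E by rewrite mule_ge0// lee_fin bw_ge0.
transitivity (\int[leb]_t ((dw x)%:E * (phi (x * t)%R * (bw t)%:E))).
  by rewrite (ge0_integralZl_EFin leb measurableT (fun t _ => f0 t) mf (dw_ge0 x)).
have mr : measurable_fun [set: R] (fun u => phi u * (rpow (x ^+ 2 - u ^+ 2))%:E).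
  apply: emeasurable_funM => //; apply/measurable_EFinP.
  apply: (measurableT_comp measurable_rpow).
  by apply: measurable_funB => //; exact: measurable_funX.
have r0 u : 0 <= phi u * (rpow (x ^+ 2 - u ^+ 2))%:E.
  by rewrite mule_ge0// lee_fin rpow_ge0.
transitivity (\int[leb]_t ((x ^+ 2)%:E * (phi (x * t)%R * (rpow (x ^+ 2 - (x * t) ^+ 2))%:E))).
  apply: eq_integral => t _; rewrite muleCA [RHS]muleCA -!EFinM.
  by rewrite -dw_bw// mulKf.
have mrx : measurable_fun [set: R]
    (fun t => phi (x * t)%R * (rpow (x ^+ 2 - (x * t) ^+ 2))%:E).
  by apply: (measurableT_comp mr); exact: measurable_funM.
rewrite (ge0_integralZl_EFin leb measurableT (fun t _ => r0 (x * t)%R) mrx (sqr_ge0 x)).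
rewrite (ge0_integral_scale (f := fun u => phi u * (rpow (x ^+ 2 - u ^+ 2))%:E) x0 mr r0).
rewrite muleA -EFinM; congr (_%:E * _).
by rewrite -real_normK ?num_real// expr2 mulfK// normr_eq0.
Qed.

Lemma key_outer (p u : R) :
  \int[leb]_x ((gs p x)%:E * (`|x|%:E * (rpow (x ^+ 2 - u ^+ 2))%:E)) =
  (gs p u)%:E * key_const p.
Proof.
pose g (r : R) := (expR (- (p / 2 * r)) * rpow (r - u ^+ 2))%R.
have mg : measurable_fun [set: R] g.
  apply: measurable_funM.
    by apply: measurableT_comp => //; apply: measurable_funN; exact: measurable_funM.
  by apply: (measurableT_comp measurable_rpow); exact: measurable_funB.
have g0 r : (0 <= g r)%R by rewrite mulr_ge0 ?expR_ge0 ?rpow_ge0.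
transitivity (\int[leb]_x ((EFin \o g) (x ^+ 2)%R * `|x|%:E)).
  by apply: eq_integral => x _; rewrite /= /g /gs EFinM muleAC muleA.
rewrite ge0_integral_sqr//; last exact/measurable_EFinP.
rewrite integral_mkcond.
(* For r < 0 also r - u^2 < 0, where the cut-off in [rpow] makes g vanish; the half-line can thus be
   enlarged to the line, on which the translation by u^2 is available. *)
transitivity (\int[leb]_r (EFin \o g) r).
  apply: eq_integral => r _; rewrite patchE; case: ifPn => //.
  rewrite notin_setE/= in_itv/= andbT => /negP; rewrite -ltNge => r0.
  rewrite /g /rpow ifF ?mulr0//; apply/negbTE; rewrite -ltNge.
  by rewrite (lt_le_trans _ (lexx 0%R))// subr_lt0 (lt_le_trans r0)// sqr_ge0.
rewrite -(ge0_integral_translate (u ^+ 2) (f := EFin \o g))//; last exact/measurable_EFinP.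
have mh : measurable_fun [set: R] (fun r => (rpow r * expR (- (p / 2 * r)))%:E).
  apply/measurable_EFinP/measurable_funM; first exact: measurable_rpow.
  by apply: measurableT_comp => //; apply: measurable_funN; exact: measurable_funM.
have h0 r : 0 <= (rpow r * expR (- (p / 2 * r)))%:E.
  by rewrite lee_fin mulr_ge0 ?expR_ge0 ?rpow_ge0.
rewrite /key_const -(ge0_integralZl_EFin leb measurableT (fun t _ => h0 t) mh (gs_ge0 p u)).
apply: eq_integral => r _; rewrite /= /g addrK -EFinM; congr EFin.
have -> : expR (- (p / 2 * (r + u ^+ 2))) = (gs p u * expR (- (p / 2 * r)))%R.
  by rewrite /gs -expRD -opprD -mulrDr addrC.
by rewrite -mulrA [(expR _ * _)%R]mulrC.
Qed.

(* Put u = x t, then r = x^2 - u^2: the Gaussian factors as a function of u times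
   a function of r, so no Beta integral has to be evaluated. *)
Lemma key_identity (phi : R -> \bar R) (p : R) : measurable_fun [set: R] phi ->
  (forall u, 0 <= phi u) ->
  \int[nu]_x ((gs p x)%:E * \int[om]_t phi (x * t)%R) =
  key_const p * \int[leb]_u (phi u * (gs p u)%:E).
Proof.
move=> mphi phi0.
have mphixt : measurable_fun [set: R * R] (fun z => phi (z.1 * z.2)%R).
  apply: (measurableT_comp mphi); exact: measurable_funM.
have mI : measurable_fun [set: R] (fun x => \int[om]_t phi (x * t)%R).
  exact: (measurable_integral1 om (F := fun x t => phi (x * t)%R) mphixt).
have I0 x : 0 <= \int[om]_t phi (x * t)%R by exact: integral_ge0.
rewrite ge0_integral_nu; last 2 first.
- by apply: emeasurable_funM => //; apply/measurable_EFinP; exact: measurable_gs.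
- by move=> x; rewrite mule_ge0// lee_fin gs_ge0.
pose F (x u : R) := (gs p x)%:E * (`|x|%:E * (phi u * (rpow (x ^+ 2 - u ^+ 2))%:E)).
have F0 x u : 0 <= F x u.
  by rewrite !mule_ge0// lee_fin ?gs_ge0 ?rpow_ge0.
have mF : measurable_fun [set: R * R] (fun z => F z.1 z.2).
  apply: emeasurable_funM.
    by apply/measurable_EFinP/(measurableT_comp (@measurable_gs _ _)).
  apply: emeasurable_funM.
    apply/measurable_EFinP; exact: measurableT_comp.
  apply: emeasurable_funM; first exact: (measurableT_comp mphi).
  apply/measurable_EFinP/(measurableT_comp measurable_rpow).
  by apply: measurable_funB; exact: measurable_funX.
transitivity (\int[leb]_x \int[leb]_u F x u).
  apply: eq_integral => x _; rewrite -muleA [_ * (dw x)%:E]muleC key_inner//.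
  have mh : measurable_fun [set: R] (fun u => phi u * (rpow (x ^+ 2 - u ^+ 2))%:E).
    apply: emeasurable_funM => //; apply/measurable_EFinP.
    apply: (measurableT_comp measurable_rpow).
    by apply: measurable_funB => //; exact: measurable_funX.
  have h0 u : 0 <= phi u * (rpow (x ^+ 2 - u ^+ 2))%:E.
    by rewrite mule_ge0// lee_fin rpow_ge0.
  rewrite -(ge0_integralZl_EFin leb measurableT (fun u _ => h0 u) mh (normr_ge0 x)).
  rewrite -(ge0_integralZl_EFin leb measurableT _ _ (gs_ge0 p x))//.
  - by move=> u _; rewrite mule_ge0.
  - exact: emeasurable_funM.
rewrite (tonelli_swap leb leb mF F0).
transitivity (\int[leb]_u (phi u * (gs p u)%:E * key_const p)).
  apply: eq_integral => u _; rewrite /F/= -muleA -key_outer.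
  rewrite -ge0_integralZl//; last 2 first.
  + apply/measurable_EFinP/measurable_funM; first exact: measurable_gs.
    apply: measurable_funM; first exact: (@normr_measurable R setT).
    apply: (measurableT_comp measurable_rpow).
    by apply: measurable_funB => //; exact: measurable_funX.
  + by move=> x _; rewrite !mule_ge0// lee_fin ?gs_ge0 ?rpow_ge0.
  by apply: eq_integral => x _; rewrite [X in _ * X = _]muleCA [LHS]muleCA.
rewrite ge0_integralZr; [by rewrite muleC|by []|..].
- by apply: emeasurable_funM => //; apply/measurable_EFinP; exact: measurable_gs.
- by move=> u _; rewrite mule_ge0// lee_fin gs_ge0.
- by apply: integral_ge0 => r _; rewrite lee_fin mulr_ge0 ?expR_ge0 ?rpow_ge0.
Qed.

End key_identity.

Section key_consequences.
Variable R : realType.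
Variable chi : R.
Hypothesis chi_ge0 : 0 <= chi.
Local Notation leb := (@lebesgue_measure R).
Local Notation nu := (nu chi).
Local Notation om := (om chi).
Local Open Scope ereal_scope.

Lemma measurable_rpow_exp (p : R) :
  measurable_fun [set: R] (fun r => rpow chi r * expR (- (p / 2 * r)))%R.
Proof.
apply: measurable_funM; first exact: measurable_rpow.
by apply: measurableT_comp => //; apply: measurable_funN; exact: measurable_funM.
Qed.

Lemma key_constE (p : R) : (0 < p)%R ->
  key_const chi p = ((2 / p) `^ (chi + 2^-1) * Gamma (chi + 2^-1))%:E.
Proof.
move=> p0; have a0 : (0 < 2 / p)%R by rewrite divr_gt0.
pose g r := (rpow chi r * expR (- (p / 2 * r)))%:E.
have mg : measurable_fun [set: R] g.
  by apply/measurable_EFinP; exact: measurable_rpow_exp.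
have g0 r : 0 <= g r by rewrite lee_fin mulr_ge0 ?rpow_ge0 ?expR_ge0.
have := ge0_integral_scale (lt0r_neq0 a0) mg g0.
rewrite gtr0_norm// => H.
have {H} -> : key_const chi p = (2 / p)%:E * \int[leb]_x g (2 / p * x)%R.
  by rewrite H muleA -EFinM divff ?gt_eqF// mul1e.
pose h r := (rpow chi r * expR (- r))%:E.
have mh : measurable_fun [set: R] h.
  apply/measurable_EFinP/measurable_funM; first exact: measurable_rpow.
  by apply: measurableT_comp => //; exact: measurable_funN.
have h0 r : 0 <= h r by rewrite lee_fin mulr_ge0 ?rpow_ge0 ?expR_ge0.
have -> : \int[leb]_x g (2 / p * x)%R = \int[leb]_x (((2 / p) `^ (chi - 2^-1))%:E * h x).
  apply: eq_integral => x _; rewrite /g /h -EFinM; congr EFin.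
  have -> : (p / 2 * (2 / p * x) = x)%R by field; rewrite gt_eqF.
  rewrite [RHS]mulrA; congr (_ * _)%R.
  rewrite /rpow pmulr_rge0//; case: ifPn => x0; last by rewrite mulr0.
  by rewrite powRM// ltW.
rewrite (ge0_integralZl_EFin leb measurableT (fun t _ => h0 t) mh (powR_ge0 _ _)).
have -> : \int[leb]_x h x = egamma (chi + 2^-1).
  rewrite /egamma integral_itv_obnd_cbnd; last first.
    apply/measurable_funTS/measurable_EFinP; exact: measurable_gamma_integrand.
  rewrite [RHS]integral_mkcond; apply: eq_integral => x _; rewrite patchE.
  have [x0|x0] := boolP (x \in _); move: x0; rewrite ?notin_setE ?inE/= in_itv/= andbT.
    by move=> x0; rewrite /h /rpow x0; congr ((_ `^ _) * _)%:E; field.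
  by move=> /negP/negbTE x0; rewrite /h /rpow x0 mul0r.
rewrite -GammaE; last by move: chi_ge0; lra.
rewrite -!EFinM mulrA; congr (_ * _)%:E.
rewrite -[X in (X * _)%R]powRr1 ?(ltW a0)// -powRD; last by rewrite (gt_eqF a0) implybT.
by congr powR; field.
Qed.

Lemma integral_nu_gs (q p : R) : (0 <= q)%R -> (0 < p)%R ->
  \int[nu]_x (`|x| `^ q * gs p x)%:E < +oo.
Proof.
move=> q0 p0; rewrite ge0_integral_nu; last 2 first.
- apply/measurable_EFinP/measurable_funM; first exact: measurable_norm_powR.
  exact: measurable_gs.
- by move=> x; rewrite lee_fin mulr_ge0 ?powR_ge0 ?gs_ge0.
apply: le_lt_trans (integral_powR_gs_lty (_ : 0 <= q + (2 * chi + 1))%R p0).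
  rewrite le_eqVlt; apply/orP; left; apply/eqP.
  apply: eq_integral => x _; rewrite -EFinM; congr EFin.
  rewrite /dw mulrAC -powRD//; apply/implyP => /eqP.
  by move: q0 chi_ge0 => ? ? ?; exfalso; lra.
by move: q0 chi_ge0 => ? ?; lra.
Qed.

Lemma integral_nu_gs_gt0 (p : R) : 0 < \int[nu]_x (gs p x)%:E.
Proof.
have mg : measurable_fun [set: R] (fun x => (gs p x * dw chi x)%:E).
  apply/measurable_EFinP/measurable_funM; first exact: measurable_gs.
  exact: measurable_dw.
rewrite ge0_integral_nu; last 2 first.
- by apply/measurable_EFinP; exact: measurable_gs.
- by move=> x; rewrite lee_fin gs_ge0.
under eq_integral do rewrite -EFinM.
apply: (@lt_le_trans _ _ (\int[leb]_(x in `]0%R, +oo[) (gs p x * dw chi x)%:E)); last first.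
  apply: ge0_subset_integral => // x _.
  by rewrite lee_fin mulr_ge0 ?gs_ge0 ?dw_ge0.
apply: ge0_integral_gt0 => //.
- by rewrite [ltRHS](lebesgue_measure_itv `]0%R, +oo[)/= ltry sube0 ltry.
- exact: measurable_funTS.
- move=> x; rewrite /= in_itv/= andbT => x0.
  by rewrite lte_fin mulr_gt0 ?expR_gt0 ?powR_gt0 ?normr_gt0 ?gt_eqF.
Qed.

(** The key identity for the constant function 1 has a finite right side, while its left side is the
    mass of [om] times a positive Gaussian integral. *)
Lemma om_lty : om [set: R] < +oo.
Proof.
have m1 : measurable_fun [set: R] (fun _ : R => 1 : \bar R) by exact: measurable_cst.
have H := key_identity chi_ge0 1%R m1 (fun=> lee01).
have I0 := integral_nu_gs_gt0 1.
rewrite ltey; apply/eqP => omy; move: H.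
rewrite key_constE//.
under [X in _ = _ * X]eq_integral do rewrite mul1e.
rewrite integral_gs// -EFinM.
under eq_integral do rewrite integral_cst// mul1e [X in _ * X]omy.
rewrite ge0_integralZr//; last 2 first.
- by apply/measurable_EFinP; exact: measurable_gs.
- by move=> x _; rewrite lee_fin gs_ge0.
by rewrite gt0_muley.
Qed.

End key_consequences.

Section integrability.
Local Open Scope ereal_scope.
Context d (T : measurableType d) (R : realType) (m : {measure set T -> \bar R}).

Lemma integrable_leC (f g : T -> R) (C : R) : (0 <= C)%R ->
  measurable_fun setT f -> measurable_fun setT g -> (forall x, (0 <= g x)%R) ->
  (forall x, (`|f x| <= C * g x)%R) -> \int[m]_x (g x)%:E < +oo ->
  m.-integrable setT (EFin \o f).
Proof.
move=> C0 mf mg g0 fg goo; apply/integrableP; split; first exact/measurable_EFinP.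
apply: (@le_lt_trans _ _ (\int[m]_x (C%:E * (g x)%:E))).
  apply: ge0_le_integral => //.
  - by apply/measurable_EFinP; exact: measurableT_comp.
  - by apply: emeasurable_funM => //; exact/measurable_EFinP.
  - by move=> x _; rewrite /= lee_fin.
have mg' : measurable_fun setT (EFin \o g) by exact/measurable_EFinP.
rewrite (ge0_integralZl_EFin m measurableT _ mg' C0).
- by rewrite lte_mul_pinfty// lee_fin.
- by move=> x _; rewrite lee_fin.
Qed.

End integrability.

Lemma integrable_leR (R : realType) (m : {measure set (measurableTypeR R) -> \bar R})
    (f g : R -> R) (C : R) : 0 <= C ->
  measurable_fun [set: R] f -> measurable_fun [set: R] g -> (forall x, 0 <= g x) ->
  (forall x, `|f x| <= C * g x) -> (\int[m]_x (g x)%:E < +oo)%E ->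
  m.-integrable setT (EFin \o f).
Proof. exact: (@integrable_leC _ (measurableTypeR R) R m f g C). Qed.

(** * Cosine and sine integrals of a Gaussian *)

Section gaussian_fourier.
Variable R : realType.
Local Notation leb := (@lebesgue_measure R).
Local Open Scope ereal_scope.

Lemma integral_derive_eq0 (G dG : R -> R) :
  (forall x, is_derive x (1%R : R) G (dG x)) -> continuous dG ->
  leb.-integrable setT (EFin \o dG) ->
  G n.+1%:R @[n --> \oo] --> (0%R : R) -> G (- n.+1%:R)%R @[n --> \oo] --> (0%R : R) ->
  \int[leb]_x (dG x)%:E = 0.
Proof.
move=> dGE cdG idG G1 G2.
have cG : continuous G.
  by move=> x; apply/differentiable_continuous/derivable1_diffP; case: (dGE x).
pose I n : set R := `[(- n.+1%:R)%R, n.+1%:R]%classic.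
have IE n : \int[leb]_(x in I n) (dG x)%:E = (G n.+1%:R - G (- n.+1%:R)%R)%:E.
  rewrite (@continuous_FTC2 _ _ G)//.
  - by rewrite gtrN.
  - exact: continuous_subspaceT.
  - split; first by move=> x _; case: (dGE x).
    + by apply: cvg_at_right_filter; exact: cG.
    + by apply: cvg_at_left_filter; exact: cG.
  - by move=> x _; rewrite derive1E; apply: (@derive_val _ _ _ _ _ _ _ (dGE x)).
have mdG : measurable_fun setT dG by exact: continuous_measurable_fun.
have : \int[leb]_(x in I n) (dG x)%:E @[n --> \oo] --> \int[leb]_x (dG x)%:E.
  under eq_fun do rewrite integral_mkcond.
  apply: (@dominated_cvg _ _ _ leb _ measurableT _ _ (fun x => `|dG x|%:E)).
  - move=> n; apply/(measurable_restrictT _ _).1; first exact: measurable_itv.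
    by apply/measurable_funTS/measurable_EFinP.
  - move=> x _; apply: cvg_near_cst; near=> n.
    rewrite /= patchE mem_set// /I/= in_itv/= -ler_norml.
    near: n; exists (Num.bound x) => // n /= xn.
    rewrite (le_trans (ltW (unstable.ltr_norm_bound x)))// ler_nat.
    exact: leq_trans xn _.
  - by [].
  - have := integrable_abse idG; exact.
  - by move=> n x _; rewrite patchE; case: ifPn => _ //=; rewrite normr0 lee_fin.
under eq_fun do rewrite IE.
move=> H; have : (G n.+1%:R - G (- n.+1%:R)%R)%:E @[n --> \oo] --> (0%R - 0%R)%:E.
  by apply: cvg_EFin; [exact: nearW|apply: cvgB].
rewrite subrr => /(cvg_unique _ H); exact.
Unshelve. all: by end_near. Qed.

Lemma cvg_gs (p : R) : (0 < p)%R -> gs p n.+1%:R @[n --> \oo] --> (0%R : R).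
Proof.
move=> p0.
have h : (2 / p * @harmonic R n)%R @[n --> \oo] --> (0%R : R).
  rewrite -[X in _ --> X](mulr0 (2 / p)%R); apply: cvgM; first exact: cvg_cst.
  exact: cvg_harmonic.
apply: (squeeze_cvgr _ (cvg_cst 0%R) h); near=> n.
rewrite gs_ge0/= /gs expRN -[X in (_ <= X * _)%R]invf_div -invfM.
rewrite lef_pV2 ?posrE ?expR_gt0 ?mulr_gt0 ?divr_gt0//.
apply: le_trans (expR_ge1Dx _).
rewrite (@le_trans _ _ (p / 2 * n.+1%:R ^+ 2)%R)//; last by rewrite lerDr.
apply: ler_wpM2l; first by rewrite divr_ge0// ltW.
by rewrite expr2 ler_peMr// ler1n.
Unshelve. all: by end_near. Qed.

Definition gcos (p m : R) : R := (\int[leb]_u (cos (m * u) * gs p u))%R.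
Definition gsin (p m : R) : R := (\int[leb]_u (u * sin (m * u) * gs p u))%R.

Lemma measurable_cosM (m : R) : measurable_fun [set: R] (fun u => cos (m * u))%R.
Proof.
apply: continuous_measurable_fun => x.
apply: (@continuous_comp _ _ _ (fun x => m * x)%R cos); last exact: continuous_cos.
by apply: (@cvgM R); [exact: cvg_cst|exact: cvg_id].
Qed.

Lemma measurable_sinM (m : R) : measurable_fun [set: R] (fun u => sin (m * u))%R.
Proof.
apply: continuous_measurable_fun => x.
apply: (@continuous_comp _ _ _ (fun x => m * x)%R sin); last exact: continuous_sin.
by apply: (@cvgM R); [exact: cvg_cst|exact: cvg_id].
Qed.

Lemma norm_cos_le1 (x : R) : (`|cos x| <= 1)%R.
Proof. by rewrite ler_norml cos_geN1 cos_le1. Qed.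

Lemma norm_sin_le1 (x : R) : (`|sin x| <= 1)%R.
Proof. by rewrite ler_norml sin_geN1 sin_le1. Qed.

Lemma integrable_gcos (p m : R) : (0 < p)%R ->
  leb.-integrable setT (EFin \o (fun u => cos (m * u) * gs p u)%R).
Proof.
move=> p0; apply: (@integrable_leR R leb _ (gs p) 1%R (@ler01 R)).
- by apply: measurable_funM; [exact: measurable_cosM|exact: measurable_gs].
- exact: measurable_gs.
- exact: gs_ge0.
- move=> x; rewrite normrM (ger0_norm (gs_ge0 _ _)) ler_wpM2r ?gs_ge0//.
  exact: norm_cos_le1.
- by rewrite integral_gs// ltry.
Qed.

Lemma integrable_gsin (p m : R) : (0 < p)%R ->
  leb.-integrable setT (EFin \o (fun u => u * sin (m * u) * gs p u)%R).
Proof.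
move=> p0; apply: (@integrable_leR R leb _ (fun u => `|u| `^ 1 * gs p u)%R 1%R (@ler01 R)).
- apply: measurable_funM; last exact: measurable_gs.
  by apply: measurable_funM => //; exact: measurable_sinM.
- by apply: measurable_funM; [exact: measurable_norm_powR|exact: measurable_gs].
- by move=> x; rewrite mulr_ge0 ?powR_ge0 ?gs_ge0.
- move=> x; rewrite mul1r !normrM (ger0_norm (gs_ge0 _ _)) ler_wpM2r ?gs_ge0//.
  by rewrite powRr1// ler_piMr// norm_sin_le1.
- exact: integral_powR_gs_lty.
Qed.

Lemma is_derive_mull (m x : R) : is_derive x (1%R : R) (fun u => m * u)%R m.
Proof.
have := @is_deriveZ _ _ _ (id : R -> R) m x (1%R : R) (1%R : R) (is_derive_id _ _).
by rewrite /= scaler1.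
Qed.

Lemma is_derive_sinM (m x : R) :
  is_derive x (1%R : R) (fun u => sin (m * u))%R (m * cos (m * x))%R.
Proof.
have := is_derive1_comp (is_derive_sin (m * x)%R) (is_derive_mull m x).
by rewrite mulrC.
Qed.

Lemma is_derive_cosM (m x : R) :
  is_derive x (1%R : R) (fun u => cos (m * u))%R (- (m * sin (m * x)))%R.
Proof.
have := is_derive1_comp (is_derive_cos (m * x)%R) (is_derive_mull m x).
by rewrite mulNr mulrC.
Qed.

Lemma is_derive_gs (p x : R) :
  is_derive x (1%R : R) (gs p) (- (p * x * gs p x))%R.
Proof.
have H := @is_deriveZ _ _ _ ((id : R -> R) ^+ 2)%R (- (p / 2))%R x (1%R : R) _
  (is_deriveX 2 (is_derive_id _ _)).
have := is_derive1_comp (is_derive_expR _) H.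
have -> : (expR \o (- (p / 2) \*: ((id : R -> R) ^+ 2)%R))%R = gs p.
  apply/funext => u; rewrite /gs/=; congr expR; exact: mulNr.
move=> {}H; apply: (is_derive_eq H).
have -> : expR ((- (p / 2) \*: (id : R -> R) ^+ 2) x)%R = gs p x.
  by rewrite /gs/=; congr expR; exact: mulNr.
by rewrite /GRing.scale /= mulr1 expr1; field.
Qed.

(** Integration by parts: the derivative of sin(m u) exp(-p u^2/2) integrates to 0. *)
Lemma gsin_gcos (p m : R) : (0 < p)%R -> gsin p m = (m / p * gcos p m)%R.
Proof.
move=> p0.
pose G u := (sin (m * u) * gs p u)%R.
pose dG u := (m * (cos (m * u) * gs p u) - p * (u * sin (m * u) * gs p u))%R.
have i1 := integrable_gcos m p0; have i2 := integrable_gsin m p0.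
have dGE (x : R) : is_derive x (1%R : R) G (dG x).
  apply: (is_derive_eq (is_deriveM (is_derive_sinM m x) (is_derive_gs p x))).
  rewrite /GRing.scale /= /dG; ring.
have Gs u : (`|G u| <= gs p u)%R.
  by rewrite normrM (ger0_norm (gs_ge0 _ _)) ler_piMl ?gs_ge0 ?norm_sin_le1.
have cdG : continuous dG.
  move=> x; apply: (@cvgB R R^o); apply: (@cvgM R); try exact: cvg_cst.
    apply: (@cvgM R); last exact: continuous_gs.
    apply: (@continuous_comp _ _ _ (fun x => m * x)%R cos); last exact: continuous_cos.
    by apply: (@cvgM R); [exact: cvg_cst|exact: cvg_id].
  apply: (@cvgM R); last exact: continuous_gs.
  apply: (@cvgM R); first exact: cvg_id.
  apply: (@continuous_comp _ _ _ (fun x => m * x)%R sin); last exact: continuous_sin.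
  by apply: (@cvgM R); [exact: cvg_cst|exact: cvg_id].
have j1 : leb.-integrable setT (EFin \o (fun u => m * (cos (m * u) * gs p u))%R).
  rewrite (_ : _ \o _ = fun u => m%:E * (EFin \o (fun u => cos (m * u) * gs p u)%R) u)//.
  exact: integrableZl.
have j2 : leb.-integrable setT (EFin \o (fun u => p * (u * sin (m * u) * gs p u))%R).
  rewrite (_ : _ \o _ = fun u => p%:E * (EFin \o (fun u => u * sin (m * u) * gs p u)%R) u)//.
  exact: integrableZl.
have idG : leb.-integrable setT (EFin \o dG).
  rewrite (_ : EFin \o dG = (EFin \o (fun u => m * (cos (m * u) * gs p u))%R) \-
     (EFin \o (fun u => p * (u * sin (m * u) * gs p u))%R))//.
  exact: integrableB.
have H : (\int[leb]_x dG x = 0)%R.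
  rewrite /Rintegral (integral_derive_eq0 dGE)//.
  - apply: norm_cvg0; apply: (squeeze_cvgr _ (cvg_cst 0%R) (cvg_gs p0)); near=> n.
    by rewrite normr_ge0 Gs.
  - apply: norm_cvg0; apply: (squeeze_cvgr _ (cvg_cst 0%R) (cvg_gs p0)); near=> n.
    by rewrite normr_ge0 (le_trans (Gs _))// gsN.
move: H; rewrite RintegralB// !RintegralZl// => /eqP; rewrite subr_eq0 => /eqP H.
rewrite /gsin /gcos mulrAC H mulrAC divff ?mul1r// gt_eqF//.
Unshelve. all: by end_near. Qed.

Lemma is_derive_gcos (p m : R) : (0 < p)%R ->
  is_derive m (1%R : R) (gcos p) (- gsin p m)%R.
Proof.
move=> p0.
pose f (m u : R) := (cos (m * u) * gs p u)%R.
have df (x u : R) : is_derive x (1%R : R) (f ^~ u) (- (u * sin (x * u) * gs p u))%R.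
  have : is_derive x (1%R : R) (gs p u \*: (fun m => cos (u * m)))%R
     (gs p u *: (- (u * sin (u * x)) : R))%R.
    by apply: is_deriveZ; exact: is_derive_cosM.
  have -> : (gs p u \*: (fun m => cos (u * m)))%R = f ^~ u.
    by apply/funext => z; rewrite /f [(z * u)%R]mulrC; exact: mulrC.
  by move=> H; apply: (is_derive_eq H); rewrite /GRing.scale /= [(u * x)%R]mulrC; ring.
pose B u := (`|u| `^ 1 * gs p u)%R.
have B0 u : (0 <= B u)%R by rewrite mulr_ge0 ?powR_ge0 ?gs_ge0.
have mB : measurable_fun setT B.
  by apply: measurable_funM; [exact: measurable_norm_powR|exact: measurable_gs].
have iB : leb.-integrable setT (EFin \o B).
  apply: (@integrable_leR R leb _ B 1%R (@ler01 R)) => //.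
  - by move=> x; rewrite mul1r ger0_norm.
  - exact: integral_powR_gs_lty.
have d1E x u : partial1of2 f x u = (- (u * sin (x * u) * gs p u))%R.
  by rewrite partial1of2E; apply: (@derive_val _ _ _ _ _ _ _ (df x u)).
have Im : `](m - 1)%R, (m + 1)%R[%classic m.
  by rewrite /= in_itv/= gtrBl ltr01 ltrDl ltr01.
have if_ x : leb.-integrable setT (EFin \o f x) by exact: integrable_gcos.
have derf x y : `](m - 1)%R, (m + 1)%R[%classic x -> setT y -> derivable (f ^~ y) x 1.
  by move=> _ _; case: (df x y).
have bnd x y : `](m - 1)%R, (m + 1)%R[%classic x -> setT y -> (`|partial1of2 f x y| <= B y)%R.
  move=> _ _; rewrite d1E normrN /B !normrM (ger0_norm (gs_ge0 _ _)) ler_wpM2r ?gs_ge0//.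
  by rewrite powRr1// ler_piMr// norm_sin_le1.
have H1 := @derivable_under_integral _ _ _ leb f setT measurableT m _ _ Im
  (fun x _ => if_ x) derf B B0 iB bnd.
have H2 := @differentiation_under_integral _ _ _ leb f setT measurableT m _ _ Im
  (fun x _ => if_ x) derf B B0 iB bnd.
apply: DeriveDef; first exact: H1.
rewrite -derive1E H2 /gsin -mulN1r -RintegralZl//.
- by apply: eq_Rintegral => u _; rewrite d1E mulN1r.
- exact: integrable_gsin.
Qed.

(* [gcos p] solves a first order linear differential equation, by [gsin_gcos]. *)
Lemma gcosE (p m : R) : (0 < p)%R ->
  gcos p m = (Num.sqrt (2 / p * pi) * expR (- (m ^+ 2 / (2 * p))))%R.
Proof.
move=> p0; pose q := (p^-1)%R.
have q0 : q != 0%R by rewrite invr_eq0 gt_eqF.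
pose g m := (gcos p m * gs (- q)%R m)%R.
have dg (x : R) : is_derive x (1%R : R) g 0%R.
  apply: (is_derive_eq (is_deriveM (is_derive_gcos x p0) (is_derive_gs (- q)%R x))).
  rewrite /GRing.scale /= gsin_gcos// -/q; ring.
have := is_derive_0_is_cst m 0%R dg.
rewrite /g {2}/gs expr0n/= mulr0 oppr0 expR0 mulr1 {2}/gcos.
under eq_Rintegral do rewrite mul0r cos0 mul1r.
rewrite {1}/Rintegral integral_gs//= => <-.
rewrite -mulrA /gs -expRD (_ : _ + _ = 0)%R ?expR0 ?mulr1//.
by rewrite /q; field; rewrite gt_eqF.
Qed.

End gaussian_fourier.

Section measurable_parameter.
Context d1 d2 (T1 : measurableType d1) (T2 : measurableType d2) (R : realType).
Variable m : {sigma_finite_measure set T2 -> \bar R}.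

(** Tonelli's theorem gives measurability for the positive and the negative part; subtraction in the
    extended reals and [fine] preserve it, also where the integral diverges. *)
Lemma measurable_Rintegral_param (F : T1 -> T2 -> R) :
  measurable_fun [set: T1 * T2] (fun z => F z.1 z.2) ->
  measurable_fun setT (fun x => \int[m]_y F x y).
Proof.
move=> mF; apply: measurableT_comp => //.
have mE : measurable_fun [set: T1 * T2] (fun z => (F z.1 z.2)%:E).
  exact/measurable_EFinP.
rewrite (_ : (fun x => _) = (fun x => \int[m]_y (fun z => (F z.1 z.2)%:E)^\+ (x, y))%E \-
   (fun x => \int[m]_y (fun z => (F z.1 z.2)%:E)^\- (x, y))%E)%E; last first.
  apply/funext => x; rewrite [LHS]integralE; congr (_ - _)%E.
    by apply: eq_integral => y _; rewrite !funeposE.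
  by apply: eq_integral => y _; rewrite !funenegE.
apply: emeasurable_funB.
- apply: (measurable_fun_fubini_tonelli_F (m2 := m) (fun z => (F z.1 z.2)%:E)^\+%E) => //.
  exact: measurable_funepos.
- apply: (measurable_fun_fubini_tonelli_F (m2 := m) (fun z => (F z.1 z.2)%:E)^\-%E) => //.
  exact: measurable_funeneg.
Qed.

End measurable_parameter.

Section dunkl_transform_gaussian.
Variable R : realType.
Variable chi : R.
Hypothesis chi_ge0 : 0 <= chi.
Local Notation leb := (@lebesgue_measure R).
Local Notation nu := (nu chi).
Local Notation om := (om chi).
Local Open Scope ereal_scope.

Lemma ge0_integral_nu_opp (f : R -> \bar R) : measurable_fun [set: R] f ->
  (forall x, 0 <= f x) -> \int[nu]_x f (- x)%R = \int[nu]_x f x.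
Proof.
move=> mf f0.
have mfN : measurable_fun [set: R] (fun x => f (- x)%R).
  by apply: (measurableT_comp mf); exact: measurable_funN.
rewrite (ge0_integral_nu chi mfN (fun=> f0 _)) (ge0_integral_nu chi mf f0).
rewrite -(ge0_integral_opp (f := fun x => f x * (dw chi x)%:E)).
- by apply: eq_integral => x _; rewrite dwN.
- by apply: emeasurable_funM => //; apply/measurable_EFinP; exact: measurable_dw.
- by move=> x; rewrite mule_ge0// lee_fin dw_ge0.
Qed.

Lemma Rintegral_nu_odd (f : R -> R) : measurable_fun [set: R] f ->
  (forall x, f (- x)%R = - f x)%R -> (\int[nu]_x f x = 0)%R.
Proof.
move=> mf fN; rewrite /Rintegral integralE.
have -> : \int[nu]_x (EFin \o f)^\- x = \int[nu]_x (EFin \o f)^\+ x.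
  rewrite -ge0_integral_nu_opp//.
  - by apply: eq_integral => x _; rewrite funenegE funeposE /= fN opprK.
  - by apply: measurable_funeneg; exact/measurable_EFinP.
have : 0 <= \int[nu]_x (EFin \o f)^\+ x by exact: integral_ge0.
(* If both parts are infinite the result is still 0, because [fine] sends infinite values to 0. *)
by case: (\int[nu]_x _) => //= r _; rewrite subrr.
Qed.

(** A bound on [-1, 1] suffices because the weight [bw] vanishes outside this interval. *)
Lemma ge0_le_integral_om (g : R -> R) (C : R) : measurable_fun [set: R] g ->
  (forall t, 0 <= g t)%R -> (0 <= C)%R -> (forall t, `|t| <= 1 -> g t <= C)%R ->
  \int[om]_t (g t)%:E <= C%:E * om setT.
Proof.
move=> mg g0 C0 gC; rewrite -integral_cst//.
have mg' : measurable_fun [set: R] (EFin \o g) by exact/measurable_EFinP.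
have mc : measurable_fun [set: R] (cst C%:E) by exact: measurable_cst.
rewrite (ge0_integral_om chi mg' (fun=> _)); last by move=> t; rewrite lee_fin.
rewrite (ge0_integral_om chi mc (fun=> _)); last by move=> t; rewrite lee_fin.
have mb : measurable_fun [set: R] (fun t => (bw chi t)%:E).
  by apply/measurable_EFinP; exact: measurable_bw.
apply: ge0_le_integral => //.
- by move=> t _; rewrite mule_ge0// lee_fin ?bw_ge0.
- exact: emeasurable_funM.
- exact: emeasurable_funM.
- move=> t _; rewrite -!EFinM lee_fin.
  have [t1|t1] := leP `|t|%R 1%R; first by rewrite ler_wpM2r ?bw_ge0// gC.
  rewrite /bw /rpow ifF ?mulr0//; apply/negbTE; rewrite -ltNge subr_lt0.
  by rewrite -real_normK ?num_real// expr_gt1.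
Qed.

Lemma om_fin : om setT \is a fin_num.
Proof. by rewrite ge0_fin_numE// om_lty. Qed.

Definition wtot : R := fine (om setT).

Lemma integrable_om (g : R -> R) (C : R) : measurable_fun [set: R] g ->
  (0 <= C)%R -> (forall t, `|t| <= 1 -> `|g t| <= C)%R ->
  om.-integrable setT (EFin \o g).
Proof.
move=> mg C0 gC; apply/integrableP; split; first exact/measurable_EFinP.
apply: (@le_lt_trans _ _ (C%:E * om setT)).
  apply: ge0_le_integral_om => //; exact: measurableT_comp.
by rewrite -(fineK om_fin) -EFinM ltry.
Qed.

Lemma le_norm_Rintegral_om (g : R -> R) (C : R) : measurable_fun [set: R] g ->
  (0 <= C)%R -> (forall t, `|t| <= 1 -> `|g t| <= C)%R ->
  (`|\int[om]_t g t| <= C * wtot)%R.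
Proof.
move=> mg C0 gC.
apply: le_trans (le_normr_Rintegral measurableT (integrable_om mg C0 gC)) _.
rewrite -lee_fin /Rintegral fineK.
  rewrite EFinM /wtot fineK ?om_fin//.
  apply: ge0_le_integral_om => //; exact: measurableT_comp.
apply: integrable_fin_num => //.
exact: (integrable_norm (integrable_om mg C0 gC)).
Qed.

(** Up to a common constant, [Ac] and [Bc] are z^(-chi) J_chi(z) and z^(-chi) J_(chi+1)(z). They are
    what remains of the factor 1 + t when it is paired with cos and with sin. *)
Definition Ac (z : R) : R := (\int[om]_t cos (z * t))%R.
Definition Bc (z : R) : R := (\int[om]_t (t * sin (z * t)))%R.

Lemma AcN z : Ac (- z) = Ac z.
Proof. by apply: eq_Rintegral => t _; rewrite mulNr cosN. Qed.

Lemma BcN z : Bc (- z) = (- Bc z)%R.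
Proof.
rewrite /Bc -[RHS]mulN1r -RintegralZl//.
  by apply: eq_Rintegral => t _; rewrite mulNr sinN mulN1r mulrN.
apply: (integrable_om (C := 1%R)) => //.
  by apply: measurable_funM => //; exact: measurable_sinM.
by move=> t t1; rewrite normrM mulr_ile1// norm_sin_le1.
Qed.

Lemma measurable_Ac : measurable_fun [set: R] Ac.
Proof.
apply: (@measurable_Rintegral_param _ _ R (measurableTypeR R) R om (fun z t => cos (z * t))%R).
apply: measurableT_comp; first exact: continuous_measurable_fun (@continuous_cos R).
exact: measurable_funM.
Qed.

Lemma measurable_Bc : measurable_fun [set: R] Bc.
Proof.
apply: (@measurable_Rintegral_param _ _ R (measurableTypeR R) R om (fun z t => t * sin (z * t))%R).
apply: measurable_funM => //.
apply: measurableT_comp; first exact: continuous_measurable_fun (@continuous_sin R).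
exact: measurable_funM.
Qed.

Lemma norm_Ac z : (`|Ac z| <= wtot)%R.
Proof.
rewrite -[leRHS]mul1r; apply: le_norm_Rintegral_om => //.
  exact: measurable_cosM.
by move=> t _; exact: norm_cos_le1.
Qed.

Lemma norm_Bc z : (`|Bc z| <= wtot)%R.
Proof.
rewrite -[leRHS]mul1r; apply: le_norm_Rintegral_om => //.
  by apply: measurable_funM => //; exact: measurable_sinM.
by move=> t t1; rewrite normrM mulr_ile1// norm_sin_le1.
Qed.

Lemma key_constK (p : R) : (0 < p)%R -> (fine (key_const chi p))%:E = key_const chi p.
Proof. by move=> p0; rewrite key_constE. Qed.

Lemma measurable_om_dilation (phi : R -> R) : measurable_fun [set: R] phi ->
  measurable_fun [set: R] (fun x => \int[om]_t phi (x * t))%R.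
Proof.
move=> mphi.
apply: (@measurable_Rintegral_param _ _ R (measurableTypeR R) R om (fun z t => phi (z * t))%R).
by apply: (measurableT_comp mphi); exact: measurable_funM.
Qed.

Let key_Rintegral_ge0 (phi : R -> R) (p : R) : (0 < p)%R ->
  measurable_fun [set: R] phi -> (forall u, 0 <= phi u)%R ->
  leb.-integrable setT (EFin \o (fun u => phi u * gs p u)%R) ->
  (forall x, om.-integrable setT (EFin \o (fun t => phi (x * t)%R))) ->
  nu.-integrable setT (EFin \o (fun x => gs p x * \int[om]_t phi (x * t))%R) /\
  (\int[nu]_x (gs p x * \int[om]_t phi (x * t)) =
   fine (key_const chi p) * \int[leb]_u (phi u * gs p u))%R.
Proof.
move=> p0 mphi phi0 iphi iom.
have H : \int[nu]_x (gs p x * \int[om]_t phi (x * t))%:E =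
    (fine (key_const chi p) * \int[leb]_u (phi u * gs p u))%:E.
  have mphi' : measurable_fun [set: R] (EFin \o phi) by exact/measurable_EFinP.
  have := key_identity chi_ge0 p mphi' (fun u => phi0 u).
  rewrite EFinM key_constK// /Rintegral fineK; last exact: integrable_fin_num.
  under [X in _ = _ * X -> _]eq_integral do rewrite -EFinM.
  move=> <-; apply: eq_integral => x _.
  rewrite EFinM fineK//; exact: (integrable_fin_num measurableT (iom x)).
have I0 x : (0 <= gs p x * \int[om]_t phi (x * t))%R.
  by rewrite mulr_ge0 ?gs_ge0// Rintegral_ge0.
split; last by rewrite {1}/Rintegral H.
apply/integrableP; split.
  apply/measurable_EFinP/measurable_funM; first exact: measurable_gs.
  exact: measurable_om_dilation.
under eq_integral do rewrite gee0_abs ?lee_fin ?I0//.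
by rewrite H ltry.
Qed.

Lemma key_Rintegral (phi : R -> R) (p : R) : (0 < p)%R ->
  measurable_fun [set: R] phi ->
  leb.-integrable setT (EFin \o (fun u => phi u * gs p u)%R) ->
  (forall x, om.-integrable setT (EFin \o (fun t => phi (x * t)%R))) ->
  (\int[nu]_x (gs p x * \int[om]_t phi (x * t)) =
   fine (key_const chi p) * \int[leb]_u (phi u * gs p u))%R.
Proof.
move=> p0 mphi iphi iom.
(* The splitting phi = |phi| - (|phi| - phi) has two nonnegative terms and inherits both
   integrability assumptions from absolute values and differences. *)
pose pp u := `|phi u|%R; pose pn u := (`|phi u| - phi u)%R.
have mpp : measurable_fun [set: R] pp by exact: measurableT_comp.
have mpn : measurable_fun [set: R] pn by exact: measurable_funB.
have ipp : leb.-integrable setT (EFin \o (fun u => pp u * gs p u)%R).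
  rewrite (_ : (fun u => _)%R = (fun u => `|phi u * gs p u|)%R).
    exact: integrable_norm.
  by apply/funext => u; rewrite normrM (ger0_norm (gs_ge0 _ _)).
have ipn : leb.-integrable setT (EFin \o (fun u => pn u * gs p u)%R).
  rewrite (_ : _ \o _ = (EFin \o (fun u => pp u * gs p u)%R) \-
    (EFin \o (fun u => phi u * gs p u)%R)); first exact: integrableB.
  by apply/funext => u /=; rewrite /pn mulrBl.
have iopp x : om.-integrable setT (EFin \o (fun t => pp (x * t)%R)).
  by rewrite /pp; exact: (integrable_norm (iom x)).
have iopn x : om.-integrable setT (EFin \o (fun t => pn (x * t)%R)).
  rewrite (_ : _ \o _ = (EFin \o (fun t => pp (x * t)%R)) \-
    (EFin \o (fun t => phi (x * t)%R)))//; exact: integrableB.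
have [J1 E1] := key_Rintegral_ge0 p0 mpp (fun u => normr_ge0 _) ipp iopp.
have pn0 u : (0 <= pn u)%R by rewrite subr_ge0 ler_norm.
have [J2 E2] := key_Rintegral_ge0 p0 mpn pn0 ipn iopn.
transitivity (\int[nu]_x (gs p x * \int[om]_t pp (x * t)) -
   \int[nu]_x (gs p x * \int[om]_t pn (x * t)))%R.
  rewrite -RintegralB//; apply: eq_Rintegral => x _.
  rewrite -mulrBr -RintegralB//; congr (_ * _)%R.
  by apply: eq_Rintegral => t _; rewrite /pn opprB addrC subrK.
rewrite E1 E2 -mulrBr -RintegralB//; congr (_ * _)%R.
by apply: eq_Rintegral => t _; rewrite -mulrBl /pn opprB addrC subrK.
Qed.

Definition kp (p : R) : R := fine (key_const chi p).

Lemma integral_Ac_gs (p m : R) : (0 < p)%R ->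
  (\int[nu]_x (Ac (m * x) * gs p x) = kp p * gcos p m)%R.
Proof.
move=> p0; rewrite -(key_Rintegral p0 (measurable_cosM m) (integrable_gcos m p0)).
  apply: eq_Rintegral => x _; rewrite mulrC; congr (_ * _)%R.
  by apply: eq_Rintegral => t _; rewrite mulrA.
move=> x; apply: (integrable_om (C := 1%R)) => //.
  by apply: (measurableT_comp (measurable_cosM m)); exact: measurable_funM.
by move=> t _; exact: norm_cos_le1.
Qed.

(** The factor x joins the factor t of [Bc], so the integrand is phi(x t) with phi(u) = u sin(m
    u). *)
Lemma integral_Bc_gs (p m : R) : (0 < p)%R ->
  (\int[nu]_x (Bc (m * x) * (x * gs p x)) = kp p * gsin p m)%R.
Proof.
move=> p0.
have mus : measurable_fun [set: R] (fun u => u * sin (m * u))%R.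
  by apply: measurable_funM => //; exact: measurable_sinM.
have muxs x : measurable_fun [set: R] (fun t => t * sin (m * (x * t)))%R.
  under eq_fun do rewrite mulrA.
  by apply: measurable_funM => //; exact: measurable_sinM.
rewrite -(key_Rintegral p0 mus (integrable_gsin m p0)).
  apply: eq_Rintegral => x _; rewrite [RHS]mulrC mulrA; congr (_ * _)%R.
  rewrite mulrC /Bc -RintegralZl//.
    by apply: eq_Rintegral => t _; rewrite !mulrA.
  apply: (integrable_om (C := 1%R)) => //.
    by apply: measurable_funM => //; exact: measurable_sinM.
  by move=> t t1; rewrite normrM mulr_ile1// norm_sin_le1.
move=> x; apply: (integrable_om (C := `|x|%R)) => //.
  by apply: (measurableT_comp mus); exact: measurable_funM.
by move=> t t1; rewrite !normrM -mulrA ler_piMr// mulr_ile1// norm_sin_le1.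
Qed.

Lemma integral_Ac_gs_odd (p m : R) :
  (\int[nu]_x (Ac (m * x) * (x * gs p x)) = 0)%R.
Proof.
apply: Rintegral_nu_odd; last by move=> x; rewrite mulrN AcN gsN mulNr mulrN.
apply: measurable_funM; last by apply: measurable_funM => //; exact: measurable_gs.
by apply: (measurableT_comp measurable_Ac); exact: measurable_funM.
Qed.

Lemma integral_Bc_gs_even (p m : R) : (\int[nu]_x (Bc (m * x) * gs p x) = 0)%R.
Proof.
apply: Rintegral_nu_odd; last by move=> x; rewrite mulrN BcN gsN mulNr.
apply: measurable_funM; last exact: measurable_gs.
by apply: (measurableT_comp measurable_Bc); exact: measurable_funM.
Qed.

(** The Gamma integral contributes (2/p)^(chi + 1/2) and the Gaussian one (2/p)^(1/2), hence the
    exponent chi + 1. The factor sqrt(pi) Gamma(chi + 1/2) is kept apart because it cancels the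
    denominator of the kernel constant. *)
Lemma kp_gcos (p m : R) : (0 < p)%R ->
  (kp p * gcos p m = Num.sqrt pi * Gamma (chi + 2^-1) * 2 `^ (chi + 1) *
    (p `^ (chi + 1))^-1 * gs p^-1 m)%R.
Proof.
move=> p0; rewrite /kp key_constE// gcosE//=.
have p20 : (0 <= 2 / p)%R by rewrite divr_ge0// ltW.
rewrite sqrtrM// -(@powR12_sqrt _ (2 / p)%R)//.
have -> : ((2 / p) `^ (chi + 2^-1) * Gamma (chi + 2^-1) *
    ((2 / p) `^ 2^-1 * Num.sqrt pi * expR (- (m ^+ 2 / (2 * p)))) =
  Num.sqrt pi * Gamma (chi + 2^-1) * ((2 / p) `^ (chi + 2^-1) * (2 / p) `^ 2^-1) *
   expR (- (m ^+ 2 / (2 * p))))%R by ring.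
rewrite -powRD; last by apply/implyP => _; rewrite gt_eqF// divr_gt0.
have -> : (chi + 2^-1 + 2^-1 = chi + 1)%R by field.
have -> : ((2 / p) `^ (chi + 1) = 2 `^ (chi + 1) / p `^ (chi + 1))%R.
  apply: (canRL (mulfK _)); first by rewrite gt_eqF// powR_gt0.
  by rewrite -powRM ?(ltW p0)// divfK// gt_eqF.
have -> : gs p^-1 m = expR (- (m ^+ 2 / (2 * p))).
  by rewrite /gs; congr (expR (- _)%R); field; rewrite gt_eqF.
by rewrite !mulrA.
Qed.

Lemma kp_gsin (p m : R) : (0 < p)%R ->
  (kp p * gsin p m = Num.sqrt pi * Gamma (chi + 2^-1) * 2 `^ (chi + 1) *
    (p `^ (chi + 2))^-1 * (m * gs p^-1 m))%R.
Proof.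
move=> p0; rewrite gsin_gcos// mulrCA kp_gcos//.
have -> : (p `^ (chi + 2) = p `^ (chi + 1) * p)%R.
  rewrite -[X in (_ * X)%R]powRr1 ?ltW// -powRD; last by rewrite (gt_eqF p0) implybT.
  by congr powR; ring.
by field; rewrite !gt_eqF// powR_gt0.
Qed.

End dunkl_transform_gaussian.

(** * Isometries on a dense subspace *)

Section square_triangle.
Context d (T : measurableType d) (R : realType) (mu : {measure set T -> \bar R}).
Local Open Scope ereal_scope.

Definition sqn (f : T -> R) : \bar R := \int[mu]_x (f x ^+ 2)%:E.

Lemma sqn_ge0 f : 0 <= sqn f.
Proof. by apply: integral_ge0 => x _; rewrite lee_fin sqr_ge0. Qed.

Lemma sqn_fin f : sqn f < +oo -> sqn f = (fine (sqn f))%:E.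
Proof. by move=> h; rewrite fineK// ge0_fin_numE// sqn_ge0. Qed.

Lemma measurable_sqr (f : T -> R) : measurable_fun setT f ->
  measurable_fun setT (fun x => (f x ^+ 2)%:E).
Proof. by move=> mf; apply/measurable_EFinP; exact: measurable_funX. Qed.

Lemma le_sqn (f g : T -> R) : measurable_fun setT f -> measurable_fun setT g ->
  (forall x, `|f x| <= `|g x|)%R -> sqn f <= sqn g.
Proof.
move=> mf mg fg; apply: ge0_le_integral => //.
- by move=> x _; rewrite lee_fin sqr_ge0.
- exact: measurable_sqr.
- exact: measurable_sqr.
- by move=> x _; rewrite lee_fin -[leLHS]real_normK ?num_real// -[leRHS]real_normK ?num_real// lerXn2r.
Qed.

Lemma Lnorm2E (f : T -> R) : sqn f < +oo ->
  Lnorm mu 2%:E (EFin \o f) = (Num.sqrt (fine (sqn f)))%:E.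
Proof.
move=> foo; rewrite unlock /=.
rewrite (_ : \int[mu]_x _ = sqn f); last first.
  by apply: eq_integral => x _; rewrite powR_mulrn// real_normK ?num_real.
by rewrite sqn_fin// poweR_EFin powR12_sqrt// fine_ge0// sqn_ge0.
Qed.

(** Minkowski's inequality under a pointwise bound instead of for a sum, so that it also applies to
    moduli of quaternion-valued functions. *)
Lemma sqn_triangle (u v w : T -> R) : measurable_fun setT u ->
  measurable_fun setT v -> measurable_fun setT w ->
  (forall x, `|u x| <= `|v x| + `|w x|)%R -> sqn v < +oo -> sqn w < +oo ->
  sqn u < +oo /\
  (Num.sqrt (fine (sqn u)) <= Num.sqrt (fine (sqn v)) + Num.sqrt (fine (sqn w)))%R.
Proof.
move=> mu_ mv mw uvw voo woo.
pose V x : R := `|v x|%R; pose W x : R := `|w x|%R.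
have mV : measurable_fun setT V by exact: measurableT_comp.
have mW : measurable_fun setT W by exact: measurableT_comp.
have VE : sqn V = sqn v by apply: eq_integral => x _; rewrite /V real_normK ?num_real.
have WE : sqn W = sqn w by apply: eq_integral => x _; rewrite /W real_normK ?num_real.
have := @minkowski_EFin _ _ _ mu V W 2 mV mW (ler1n _ 2).
rewrite (Lnorm2E (f := V)) ?VE// (Lnorm2E (f := W)) ?WE// => H.
have s : sqn (V \+ W)%R < +oo.
  (* An infinite norm of the sum would contradict the finite bound just obtained. *)
  rewrite ltey; apply/eqP => e; move: H; rewrite unlock /=.
  rewrite (_ : \int[mu]_x _ = +oo); last first.
    rewrite -[RHS]e; apply: eq_integral => x _.
    by rewrite powR_mulrn// real_normK ?num_real.
  by rewrite poweRyr ?invr_eq0// -EFinD leye_eq.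
have uVW : sqn u <= sqn (V \+ W)%R.
  apply: le_sqn => //; first exact: measurable_funD.
  by move=> x; rewrite (ger0_norm (addr_ge0 (normr_ge0 (v x)) (normr_ge0 (w x)))).
have uoo := le_lt_trans uVW s.
split => //; move: H; rewrite Lnorm2E// -EFinD lee_fin; apply: le_trans.
by rewrite ler_wsqrtr// fine_le// ge0_fin_numE ?sqn_ge0.
Qed.

End square_triangle.

Lemma limn_einf_le (R : realType) (u : (\bar R)^nat) (B : \bar R) :
  (forall n, (u n <= B)%E) -> (limn_einf u <= B)%E.
Proof.
move=> uB; rewrite limn_einf_lim; apply: lime_le; first exact: is_cvg_einfs.
apply: nearW => n; apply: le_trans (uB n).
by apply: ereal_inf_lbound; exists n => //=.
Qed.

Section dense_isometry.
Context d (T : measurableType d) (R : realType).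
Variable mu : {sigma_finite_measure set T -> \bar R}.
Local Open Scope ereal_scope.

(* A gauge that controls the L^1 and the L^2 norm at the same time. *)
Definition n12 (f : T -> R) : \bar R := \int[mu]_x (`|f x| + f x ^+ 2)%:E.

Lemma n12_ge0 f : 0 <= n12 f.
Proof. by apply: integral_ge0 => x _; rewrite lee_fin addr_ge0 ?sqr_ge0. Qed.

Lemma measurable_n12 (f : T -> R) : measurable_fun setT f ->
  measurable_fun setT (fun x => `|f x| + f x ^+ 2)%R.
Proof.
move=> mf; apply: measurable_funD; first exact: measurableT_comp.
exact: measurable_funX.
Qed.

Lemma le_n12 (f g : T -> R) (C : R) : (0 <= C)%R ->
  measurable_fun setT f -> measurable_fun setT g ->
  (forall x, `|f x| + f x ^+ 2 <= C * (`|g x| + g x ^+ 2))%R -> n12 f <= C%:E * n12 g.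
Proof.
move=> C0 mf mg fg; rewrite /n12 -(ge0_integralZl_EFin mu measurableT _ _ C0).
- apply: ge0_le_integral => //.
  + by move=> x _; rewrite lee_fin addr_ge0 ?sqr_ge0.
  + by apply/measurable_EFinP; exact: measurable_n12.
  + by apply: emeasurable_funM => //; apply/measurable_EFinP; exact: measurable_n12.
  + by move=> x _; rewrite -EFinM lee_fin.
- by move=> x _; rewrite lee_fin addr_ge0 ?sqr_ge0.
- by apply/measurable_EFinP; exact: measurable_n12.
Qed.

(** The gauge is not a norm: the factor 2 comes from (f + g)^2 <= 2 f^2 + 2 g^2. *)
Lemma n12D (f g : T -> R) : measurable_fun setT f -> measurable_fun setT g ->
  n12 (f \+ g)%R <= 2%:E * (n12 f + n12 g).
Proof.
move=> mf mg.
rewrite /n12 -ge0_integralD//; last 4 first.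
- by move=> x _; rewrite lee_fin addr_ge0 ?sqr_ge0.
- by apply/measurable_EFinP; exact: measurable_n12.
- by move=> x _; rewrite lee_fin addr_ge0 ?sqr_ge0.
- by apply/measurable_EFinP; exact: measurable_n12.
rewrite -ge0_integralZl_EFin//; last 2 first.
- by move=> x _; rewrite -EFinD lee_fin !addr_ge0 ?sqr_ge0.
- by apply: emeasurable_funD; apply/measurable_EFinP; exact: measurable_n12.
apply: ge0_le_integral => //.
- by move=> x _; rewrite lee_fin addr_ge0 ?sqr_ge0.
- by apply/measurable_EFinP; apply: measurable_n12; exact: measurable_funD.
- apply: emeasurable_funM => //.
  by apply: emeasurable_funD; apply/measurable_EFinP; exact: measurable_n12.
- move=> x _; rewrite -EFinD -EFinM lee_fin /=.
  have h1 := ler_normD (f x) (g x).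
  have h2 : ((f x + g x) ^+ 2 <= 2 * (f x ^+ 2 + g x ^+ 2))%R.
    by rewrite -subr_ge0 (_ : _ - _ = (f x - g x) ^+ 2)%R ?sqr_ge0//; ring.
  have h3 := normr_ge0 (f x); have h4 := normr_ge0 (g x).
  lra.
Qed.

Lemma n12Z (a : R) (f : T -> R) : measurable_fun setT f ->
  n12 (fun x => a * f x)%R <= (`|a| + a ^+ 2)%:E * n12 f.
Proof.
move=> mf; apply: le_n12 => //.
- by rewrite addr_ge0 ?sqr_ge0.
- exact: measurable_funM.
- move=> x; rewrite normrM exprMn.
  have h3 := normr_ge0 (f x); have h4 := normr_ge0 a.
  have h5 := sqr_ge0 (f x); have h6 := sqr_ge0 a.
  by nra.
Qed.

Lemma n12_integrable (f : T -> R) : measurable_fun setT f -> n12 f < +oo ->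
  mu.-integrable setT (EFin \o f).
Proof.
move=> mf foo; apply: (@integrable_leC _ _ _ mu f (fun x => `|f x| + f x ^+ 2)%R 1%R) => //.
- exact: measurable_n12.
- by move=> x; rewrite addr_ge0 ?sqr_ge0.
- by move=> x; rewrite mul1r lerDl sqr_ge0.
Qed.

Lemma le_sqn_n12 (f : T -> R) : measurable_fun setT f -> sqn mu f <= n12 f.
Proof.
move=> mf; apply: ge0_le_integral => //.
- by move=> x _; rewrite lee_fin sqr_ge0.
- exact: measurable_sqr.
- by apply/measurable_EFinP; exact: measurable_n12.
- by move=> x _; rewrite lee_fin lerDr.
Qed.

Variable S : (T -> R) -> Prop.
Hypothesis S_measurable : forall g, S g -> measurable_fun setT g.
Hypothesis S_n12 : forall g, S g -> n12 g < +oo.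
Hypothesis S_lin : forall a g h, S g -> S h -> S (fun x => a * g x + h x)%R.

Definition n12_closure (f : T -> R) := measurable_fun setT f /\
  forall e : R, (0 < e)%R -> exists2 g, S g & n12 (f \- g)%R < e%:E.
Local Notation C := n12_closure.

Lemma n12_closure_sub g : S g -> C g.
Proof.
move=> Sg; split; first exact: S_measurable.
move=> e e0; exists g => //; rewrite /n12.
under eq_integral do rewrite /= subrr normr0 expr0n addr0.
by rewrite integral0 lte_fin.
Qed.

Lemma n12_closure_closed (f : T -> R) : measurable_fun setT f ->
  (forall e : R, (0 < e)%R -> exists2 g, C g & n12 (f \- g)%R < e%:E) -> C f.
Proof.
move=> mf H; split => // e e0.
have [g [mg Cg] fg] := H _ (divr_gt0 e0 (ltr0n _ 4)).
have [h Sh gh] := Cg _ (divr_gt0 e0 (ltr0n _ 4)).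
exists h => //.
have mh := S_measurable Sh.
have -> : (f \- h = (f \- g) \+ (g \- h))%R.
  by apply/funext => x /=; rewrite addrA subrK.
apply: le_lt_trans (n12D _ _) _; [exact: measurable_funB..|].
have -> : e%:E = 2%:E * ((e / 4)%:E + (e / 4)%:E).
  by rewrite -EFinD -EFinM; congr EFin; field.
by rewrite lte_pmul2l// lteD.
Qed.

Lemma n12_closure_lin (a : R) (f g : T -> R) : C f -> C g -> C (fun x => a * f x + g x)%R.
Proof.
move=> [mf Cf] [mg Cg]; split.
  by apply: measurable_funD => //; exact: measurable_funM.
move=> e e0.
have a0 : (0 < `|a| + a ^+ 2 + 1)%R by rewrite ltr_wpDl// addr_ge0 ?sqr_ge0.
have [f' Sf ff] := Cf _ (divr_gt0 (divr_gt0 e0 (ltr0n _ 4)) a0).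
have [g' Sg gg] := Cg _ (divr_gt0 e0 (ltr0n _ 4)).
exists (fun x => a * f' x + g' x)%R; first exact: S_lin.
have mf' := S_measurable Sf; have mg' := S_measurable Sg.
have -> : ((fun x => a * f x + g x) \- (fun x => a * f' x + g' x) =
          (fun x => a * (f \- f') x) \+ (g \- g'))%R.
  by apply/funext => x /=; ring.
apply: le_lt_trans (n12D _ _) _.
- by apply: measurable_funM => //; exact: measurable_funB.
- exact: measurable_funB.
have -> : e%:E = 2%:E * ((e / 4)%:E + (e / 4)%:E).
  by rewrite -EFinD -EFinM; congr EFin; field.
rewrite lte_pmul2l// lteD//.
apply: le_lt_trans (n12Z _ _) _; first exact: measurable_funB.
apply: (@le_lt_trans _ _ ((`|a| + a ^+ 2 + 1)%:E * n12 (f \- f')%R)).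
  by rewrite lee_wpmul2r ?n12_ge0// lee_fin lerDl.
rewrite -lte_pdivlMl// muleC; exact: ff.
Qed.

(** With this closure property density can be proved by pointwise limits alone, as long as one
    function of finite gauge dominates them. *)
Lemma n12_closure_dominated (f_ : nat -> T -> R) (f h : T -> R) :
  (forall n, C (f_ n)) -> measurable_fun setT f -> measurable_fun setT h ->
  (forall x, f_ n x @[n --> \oo] --> f x) ->
  (forall n x, `|f_ n x| <= h x)%R -> n12 h < +oo -> C f.
Proof.
move=> Cf mf mh ff fh hoo; apply: n12_closure_closed => // e e0.
have fh' x : (`|f x| <= h x)%R.
  have c : `|f_ n x|%R @[n --> \oo] --> `|f x|%R by exact: (cvg_norm (ff x)).
  rewrite -(cvg_lim _ c)//; apply: limr_le.
    by apply/cvg_ex; eexists; exact: c.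
  by apply: nearW => n; exact: fh.
have h0 x : (0 <= h x)%R := le_trans (normr_ge0 _) (fh' x).
have mfn n := (Cf n).1.
have : n12 (f \- f_ n)%R @[n --> \oo] --> \int[mu]_x (cst 0 x).
  (* From |f - f_n| <= 2h the gauge integrand is at most 2h + 4h^2, hence the factor 4. *)
  apply: (@dominated_cvg _ _ _ mu _ measurableT _ _ (fun x => (4 * (`|h x| + h x ^+ 2))%:E)).
  - by move=> n; apply/measurable_EFinP; apply: measurable_n12; exact: measurable_funB.
  - move=> x _; apply: cvg_EFin; first exact: nearW.
    have d0 : (f \- f_ n)%R x @[n --> \oo] --> (0%R : R).
      by rewrite -(subrr (f x)); apply: cvgB; [exact: cvg_cst|exact: ff].
    have d1 : `|(f \- f_ n)%R x|%R @[n --> \oo] --> (0%R : R).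
      by rewrite -(normr0 R); exact: cvg_norm.
    have d2 : ((f \- f_ n) x ^+ 2)%R @[n --> \oo] --> (0%R : R).
      by rewrite -(mulr0 (0%R : R)); exact: (cvgM d0 d0).
    by rewrite -(addr0 (0%R : R)); exact: (cvgD d1 d2).
  - by [].
  - rewrite (_ : (fun x => _) = fun x => 4%:E * (`|h x| + h x ^+ 2)%:E)//.
    apply: integrableZl => //; apply/integrableP; split.
      by apply/measurable_EFinP; exact: measurable_n12.
    by under eq_integral do rewrite gee0_abs ?lee_fin ?addr_ge0 ?sqr_ge0//.
  - move=> n x _; rewrite gee0_abs ?lee_fin ?addr_ge0 ?sqr_ge0//= (ger0_norm (h0 x)).
    have a1 := fh' x; have a2 := fh n x; have a3 := h0 x.
    have b : (`|f x - f_ n x| <= 2 * h x)%R.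
      by rewrite (le_trans (ler_normB _ _))// mulr_natl mulr2n lerD.
    have : ((f x - f_ n x) ^+ 2 <= 4 * h x ^+ 2)%R.
      rewrite -real_normK ?num_real// (_ : 4 * h x ^+ 2 = (2 * h x) ^+ 2)%R; last by ring.
      by rewrite lerXn2r// nnegrE mulr_ge0.
    lra.
rewrite integral0 => /fine_cvgP[fin].
move=> /cvgrPdist_lt/(_ _ e0) [N _ HN].
have [N' _ HN'] := fin.
exists (f_ (maxn N N')); first exact: Cf.
have := HN _ (leq_maxl N N'); rewrite /= sub0r normrN => H.
have F := HN' _ (leq_maxr N N').
by rewrite -(fineK F) lte_fin (le_lt_trans (ler_norm _)).
Qed.

Section kernel.
Variables (k : T -> T -> R) (M : R).
Hypothesis mk : measurable_fun [set: T * T] (fun z => k z.1 z.2).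
Hypothesis k_le : forall y x, (`|k y x| <= M)%R.
Definition ktr (f : T -> R) (y : T) : R := (\int[mu]_x (k y x * f x))%R.
Variable kappa : R.
Hypothesis kappa_ge0 : (0 <= kappa)%R.
Hypothesis S_iso : forall g, S g -> sqn mu (ktr g) = kappa%:E * sqn mu g.

Lemma measurable_ktr f : measurable_fun setT f -> measurable_fun setT (ktr f).
Proof.
move=> mf; apply: (@measurable_Rintegral_param _ _ _ _ R mu (fun y x => k y x * f x)%R).
by apply: measurable_funM => //; exact: (measurableT_comp mf).
Qed.

Lemma integrable_ktr f y : measurable_fun setT f -> n12 f < +oo ->
  mu.-integrable setT (EFin \o (fun x => k y x * f x)%R).
Proof.
move=> mf foo.
apply: (@integrable_leC _ _ _ mu _ (fun x => `|f x| + f x ^+ 2)%R `|M|%R) => //.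
- apply: measurable_funM => //; exact: (measurableT_comp mk (measurable_fun_pair _ _)).
- exact: measurable_n12.
- by move=> x; rewrite addr_ge0 ?sqr_ge0.
- move=> x; rewrite normrM ler_pM//.
    exact: le_trans (k_le y x) (ler_norm _).
  by rewrite lerDl sqr_ge0.
Qed.

Lemma ktrB f g y : measurable_fun setT f -> n12 f < +oo ->
  measurable_fun setT g -> n12 g < +oo ->
  ktr (f \- g)%R y = (ktr f y - ktr g y)%R.
Proof.
move=> mf foo mg goo; rewrite /ktr -RintegralB//; try exact: integrable_ktr.
by apply: eq_Rintegral => x _; rewrite /= mulrBr.
Qed.

Lemma norm_ktr f y : measurable_fun setT f -> n12 f < +oo ->
  (`|ktr f y| <= `|M| * fine (n12 f))%R.
Proof.
move=> mf foo; rewrite /ktr.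
apply: le_trans (le_normr_Rintegral measurableT (integrable_ktr y mf foo)) _.
have i1 := integrable_norm (integrable_ktr y mf foo).
rewrite -lee_fin /Rintegral fineK; last exact: (integrable_fin_num measurableT i1).
rewrite EFinM fineK; last by rewrite ge0_fin_numE// n12_ge0.
rewrite /n12 -ge0_integralZl_EFin//; last 2 first.
- by move=> x _; rewrite lee_fin addr_ge0 ?sqr_ge0.
- by apply/measurable_EFinP; exact: measurable_n12.
apply: ge0_le_integral => //.
- by apply: (measurable_int mu i1).
- by apply: emeasurable_funM => //; apply/measurable_EFinP; exact: measurable_n12.
- move=> x _; rewrite lee_fin normrM ler_pM//.
    exact: le_trans (k_le y x) (ler_norm _).
  by rewrite lerDl sqr_ge0.
Qed.

Lemma n12_closure_lty f : C f -> n12 f < +oo.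
Proof.
move=> [mf Cf]; have [g Sg fg] := Cf _ ltr01.
have mg := S_measurable Sg.
have -> : (f = (f \- g) \+ g)%R by apply/funext => x /=; rewrite subrK.
apply: le_lt_trans (n12D _ _) _ => //; first exact: measurable_funB.
have fgoo := lt_trans fg (ltry 1%R).
by rewrite lte_mul_pinfty// lte_add_pinfty// S_n12.
Qed.

(** A priori bound on the closure. Approximants in S converge to f in the gauge; since the kernel is
    bounded, their transforms converge pointwise, and Fatou's lemma transfers the bound. The 4 comes
    from writing g_n as f minus (f - g_n) and applying [n12D]. *)
Lemma sqn_ktr_le f (e : R) : C f -> n12 f < e%:E ->
  sqn mu (ktr f) <= (4 * kappa * e)%:E.
Proof.
move=> Cf fe; have [mf Cf'] := Cf.
have e0 : (0 < e)%R by rewrite -lte_fin (le_lt_trans (n12_ge0 f)).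
have foo := n12_closure_lty Cf.
(* The bound e keeps the gauge of g_n below 4 e, the bound 1/(n+1) forces convergence. *)
have /choice[g gP] n : exists g, S g /\ n12 (f \- g)%R < (Num.min e n.+1%:R^-1)%:E.
  have e1 : (0 < Num.min e n.+1%:R^-1)%R by rewrite lt_min e0 invr_gt0 ltr0n.
  by have [g Sg fg] := Cf' _ e1; exists g.
have mg n := S_measurable (gP n).1.
have goo n := S_n12 (gP n).1.
have cvk y : (ktr (g n) y ^+ 2)%:E @[n --> \oo] --> (ktr f y ^+ 2)%:E.
  apply: cvg_EFin; first exact: nearW.
  suff H : ktr (g n) y @[n --> \oo] --> ktr f y by exact: (cvgM H H).
  apply/subr_cvg0; apply: norm_cvg0.
  have h : (`|M| * @harmonic R n)%R @[n --> \oo] --> (0%R : R).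
    rewrite -[X in _ --> X](mulr0 `|M|%R); apply: cvgM; first exact: cvg_cst.
    exact: cvg_harmonic.
  apply: (squeeze_cvgr _ (cvg_cst 0%R) h); near=> n.
  rewrite normr_ge0/= distrC -ktrB//.
  have m1 : measurable_fun setT (f \- g n)%R by exact: measurable_funB.
  have fgn := (gP n).2.
  have fgoo : n12 (f \- g n)%R < +oo by rewrite (lt_trans fgn)// ltry.
  apply: le_trans (norm_ktr y m1 fgoo) _; rewrite ler_wpM2l//.
  rewrite -lee_fin fineK; last by rewrite ge0_fin_numE// n12_ge0.
  by rewrite (le_trans (ltW fgn))// lee_fin ge_min lexx orbT.
apply: (@le_trans _ _ (\int[mu]_y limn_einf (fun n => (ktr (g n) y ^+ 2)%:E))).
  rewrite le_eqVlt; apply/orP; left; apply/eqP.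
  by apply: eq_integral => y _; apply/esym; exact: (cvg_limn_einf_sup (cvk y)).1.
apply: le_trans (fatou mu measurableT _ _) _.
- by move=> n; apply: measurable_sqr; exact: measurable_ktr.
- by move=> n y _; rewrite lee_fin sqr_ge0.
apply: limn_einf_le => n; have -> := S_iso (gP n).1 : \int[mu]_x (ktr (g n) x ^+ 2)%:E = _.
rewrite [leRHS](_ : _ = kappa%:E * (4 * e)%:E); last by rewrite -EFinM; congr EFin; ring.
rewrite lee_wpmul2l// (le_trans (le_sqn_n12 (mg n)))//.
have -> : (g n = f \+ (fun x => -1 * (f \- g n) x))%R.
  by apply/funext => x /=; ring.
have mfg : measurable_fun setT (f \- g n)%R by exact: measurable_funB.
apply: le_trans (n12D mf _) _; first exact: measurable_funM.
rewrite (_ : 4 * e = 2 * (e + e))%R; last by ring.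
rewrite EFinM lee_pmul2l// EFinD leeD ?(ltW fe)//.
have fgn : n12 (f \- g n)%R < e%:E by rewrite (lt_le_trans (gP n).2)// lee_fin ge_min lexx.
apply: le_trans (ltW fgn); have := @le_n12 (fun x => -1 * (f \- g n) x)%R (f \- g n)%R 1%R ler01.
rewrite mul1e; apply => //; first exact: measurable_funM.
by move=> x; rewrite mul1r mulN1r normrN sqrrN.
Unshelve. all: by end_near. Qed.

(** The a priori bound for f - g, with g in S, makes the transforms of f and g close in L^2, so the
    isometry on S passes to f. *)
Theorem n12_closure_isometry f : C f -> sqn mu (ktr f) = kappa%:E * sqn mu f.
Proof.
move=> Cf; have [mf Cf'] := Cf.
have foo := n12_closure_lty Cf.
have foo2 : sqn mu f < +oo by rewrite (le_lt_trans (le_sqn_n12 mf)).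
have [e0 fe0] : exists e : R, n12 f < e%:E.
  exists (fine (n12 f) + 1)%R; rewrite EFinD fineK ?ge0_fin_numE ?n12_ge0//.
  by rewrite lteDl ?lte_fin// ge0_fin_numE ?n12_ge0.
have koo : sqn mu (ktr f) < +oo by rewrite (le_lt_trans (sqn_ktr_le Cf fe0))// ltry.
rewrite (sqn_fin koo) (sqn_fin foo2) -EFinM; congr EFin.
set a := fine (sqn mu (ktr f)); set b := fine (sqn mu f).
have a0 : (0 <= a)%R by rewrite fine_ge0// sqn_ge0.
have b0 : (0 <= b)%R by rewrite fine_ge0// sqn_ge0.
suff : (Num.sqrt a = Num.sqrt kappa * Num.sqrt b)%R.
  by rewrite -sqrtrM// => /eqP; rewrite eqr_sqrt// ?mulr_ge0// => /eqP.
apply/eqP; rewrite -subr_eq0 -normr_le0; apply/ler_addgt0Pl => e e_gt0; rewrite addr0.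
(* The distance of the transforms costs 2 sqrt(kappa) e/c and the comparison of the norms of f and g
   another sqrt(kappa) e/c. The summand 1 keeps c positive when kappa = 0. *)
pose c := (3 * Num.sqrt kappa + 1)%R.
have c0 : (0 < c)%R by rewrite ltr_wpDl// mulr_ge0// sqrtr_ge0.
pose eps := ((e / c) ^+ 2)%R.
have eps0 : (0 < eps)%R by rewrite exprn_gt0// divr_gt0.
have [g Sg fg] := Cf' _ eps0.
have mg := S_measurable Sg; have goo := S_n12 Sg.
have goo2 : sqn mu g < +oo by rewrite (le_lt_trans (le_sqn_n12 mg)).
have kgE : sqn mu (ktr g) = (kappa * fine (sqn mu g))%:E.
  by rewrite S_iso// (sqn_fin goo2) EFinM.
have kgoo : sqn mu (ktr g) < +oo by rewrite kgE ltry.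
have mfg : measurable_fun setT (f \- g)%R by exact: measurable_funB.
have Cfg : C (f \- g)%R.
  rewrite (_ : (f \- g)%R = (fun x => -1 * g x + f x)%R); last first.
    by apply/funext => x /=; ring.
  by apply: n12_closure_lin => //; exact: n12_closure_sub.
have kfg := sqn_ktr_le Cfg fg.
have kfgoo : sqn mu (ktr (f \- g)%R) < +oo by rewrite (le_lt_trans kfg)// ltry.
have fgoo2 : sqn mu (f \- g)%R < +oo.
  by rewrite (le_lt_trans (le_sqn_n12 mfg))// (lt_trans fg)// ltry.
have s1 : (Num.sqrt (fine (sqn mu (ktr (f \- g)%R))) <= 2 * Num.sqrt kappa * (e / c))%R.
  rewrite -[leRHS]ger0_norm; last by rewrite !mulr_ge0 ?sqrtr_ge0 ?invr_ge0 ?ltW.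
  rewrite -sqrtr_sqr ler_wsqrtr// -lee_fin -(sqn_fin kfgoo).
  rewrite (le_trans kfg)// lee_fin !exprMn sqr_sqrtr// /eps.
  by rewrite le_eqVlt; apply/orP; left; apply/eqP; ring.
have s2 : (Num.sqrt (fine (sqn mu (f \- g)%R)) <= e / c)%R.
  rewrite -[leRHS]ger0_norm; last by rewrite divr_ge0 ?ltW.
  rewrite -sqrtr_sqr ler_wsqrtr// -lee_fin -(sqn_fin fgoo2).
  by rewrite (le_trans (le_sqn_n12 mfg))// ltW.
have mkf := measurable_ktr mf; have mkg := measurable_ktr mg.
have mkfg := measurable_ktr mfg.
have kB y : ktr (f \- g)%R y = (ktr f y - ktr g y)%R by rewrite ktrB.
have tri (u v : R) : (`|u| <= `|v| + `|u - v|)%R.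
  by have := ler_normD v (u - v)%R; rewrite (_ : v + (u - v) = u)%R//; ring.
(* Norms are compared in both directions; the terms with [eq_ind_r] only transport the triangle
   inequality along [kB] and the symmetry of the distance. *)
have [_ t1] : _ /\ _ := sqn_triangle (u := ktr f) mkf mkg mkfg
  (fun y => eq_ind_r (fun z => `|ktr f y| <= `|ktr g y| + `|z|)%R (tri _ _) (kB y)) kgoo kfgoo.
have [_ t2] : _ /\ _ := sqn_triangle (u := ktr g) mkg mkf mkfg
  (fun y => eq_ind_r (fun z => `|ktr g y| <= `|ktr f y| + `|z|)%R
    (eq_ind_r (fun z => `|ktr g y| <= `|ktr f y| + z)%R (tri _ _) (distrC _ _)) (kB y)) koo kfgoo.
have [_ t3] : _ /\ _ := sqn_triangle (u := f) mf mg mfg (fun x => tri _ _) goo2 fgoo2.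
have [_ t4] : _ /\ _ := sqn_triangle (u := g) mg mf mfg
  (fun y => eq_ind_r (fun z => `|g y| <= `|f y| + z)%R (tri _ _) (distrC _ _)) foo2 fgoo2.
move: t1 t2; rewrite kgE /= sqrtrM// -/a => t1 t2.
move: t3 t4; rewrite -/b => t3 t4.
have ecE : ((3 * Num.sqrt kappa + 1) * (e / c) = e)%R by rewrite mulrC divfK// gt_eqF.
have ec0 : (0 <= e / c)%R by rewrite divr_ge0 ?ltW.
have k0 := sqrtr_ge0 kappa.
have h3 : (Num.sqrt kappa * Num.sqrt b <= Num.sqrt kappa * (Num.sqrt (fine (sqn mu g)) + e / c))%R.
  by apply: ler_wpM2l => //; rewrite (le_trans t3)// lerD2l.
have h4 : (Num.sqrt kappa * Num.sqrt (fine (sqn mu g)) <= Num.sqrt kappa * (Num.sqrt b + e / c))%R.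
  by apply: ler_wpM2l => //; rewrite (le_trans t4)// lerD2l.
move: ecE s1 h3 h4 t1 t2 ec0.
move: (Num.sqrt (fine (sqn mu (ktr (f \- g)%R)))) (Num.sqrt (fine (sqn mu g))) => X Y.
move: (Num.sqrt a) (Num.sqrt b) (Num.sqrt kappa) (e / c)%R => A B K r.
rewrite ler_norml !mulrDr mulrDl mul1r -!mulrA.
move: (K * r)%R (K * Y)%R (K * B)%R => Kr KY KB *.
by apply/andP; split; lra.
Qed.

End kernel.
End dense_isometry.

(** * Plancherel on the real line *)

Section gaussian_span.
Variable R : realType.
Variable chi : R.
Hypothesis chi_ge0 : 0 <= chi.
Local Notation leb := (@lebesgue_measure R).
Local Notation nu := (nu chi).
Local Notation N12 := (n12 nu).
Local Open Scope ereal_scope.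

(* x^b exp(-p x^2 / 2), where the boolean b stands for the exponent 0 or 1. *)
Definition gen (b : bool) (p x : R) : R := (x ^+ b * gs p x)%R.

Inductive gspan : (R -> R) -> Prop :=
| gspan_gen b p : (0 < p)%R -> gspan (gen b p)
| gspan_lin a g h : gspan g -> gspan h -> gspan (fun x => a * g x + h x)%R.

Lemma measurable_gen b p : measurable_fun [set: R] (gen b p).
Proof. by apply: measurable_funM; [exact: measurable_funX|exact: measurable_gs]. Qed.

Lemma gspan_measurable g : gspan g -> measurable_fun [set: R] g.
Proof.
elim=> [b p _|a f h _ mf _ mh]; first exact: measurable_gen.
by apply: measurable_funD => //; exact: measurable_funM.
Qed.

Lemma gen_sqr b p x : (gen b p x ^+ 2 = `|x| `^ (2 * b%:R) * gs (p + p) x)%R.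
Proof.
rewrite /gen exprMn -gsD -expr2 -natrM powR_mulrn//; congr (_ * _)%R.
by case: b; rewrite ?expr0 ?expr1n//= muln1 real_normK ?num_real.
Qed.

Lemma norm_gen b p x : (`|gen b p x| = `|x| `^ b%:R * gs p x)%R.
Proof. by rewrite /gen normrM (ger0_norm (gs_ge0 _ _)) normrX powR_mulrn. Qed.

Lemma gen_n12 b (p : R) : (0 < p)%R -> N12 (gen b p) < +oo.
Proof.
move=> p0; rewrite /N12.
under eq_integral do rewrite EFinD.
rewrite ge0_integralD//; last 3 first.
- by apply/measurable_EFinP; apply: measurableT_comp => //; exact: measurable_gen.
- by move=> x _; rewrite lee_fin sqr_ge0.
- by apply: measurable_sqr; exact: measurable_gen.
rewrite lte_add_pinfty//.
- under eq_integral do rewrite norm_gen.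
  exact: integral_nu_gs.
- under eq_integral do rewrite gen_sqr.
  by apply: integral_nu_gs => //; rewrite ?mulr_ge0// addr_gt0.
Qed.

Lemma gspan_n12 g : gspan g -> N12 g < +oo.
Proof.
elim=> [b p|a f h Sf foo Sh hoo]; first exact: gen_n12.
have mf := gspan_measurable Sf; have mh := gspan_measurable Sh.
have maf : measurable_fun [set: R] (fun x => a * f x)%R by exact: measurable_funM.
apply: le_lt_trans (n12D nu maf mh) _.
rewrite lte_mul_pinfty// lte_add_pinfty//.
apply: le_lt_trans (n12Z nu a mf) _.
by rewrite lte_mul_pinfty// lee_fin addr_ge0 ?sqr_ge0.
Qed.

Lemma ge0_integral_nu_scale (f : R -> \bar R) (a : R) : a != 0%R ->
  measurable_fun [set: R] f -> (forall x, 0 <= f x) ->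
  \int[nu]_x f (a * x)%R = ((`|a| `^ (2 * chi + 2))^-1)%:E * \int[nu]_x f x.
Proof.
move=> a0 mf f0.
have mfa : measurable_fun [set: R] (fun x => f (a * x)%R).
  by apply: (measurableT_comp mf); exact: measurable_funM.
have mdw : measurable_fun [set: R] (fun x => (dw chi x)%:E).
  by apply/measurable_EFinP; exact: measurable_dw.
rewrite (ge0_integral_nu chi mfa (fun=> f0 _)) (ge0_integral_nu chi mf f0).
have na0 : (0 < `|a|)%R by rewrite normr_gt0.
pose F x := f x * (dw chi x)%:E.
have mF : measurable_fun [set: R] F by exact: emeasurable_funM.
have F0 x : 0 <= F x by rewrite mule_ge0// lee_fin dw_ge0.
have c0 : (0 <= (`|a| `^ (2 * chi + 1))^-1)%R by rewrite invr_ge0 powR_ge0.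
transitivity (\int[leb]_x (((`|a| `^ (2 * chi + 1))^-1)%:E * F (a * x)%R)).
  apply: eq_integral => x _; rewrite /F muleCA; congr (_ * _); rewrite -EFinM; congr EFin.
  by rewrite /dw normrM powRM// mulKf// gt_eqF// powR_gt0.
have mFa : measurable_fun [set: R] (fun x => F (a * x)%R).
  by apply: (measurableT_comp mF); exact: measurable_funM.
rewrite (ge0_integralZl_EFin leb measurableT (fun x _ => F0 _) mFa c0).
rewrite (ge0_integral_scale a0 mF F0) muleA -EFinM; congr (_%:E * _).
rewrite -invfM; congr (_^-1)%R.
rewrite -[X in (_ * X)%R]powRr1// -powRD; last by rewrite (gt_eqF na0) implybT.
by congr (_ `^ _)%R; clear; ring.
Qed.

(** The Gaussian moment of order 2b. Only its scaling in r is used; the value at r = 1 is never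
    computed because it occurs on both sides of the isometry. *)
Definition mom b (r : R) : \bar R := \int[nu]_x (gen b r x * x ^+ b)%:E.

Lemma gen_mom_ge0 b r x : (0 <= gen b r x * x ^+ b)%R.
Proof. by rewrite /gen mulrAC -expr2 mulr_ge0 ?sqr_ge0 ?gs_ge0. Qed.

Lemma measurable_gen_mom b r : measurable_fun [set: R] (fun x => gen b r x * x ^+ b)%R.
Proof. by apply: measurable_funM; [exact: measurable_gen|exact: measurable_funX]. Qed.

Lemma mom_fin b (r : R) : (0 < r)%R -> mom b r \is a fin_num.
Proof.
move=> r0; rewrite ge0_fin_numE; last first.
  by apply: integral_ge0 => x _; rewrite lee_fin gen_mom_ge0.
apply: le_lt_trans (integral_nu_gs chi_ge0 (_ : 0 <= 2 * b%:R)%R r0); last by rewrite mulr_ge0.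
rewrite le_eqVlt; apply/orP; left; apply/eqP; apply: eq_integral => x _.
rewrite /gen mulrAC; congr (_ * _)%:E.
by rewrite -natrM powR_mulrn// mul2n -addnn exprD -!normrX -normrM ger0_norm// -expr2 sqr_ge0.
Qed.

Lemma momE b (r : R) : (0 < r)%R -> mom b r = ((r `^ (chi + 1 + b%:R))^-1)%:E * mom b 1.
Proof.
move=> r0; have s0 : (0 < Num.sqrt r)%R by rewrite sqrtr_gt0.
have mm : measurable_fun [set: R] (fun x => (gen b 1 x * x ^+ b)%:E).
  by apply/measurable_EFinP; exact: measurable_gen_mom.
have H := ge0_integral_nu_scale (lt0r_neq0 s0) mm (fun x => gen_mom_ge0 b 1 x).
have E : \int[nu]_x (gen b 1 (Num.sqrt r * x) * (Num.sqrt r * x) ^+ b)%:E =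
    (r ^+ b)%:E * mom b r.
  rewrite /mom -ge0_integralZl_EFin//; last 3 first.
  - by move=> x _; rewrite lee_fin gen_mom_ge0.
  - by apply/measurable_EFinP; exact: measurable_gen_mom.
  - by rewrite exprn_ge0// ltW.
  apply: eq_integral => x _; rewrite -EFinM; congr EFin.
  have -> : gen b 1 (Num.sqrt r * x) = ((Num.sqrt r * x) ^+ b * gs r x)%R.
    rewrite /gen; congr (_ * _)%R; rewrite /gs exprMn sqr_sqrtr ?ltW//; congr (expR (- _)).
    by rewrite mulrA; congr (_ * _)%R; rewrite div1r mulrC.
  have -> : (r ^+ b = (Num.sqrt r ^+ b) ^+ 2)%R.
    by rewrite -exprM mulnC exprM sqr_sqrtr// ltW.
  by rewrite /gen !exprMn; ring.
rewrite -/(mom b 1) E in H.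
have rb0 : (0 < r ^+ b)%R by rewrite exprn_gt0.
have := congr1 (fun z => ((r ^+ b)^-1)%:E * z) H.
rewrite !muleA -!EFinM mulVf; last by rewrite gt_eqF.
rewrite mul1e => ->; congr (_%:E * _).
rewrite -invfM; congr (_^-1)%R.
rewrite ger0_norm ?sqrtr_ge0// -powR12_sqrt ?ltW// -powRrM -powR_mulrn ?ltW//.
rewrite -powRD; last by rewrite (gt_eqF r0) implybT.
by congr (_ `^ _)%R; clear; field.
Qed.

Definition dkc : R := (Gamma (chi + 1) / (Num.sqrt pi * Gamma (chi + 2^-1)))%R.
(** The real counterpart of the Dunkl kernel, obtained by replacing the imaginary unit with 1. *)
Definition dkernel (z : R) : R := (dkc * (Ac chi z + Bc chi z))%R.
(** The eigenvalue of the transform on x^b exp(-x^2/2) for l = 1; its inverse is a factor of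
    [frac_const]. *)
Definition bigD : R := (2 `^ (chi + 1) * Gamma (chi + 1))%R.

Variable l : R.
Hypothesis l_neq0 : l != 0%R.

Local Notation k := (fun y x => dkernel (l * y * x))%R.

Lemma norm_dkernel z : (`|dkernel z| <= `|dkc| * (wtot chi + wtot chi))%R.
Proof.
rewrite normrM ler_wpM2l// (le_trans (ler_normD _ _))// lerD//.
  exact: norm_Ac.
exact: norm_Bc.
Qed.

Lemma measurable_dkernel : measurable_fun [set: R] dkernel.
Proof.
apply: measurable_funM => //; apply: measurable_funD; [exact: measurable_Ac|].
exact: measurable_Bc.
Qed.

Lemma measurable_dkernel2 : measurable_fun [set: R * R] (fun z => k z.1 z.2).
Proof.
apply: (measurableT_comp measurable_dkernel).
by apply: measurable_funM => //; exact: measurable_funM.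
Qed.

(** By parity only [Ac] contributes for b = 0 and only [Bc] for b = 1. The constant [dkc] then
    cancels sqrt(pi) Gamma(chi + 1/2), which leaves [bigD]. *)
Lemma ktr_gen b (p y : R) : (0 < p)%R ->
  ktr nu k (gen b p) y =
  (bigD * (p `^ (chi + 1 + b%:R))^-1 * gen b p^-1 (l * y))%R.
Proof.
move=> p0; rewrite /ktr.
have mg := @measurable_gen b p; have goo := gen_n12 b p0.
have bound := norm_Ac chi_ge0; have boundB := norm_Bc chi_ge0.
have mA : measurable_fun [set: R] (fun x => Ac chi (l * y * x)).
  by apply: (measurableT_comp (measurable_Ac chi)); exact: measurable_funM.
have mB : measurable_fun [set: R] (fun x => Bc chi (l * y * x)).
  by apply: (measurableT_comp (measurable_Bc chi)); exact: measurable_funM.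
have w0 : (0 <= wtot chi)%R := le_trans (normr_ge0 _) (bound 0%R).
have iA : nu.-integrable setT (EFin \o (fun x => Ac chi (l * y * x) * gen b p x)%R).
  apply: (@integrable_leR R nu _ (fun x => `|gen b p x| + gen b p x ^+ 2)%R (wtot chi) w0) => //.
  - exact: measurable_funM.
  - exact: measurable_n12.
  - by move=> x; rewrite addr_ge0 ?sqr_ge0.
  - by move=> x; rewrite normrM ler_pM// lerDl sqr_ge0.
have iB : nu.-integrable setT (EFin \o (fun x => Bc chi (l * y * x) * gen b p x)%R).
  apply: (@integrable_leR R nu _ (fun x => `|gen b p x| + gen b p x ^+ 2)%R (wtot chi) w0) => //.
  - exact: measurable_funM.
  - exact: measurable_n12.
  - by move=> x; rewrite addr_ge0 ?sqr_ge0.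
  - by move=> x; rewrite normrM ler_pM// lerDl sqr_ge0.
transitivity (dkc * (\int[nu]_x (Ac chi (l * y * x) * gen b p x) +
                     \int[nu]_x (Bc chi (l * y * x) * gen b p x)))%R.
  rewrite -RintegralD// -RintegralZl//; last first.
    rewrite (_ : _ \o _ = (EFin \o (fun x => Ac chi (l * y * x) * gen b p x)%R) \+
       (EFin \o (fun x => Bc chi (l * y * x) * gen b p x)%R))//; exact: integrableD.
  by apply: eq_Rintegral => x _; rewrite /dkernel -mulrA mulrDl.
have gpi0 : (0 < Num.sqrt pi :> R)%R by rewrite sqrtr_gt0 pi_gt0.
have ga0 : (0 < Gamma (chi + 2^-1) :> R)%R by apply: Gamma_gt0; move: chi_ge0; lra.
case: b {mg goo iA iB} => /=; rewrite /gen/=.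
- under eq_Rintegral do rewrite expr1.
  rewrite integral_Ac_gs_odd add0r.
  under eq_Rintegral do rewrite expr1.
  rewrite integral_Bc_gs// kp_gsin// expr1.
  have -> : (chi + 1 + 1 = chi + 2)%R by ring.
  move: (powR_gt0 (chi + 2) p0) gpi0 ga0; rewrite /dkc /bigD; clear => h1 h2 h3.
  by field; rewrite !gt_eqF.
- under eq_Rintegral do rewrite expr0 mul1r.
  under [X in (_ + X)%R]eq_Rintegral do rewrite expr0 mul1r.
  rewrite (integral_Bc_gs_even chi_ge0) integral_Ac_gs// kp_gcos// expr0 mul1r !addr0.
  move: (powR_gt0 (chi + 1) p0) gpi0 ga0; rewrite /dkc /bigD; clear => h1 h2 h3.
  by field; rewrite !gt_eqF.
Qed.

(** The power of |l| is the effect on [nu] of the dilation by l. *)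
Definition kappa : R := (bigD ^+ 2 * (`|l| `^ (2 * chi + 2))^-1)%R.

Lemma kappa_ge0 : (0 <= kappa)%R.
Proof. by rewrite mulr_ge0 ?sqr_ge0// invr_ge0 powR_ge0. Qed.

Lemma Rintegral_genM b (p q : R) : (0 < p)%R -> (0 < q)%R ->
  nu.-integrable setT (EFin \o (fun x => gen b p x * gen b q x)%R) /\
  (\int[nu]_x (gen b p x * gen b q x) =
   ((p + q) `^ (chi + 1 + b%:R))^-1 * fine (mom b 1))%R.
Proof.
move=> p0 q0; have pq0 := addr_gt0 p0 q0.
have -> : (fun x => gen b p x * gen b q x)%R = (fun x => gen b (p + q) x * x ^+ b)%R.
  by apply/funext => x; rewrite /gen -gsD mulrACA -!mulrA; congr (_ * _)%R; rewrite mulrC -!mulrA.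
split; last first.
  by rewrite /Rintegral -/(mom b (p + q)) momE// -(fineK (mom_fin b ltr01)).
apply/integrableP; split; first by apply/measurable_EFinP; exact: measurable_gen_mom.
under eq_integral do rewrite gee0_abs ?lee_fin ?gen_mom_ge0//.
rewrite -/(mom b (p + q)) -ge0_fin_numE ?mom_fin//.
by apply: integral_ge0 => x _; rewrite lee_fin gen_mom_ge0.
Qed.

Lemma Rintegral_genM_neq b b' (p q : R) : (0 < p)%R -> (0 < q)%R -> b != b' ->
  nu.-integrable setT (EFin \o (fun x => gen b p x * gen b' q x)%R) /\
  (\int[nu]_x (gen b p x * gen b' q x) = 0)%R.
Proof.
move=> p0 q0 bb'.
have E x : (gen b p x * gen b' q x = x * gs (p + q) x)%R.
  rewrite /gen -gsD; case: b b' bb' => [] [] //= _; rewrite expr0 expr1; ring.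
have mE : measurable_fun [set: R] (fun x => gen b p x * gen b' q x)%R.
  by apply: measurable_funM; exact: measurable_gen.
split; last first.
  by apply: Rintegral_nu_odd => // x; rewrite !E gsN mulNr.
apply: (@integrable_leR R nu _ (fun x => `|x| `^ 1 * gs (p + q) x)%R 1%R ler01) => //.
- by apply: measurable_funM; [exact: measurable_norm_powR|exact: measurable_gs].
- by move=> x; rewrite mulr_ge0 ?powR_ge0 ?gs_ge0.
- by move=> x; rewrite mul1r E normrM powRr1// (ger0_norm (gs_ge0 _ _)).
- by apply: integral_nu_gs => //; exact: addr_gt0.
Qed.

(* The polarised isometry, bundled with the integrability that makes it stable
   under linear combinations in each argument. *)
Definition polar (f g : R -> R) := [/\
  nu.-integrable setT (EFin \o (fun x => f x * g x)%R),
  nu.-integrable setT (EFin \o (fun x => ktr nu k f x * ktr nu k g x)%R) &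
  (\int[nu]_x (ktr nu k f x * ktr nu k g x) = kappa * \int[nu]_x (f x * g x))%R].

(** For different parities both integrands are odd. For equal parities both sides are powers with
    exponent chi + 1 + b times the same moment, and the bases match because p q (l^2/p + l^2/q) =
    l^2 (p + q). *)
Lemma polar_gen b b' (p q : R) : (0 < p)%R -> (0 < q)%R ->
  polar (gen b p) (gen b' q).
Proof.
move=> p0 q0.
have l20 : (0 < l ^+ 2)%R by rewrite exprn_even_gt0.
(* The Gaussian with parameter 1/p evaluated at l x is the Gaussian with parameter l^2/p at x. *)
pose P : R := (l ^+ 2 / p)%R; pose Q : R := (l ^+ 2 / q)%R.
have P0 : (0 < P)%R by rewrite divr_gt0. have Q0 : (0 < Q)%R by rewrite divr_gt0.
have genl (d : bool) (r x : R) : gen d r^-1 (l * x) = (l ^+ d * gen d (l ^+ 2 / r) x)%R.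
  rewrite /gen /gs !exprMn mulrA; congr (_ * expR (- _))%R.
  by clear; ring.
pose c : R := (bigD * (p `^ (chi + 1 + b%:R))^-1 * (bigD * (q `^ (chi + 1 + b'%:R))^-1) * (l ^+ b * l ^+ b'))%R.
have kE : (fun x => ktr nu k (gen b p) x * ktr nu k (gen b' q) x)%R =
    (fun x => c * (gen b P x * gen b' Q x))%R.
  by apply/funext => x; rewrite !ktr_gen// !genl /c /P /Q; ring.
have ikc : nu.-integrable setT (EFin \o (fun x => gen b P x * gen b' Q x)%R) ->
  nu.-integrable setT (EFin \o (fun x => c * (gen b P x * gen b' Q x))%R).
  move=> i; rewrite (_ : _ \o _ = fun x => c%:E * (EFin \o (fun x => gen b P x * gen b' Q x)%R) x)//.
  exact: integrableZl.
rewrite /polar kE.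
have [bb'|bb'] := eqVneq b b'; last first.
  have [i1 e1] := Rintegral_genM_neq p0 q0 bb'.
  have [i2 e2] := Rintegral_genM_neq P0 Q0 bb'.
  split => //; first exact: ikc.
  by rewrite (RintegralZl c measurableT i2) e1 e2 !mulr0.
subst b'.
have [i1 e1] := Rintegral_genM b p0 q0.
have [i2 e2] := Rintegral_genM b P0 Q0.
split => //; first exact: ikc.
rewrite (RintegralZl c measurableT i2) e1 e2 !mulrA; congr (_ * _)%R.
rewrite /c /kappa.
have pc0 : (p `^ (chi + 1 + b%:R) != 0)%R by rewrite gt_eqF// powR_gt0.
have qc0 : (q `^ (chi + 1 + b%:R) != 0)%R by rewrite gt_eqF// powR_gt0.
have PQ : (p `^ (chi + 1 + b%:R) * q `^ (chi + 1 + b%:R) * (P + Q) `^ (chi + 1 + b%:R) =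
    `|l| `^ (2 * chi + 2) * (l ^+ b * l ^+ b) * (p + q) `^ (chi + 1 + b%:R))%R.
  rewrite -!powRM ?mulr_ge0 ?addr_ge0 ?ltW//.
  have -> : (p * q * (P + Q) = l ^+ 2 * (p + q))%R.
    rewrite /P /Q; move: (lt0r_neq0 p0) (lt0r_neq0 q0); clear => p1 q1.
    by field; rewrite p1 q1.
  rewrite powRM ?addr_ge0 ?ltW//; congr (_ * _)%R.
  have -> : (l ^+ b * l ^+ b = `|l| `^ (2 * b%:R))%R.
    rewrite -natrM powR_mulrn// mul2n -addnn exprD -!normrX -normrM ger0_norm//.
    by rewrite -expr2 sqr_ge0.
  rewrite -powRD; last by rewrite normr_eq0 l_neq0 implybT.
  rewrite -real_normK ?num_real// -powR_mulrn// -powRrM.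
  by congr (_ `^ _)%R; clear; ring.
have PQ0 : ((P + Q) `^ (chi + 1 + b%:R) != 0)%R by apply: lt0r_neq0; apply: powR_gt0; exact: addr_gt0.
have pq0 : ((p + q) `^ (chi + 1 + b%:R) != 0)%R by apply: lt0r_neq0; apply: powR_gt0; exact: addr_gt0.
have ln0 : (`|l| `^ (2 * chi + 2) != 0)%R by apply: lt0r_neq0; apply: powR_gt0; rewrite normr_gt0.
have lb0 : (l ^+ b != 0)%R by rewrite expf_neq0.
move: PQ pc0 qc0 PQ0 pq0 ln0 lb0; clear.
move: (p `^ _)%R (q `^ _)%R ((P + Q) `^ _)%R ((p + q) `^ _)%R (`|l| `^ _)%R (l ^+ b)%R => x y z u v w.
move=> H x0 y0 z0 u0 v0 w0.
have -> : (bigD / x * (bigD / y) * (w * w) / z = bigD ^+ 2 * (w * w) / (x * y * z))%R.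
  by field; rewrite x0 y0 z0.
by rewrite H; field; rewrite v0 u0 w0.
Qed.

Lemma ktr_lin (a : R) g h y : gspan g -> gspan h ->
  ktr nu k (fun x => a * g x + h x)%R y = (a * ktr nu k g y + ktr nu k h y)%R.
Proof.
move=> Sg Sh; have mg := gspan_measurable Sg; have mh := gspan_measurable Sh.
have ig := @integrable_ktr _ (measurableTypeR R) R nu k _ measurable_dkernel2
  (fun y x => norm_dkernel _) g y mg (gspan_n12 Sg).
have ih := @integrable_ktr _ (measurableTypeR R) R nu k _ measurable_dkernel2
  (fun y x => norm_dkernel _) h y mh (gspan_n12 Sh).
rewrite /ktr -(RintegralZl a measurableT ig) -RintegralD//.
  by apply: eq_Rintegral => x _; clear; ring.
rewrite (_ : _ \o _ = fun x => a%:E * (EFin \o (fun x => k y x * g x)%R) x)//.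
exact: integrableZl.
Qed.

Lemma polar_sym f g : polar f g -> polar g f.
Proof.
have C (u v : R -> R) : (fun x => u x * v x)%R = (fun x => v x * u x)%R.
  by apply/funext => x; rewrite mulrC.
by rewrite /polar C [X in _ -> [/\ _, nu.-integrable _ (_ \o X) & _]]C [(fun x => ktr nu k g x * _)%R]C.
Qed.

Lemma polar_lin (a : R) f g h : gspan f -> gspan g -> polar f h -> polar g h ->
  polar (fun x => a * f x + g x)%R h.
Proof.
move=> Sf Sg [f1 f2 f3] [g1 g2 g3].
have Z (u : R -> R) : nu.-integrable setT (EFin \o u) ->
   nu.-integrable setT (EFin \o (fun x => a * u x)%R).
  move=> i; rewrite (_ : _ \o _ = fun x => a%:E * (EFin \o u) x)//.
  exact: integrableZl.
have E1 : (fun x => (a * f x + g x) * h x)%R = (fun x => a * (f x * h x) + g x * h x)%R.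
  by apply/funext => x; ring.
have E2 : (fun x => ktr nu k (fun x => a * f x + g x) x * ktr nu k h x)%R =
    (fun x => a * (ktr nu k f x * ktr nu k h x) + ktr nu k g x * ktr nu k h x)%R.
  by apply/funext => x; rewrite ktr_lin//; ring.
have D (u v : R -> R) : nu.-integrable setT (EFin \o u) ->
   nu.-integrable setT (EFin \o v) ->
   nu.-integrable setT (EFin \o (fun x => a * u x + v x)%R) /\
   (\int[nu]_x (a * u x + v x) = a * \int[nu]_x u x + \int[nu]_x v x)%R.
  move=> iu iv; split.
    rewrite (_ : _ \o _ = (EFin \o (fun x => a * u x)%R) \+ (EFin \o v))//.
    by apply: integrableD => //; exact: Z.
  by rewrite (RintegralD measurableT (Z _ iu) iv) (RintegralZl a measurableT iu).
rewrite /polar E1 E2.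
have [i1 ->] := D _ _ f1 g1; have [i2 ->] := D _ _ f2 g2.
by split => //; rewrite f3 g3; ring.
Qed.

Lemma gspan_polar f g : gspan f -> gspan g -> polar f g.
Proof.
move=> Sf; elim=> [b p p0|a g1 g2 S1 P1 S2 P2]; last first.
  by apply: polar_sym; apply: polar_lin => //; exact: polar_sym.
elim: Sf => [b' p' p'0|a f1 f2 S1 P1 S2 P2]; first exact: polar_gen.
exact: polar_lin.
Qed.

Lemma gspan_isometry g : gspan g -> sqn nu (ktr nu k g) = kappa%:E * sqn nu g.
Proof.
move=> Sg; have [i1 i2 i3] := gspan_polar Sg Sg.
rewrite /sqn; under eq_integral do rewrite expr2.
under [in RHS]eq_integral do rewrite expr2.
have := congr1 EFin i3; rewrite EFinM /Rintegral !fineK//.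
- exact: (integrable_fin_num measurableT i1).
- exact: (integrable_fin_num measurableT i2).
Qed.

End gaussian_span.

Section exp_limits.
Variable R : realType.

Lemma exp_coeff_partial_le (z : R) n :
  (`|\sum_(0 <= k < n) (k`!%:R^-1 * (- z) ^+ k)| <= expR `|z|)%R.
Proof.
apply: le_trans (ler_norm_sum _ _ _) _.
have -> : (\sum_(0 <= k < n) `|k`!%:R^-1 * (- z) ^+ k| = series (exp_coeff `|z|) n)%R.
  rewrite /series/=; apply: eq_big_nat => k _.
  by rewrite normrM normrX normrN ger0_norm// /exp_coeff/= mulrC.
apply: nondecreasing_cvgn_le; last exact: is_cvg_series_exp_coeff.
apply/nondecreasing_seqP => k; rewrite /series/= big_nat_recr//= lerDl.
by rewrite /exp_coeff/= divr_ge0// exprn_ge0.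
Qed.

Lemma cvg_exp_partial (z : R) :
  (\sum_(0 <= k < n) (k`!%:R^-1 * (- z) ^+ k))%R @[n --> \oo] --> expR (- z).
Proof.
rewrite (_ : (fun n => _) = series (exp_coeff (- z))); first exact: is_cvg_series_exp_coeff.
by apply/funext => n; apply: eq_big_nat => k _; rewrite /exp_coeff/= mulrC.
Qed.

(* The factor n.+1 in front of the inner exponential makes the limit at u = r
   vanish. *)
Lemma cvg_gumbel (r u : R) :
  expR (- (n.+1%:R * expR (n.+1%:R * (r - u)))) @[n --> \oo] --> (\1_(`]r, +oo[%classic) u : R).
Proof.
have hN : n.+1%:R^-1 @[n --> \oo] --> (0%R : R) by exact: cvg_harmonic.
rewrite indicE; have [ur|ur] := ltP r u.
  have -> : ((u \in `]r, +oo[%classic)%:R = expR (- 0) :> R)%R.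
    by rewrite oppr0 expR0 mem_set//= in_itv/= ur.
  apply: (@cvg_comp _ _ _ (fun n : nat => - (n.+1%:R * expR (n.+1%:R * (r - u))))%R expR); last exact: continuous_expR.
  apply: (@cvgN R R^o).
  pose d := (u - r)%R; have d0 : (0 < d)%R by rewrite subr_gt0.
  (* From exp z >= z^2/2 with z = (n+1) d, one gets (n+1) exp(-(n+1) d) <= 2/((n+1) d^2). *)
  have h : (2 / d ^+ 2 * n.+1%:R^-1)%R @[n --> \oo] --> (0%R : R).
    by rewrite -[X in _ --> X](mulr0 (2 / d ^+ 2)%R); apply: cvgM => //; exact: cvg_cst.
  apply: (squeeze_cvgr _ (cvg_cst 0%R) h); near=> n.
  rewrite mulr_ge0 ?expR_ge0//= -opprB -/d mulrN expRN.
  have x0 : (0 <= n.+1%:R * d)%R by rewrite mulr_ge0// ltW.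
  have H : (n.+1%:R * d) ^+ 2 / 2 <= expR (n.+1%:R * d).
    by apply: le_trans (expR_ge1Dxn 1 x0); rewrite lerDr.
  rewrite ler_pdivrMr ?expR_gt0//.
  rewrite (le_trans _ (ler_wpM2l _ H))//; last first.
    by rewrite mulr_ge0 ?invr_ge0 ?divr_ge0 ?sqr_ge0.
  rewrite le_eqVlt; apply/orP; left; apply/eqP.
  by move: (lt0r_neq0 d0); rewrite /d; have := pnatr_eq0 R n.+1; clear; move: (u - r)%R (n.+1%:R : R) => v w w0 v0; field; rewrite v0 w0.
rewrite memNset; last by rewrite /= in_itv/= andbT; apply/negP; rewrite -leNgt.
(* For u <= r the inner exponential is at least 1, so the value is at most exp(-(n+1)) <=
   1/(n+1). *)
apply: (squeeze_cvgr _ (cvg_cst 0%R) hN); near=> n.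
rewrite expR_ge0/= expRN lef_pV2 ?posrE ?expR_gt0//.
apply: le_trans (expR_ge1Dx _).
rewrite (@le_trans _ _ (n.+1%:R * expR (n.+1%:R * (r - u))))%R//; last by rewrite lerDr.
rewrite ler_peMr// -expR0 ler_expR mulr_ge0// subr_ge0.
by [].
Unshelve. all: by end_near. Qed.

End exp_limits.

(** * Density of the Gaussian span *)

Section gaussian_totality.
Variable R : realType.
Variable chi : R.
Hypothesis chi_ge0 : 0 <= chi.
Local Notation nu := (nu chi).
Local Notation N12 := (n12 nu).
Local Notation C := (n12_closure nu (@gspan R)).
Local Open Scope ereal_scope.

Let Sm := @gspan_measurable R.
Let Sl := @gspan_lin R.

Let C_lin a f g : C f -> C g -> C (fun x => a * f x + g x)%R.
Proof. exact: (@n12_closure_lin _ (measurableTypeR R) R nu _ Sm Sl). Qed.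

Let C_dom (f_ : nat -> R -> R) (f h : R -> R) :
  (forall n, C (f_ n)) -> measurable_fun [set: R] f -> measurable_fun [set: R] h ->
  (forall x, f_ n x @[n --> \oo] --> f x) ->
  (forall n x, `|f_ n x| <= h x)%R -> N12 h < +oo -> C f.
Proof. exact: (@n12_closure_dominated _ (measurableTypeR R) R nu _ Sm). Qed.

Let C_sub g : gspan g -> C g.
Proof. exact: (@n12_closure_sub _ (measurableTypeR R) R nu _ Sm). Qed.

Lemma closure0 : C (fun=> 0%R).
Proof.
have Cg : C (gen false 1) by apply: C_sub; exact: gspan_gen.
rewrite (_ : (fun=> 0%R) = (fun x => -1 * gen false 1 x + gen false 1 x)%R); first exact: C_lin.
by apply/funext => x; rewrite mulN1r addNr.
Qed.

Lemma closure_sum (I : Type) (s : seq I) (F : I -> R -> R) :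
  (forall i, C (F i)) -> C (fun x => \sum_(i <- s) F i x)%R.
Proof.
move=> CF; elim: s => [|i s ih].
  by under eq_fun do rewrite big_nil; exact: closure0.
under eq_fun do rewrite big_cons -[X in (X + _)%R]mul1r.
exact: C_lin.
Qed.

Lemma closureZ a f : C f -> C (fun x => a * f x)%R.
Proof.
move=> Cf; rewrite (_ : (fun x => _) = (fun x => a * f x + 0)%R).
  by apply: C_lin => //; exact: closure0.
by apply/funext => x; rewrite addr0.
Qed.

Lemma closureB f g : C f -> C g -> C (f \- g)%R.
Proof.
move=> Cf Cg; rewrite (_ : (f \- g)%R = (fun x => -1 * g x + f x)%R); first exact: C_lin.
by apply/funext => x /=; rewrite mulN1r addrC.
Qed.

Variable b : bool.
Local Notation E := (gen b 2).

Let mE : measurable_fun [set: R] E := @measurable_gen R b 2.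
Let Eoo : N12 E < +oo := gen_n12 chi_ge0 b (ltr0n R 2).

Let CE : C E.
Proof. by apply: C_sub; exact: gspan_gen. Qed.

Lemma n12_bounded (g : R -> R) (M : R) : (0 <= M)%R -> N12 (fun x => M * `|E x|)%R < +oo.
Proof.
move=> M0.
have mnE : measurable_fun [set: R] (fun x => `|E x|)%R by exact: measurableT_comp.
apply: le_lt_trans (n12Z nu M mnE) _.
rewrite lte_mul_pinfty// ?lee_fin ?addr_ge0 ?sqr_ge0//.
apply: le_lt_trans Eoo; rewrite le_eqVlt; apply/orP; left; apply/eqP.
by apply: eq_integral => x _; rewrite normr_id real_normK ?num_real.
Qed.

(* The partial sums of the outer exponential belong to the span. *)
Lemma closure_exp (M : R) (m : nat) : (0 <= M)%R ->
  C (fun x => E x * expR (- (M * gs (2 * m%:R) x)))%R.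
Proof.
move=> M0.
have mv : measurable_fun [set: R] (fun x => expR (- (M * gs (2 * m%:R) x)))%R.
  apply: measurableT_comp => //; apply: measurable_funN.
  by apply: measurable_funM => //; exact: measurable_gs.
apply: (@C_dom (fun n x => E x * \sum_(0 <= k < n) (k`!%:R^-1 * (- (M * gs (2 * m%:R) x)) ^+ k))%R
  _ (fun x => expR M * `|E x|)%R).
- move=> n; under eq_fun do rewrite big_distrr/=.
  apply: closure_sum => k.
  rewrite (_ : (fun x => _) = (fun x => (k`!%:R^-1 * (- M) ^+ k) * gen b (2 + k%:R * (2 * m%:R)) x)%R).
    apply: closureZ; apply: C_sub; apply: gspan_gen.
    by rewrite ltr_wpDr// !mulr_ge0.
  apply/funext => x; rewrite /gen -(gsD 2) -mulNr exprMn.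
  have -> : gs (k%:R * (2 * m%:R)) x = (gs (2 * m%:R) x ^+ k)%R.
    by rewrite /gs -expRM_natl; congr expR; rewrite mulrN; congr (- _)%R; clear; ring.
  clear; ring.
- exact: measurable_funM.
- by apply: measurable_funM => //; exact: measurableT_comp.
- by move=> x; apply: (@cvgM R); [exact: cvg_cst|exact: cvg_exp_partial].
- move=> n x; rewrite normrM mulrC ler_wpM2r//.
  apply: le_trans (exp_coeff_partial_le _ _) _; rewrite ler_expR.
  rewrite normrM (ger0_norm M0) (ger0_norm (gs_ge0 _ _)) ler_piMr//.
  rewrite /gs -expR0 ler_expR oppr_le0 mulr_ge0 ?sqr_ge0//.
- by apply: n12_bounded => //; exact: expR_ge0.
Qed.

(** The approximants of [cvg_gumbel] at u = x^2 have the form treated in [closure_exp], with M =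
    (n+1) exp((n+1) r) and m = n+1. *)
Lemma closure_ray (r : R) : C (fun x => E x * \1_(`]r, +oo[%classic) (x ^+ 2))%R.
Proof.
have mx2 : measurable_fun [set: R] (fun x : R => x ^+ 2)%R by exact: measurable_funX.
apply: (@C_dom (fun n x => E x * expR (- (n.+1%:R * expR (n.+1%:R * (r - x ^+ 2)))))%R
  _ (fun x => 1 * `|E x|)%R).
- move=> n.
  rewrite (_ : (fun x => _) = (fun x => E x *
    expR (- ((n.+1%:R * expR (n.+1%:R * r)) * gs (2 * n.+1%:R) x)))%R).
    by apply: closure_exp; rewrite mulr_ge0 ?expR_ge0.
  apply/funext => x; congr (_ * expR (- _))%R; rewrite -mulrA; congr (_ * _)%R.
  rewrite /gs -expRD; congr expR; rewrite mulrBr; congr (_ - _)%R; congr (_ * _)%R.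
  by rewrite mulrAC divff ?mul1r.
- apply: measurable_funM => //.
  have mi : measurable_fun [set: R] (\1_(`]r, +oo[%classic) : R -> R).
    by apply: measurable_indic; exact: measurable_itv.
  exact: (measurableT_comp mi mx2).
- by apply: measurable_funM => //; exact: measurableT_comp.
- by move=> x; apply: (@cvgM R); [exact: cvg_cst|exact: cvg_gumbel].
- move=> n x; rewrite normrM mulrC ler_wpM2r// ger0_norm ?expR_ge0//.
- exact: n12_bounded.
Qed.

Let measurable_sq : measurable_fun [set: R] (fun x : R => x ^+ 2)%R.
Proof. exact: measurable_funX. Qed.

Lemma closure_borel (A : set (measurableTypeR R)) : measurable A ->
  C (fun x => E x * \1_A (x ^+ 2))%R.
Proof.
pose D : set (set R) := [set A | @measurable _ (measurableTypeR R) A /\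
  C (fun x => E x * \1_A (x ^+ 2))%R].
suff DA : <<s @RGenOInfty.G R >> `<=` D.
  move=> mA; have : (@RGenOInfty.G R).-sigma.-measurable A by rewrite -RGenOInfty.measurableE.
  by move=> /DA[].
(* Open rays generate the Borel sets and are stable under intersection, so it remains to treat
   complements and disjoint countable unions. *)
rewrite -setI_closed_g_dynkin_g_sigma_algebra; last first.
  move=> _ _ [r ->] [s ->]; exists (Num.max r s).
  by apply/seteqP; split => x /=; rewrite !in_itv/= !andbT gt_max => /andP.
apply: smallest_sub => [|_ [r ->]]; last first.
  by split; [exact: measurable_itv|exact: closure_ray].
split.
- split; first exact: measurableT.
  by rewrite (_ : (fun x => _) = E)//; apply/funext => x; rewrite indicT mulr1.
- move=> B [mB CB]; split; first exact: measurableC.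
  rewrite (_ : (fun x => _) = (E \- (fun x => E x * \1_B (x ^+ 2)))%R); first exact: closureB.
  apply/funext => x; rewrite /= indicC indicE.
  by case: (_ \in B); rewrite /= ?mulr1 ?mulr0 ?subrr ?subr0.
- move=> F tF DF; split; first by apply: bigcup_measurable => k _; exact: (DF k).1.
  (* The sets are disjoint, so these sums increase to the indicator of the union and stay below 1,
     which provides the dominating function. *)
  pose U n (u : R) := (\sum_(0 <= k < n) \1_(F k) u)%R : R.
  have Ucvg u : U n u @[n --> \oo] --> (\1_(\bigcup_k F k) u : R).
    have h : (EFin \o U ^~ u) x @[x --> \oo] --> (\1_(\bigcup_k F k) u)%:E.
      rewrite indic_bigcup// (_ : _ \o _ = fun n => \sum_(0 <= k < n) (\1_(F k) u)%:E).
        by apply: is_cvg_nneseries => k _ _; rewrite lee_fin.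
      by apply/funext => n; rewrite sumEFin.
    by have /fine_cvgP[] := h.
  have Ule n u : (`|U n u| <= 1)%R.
    rewrite ger0_norm ?sumr_ge0//.
    apply: (@le_trans _ _ (\1_(\bigcup_k F k) u : R)); last by rewrite indicE lern1 leq_b1.
    rewrite -(cvg_lim _ (Ucvg u))//; apply: nondecreasing_cvgn_le; last by apply/cvg_ex; eexists; exact: Ucvg.
    by apply/nondecreasing_seqP => k; rewrite /U big_nat_recr//= lerDl.
  have mU : measurable (\bigcup_k F k : set (measurableTypeR R)).
    by apply: bigcup_measurable => k _; exact: (DF k).1.
  apply: (@C_dom (fun n x => E x * U n (x ^+ 2))%R _ (fun x => 1 * `|E x|)%R).
  + move=> n; under eq_fun do rewrite big_distrr/=.
    by apply: closure_sum => k; exact: (DF k).2.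
  + apply: measurable_funM => //.
    have mi : measurable_fun [set: R] (\1_(\bigcup_k F k) : R -> R) by exact: measurable_indic.
    exact: (measurableT_comp mi measurable_sq).
  + by apply: measurable_funM => //; exact: measurableT_comp.
  + by move=> x; apply: (@cvgM R); [exact: cvg_cst|exact: Ucvg].
  + by move=> n x; rewrite normrM mulrC ler_wpM2r.
  + exact: n12_bounded.
Qed.

Import HBNNSimple.

(** Simple functions increase to g, and their products with E are dominated by the limit itself,
    whose gauge is finite by assumption. *)
Lemma closure_nneg (g : R -> R) : measurable_fun [set: R] g -> (forall u, 0 <= g u)%R ->
  N12 (fun x => E x * g (x ^+ 2))%R < +oo -> C (fun x => E x * g (x ^+ 2))%R.
Proof.
move=> mg g0 goo.
have mEg : measurable_fun [set: measurableTypeR R] (EFin \o g) by exact/measurable_EFinP.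
pose a := nnsfun_approx (@measurableT _ (measurableTypeR R)) mEg.
have acvg u : a n u @[n --> \oo] --> g u.
  have h : (EFin \o a ^~ u) x @[x --> \oo] --> (g u)%:E.
    by apply: cvg_nnsfun_approx => // x _; rewrite lee_fin.
  by have /fine_cvgP[] := h.
have ale n u : (a n u <= g u)%R.
  rewrite -(cvg_lim _ (acvg u))//; apply: nondecreasing_cvgn_le; last by apply/cvg_ex; eexists; exact: acvg.
  by move=> i j ij; have /lefP := nd_nnsfun_approx (@measurableT _ (measurableTypeR R)) mEg ij; exact.
have mEg2 : measurable_fun [set: R] (fun x => E x * g (x ^+ 2))%R.
  by apply: measurable_funM => //; exact: (measurableT_comp mg measurable_sq).
apply: (@C_dom (fun n x => E x * a n (x ^+ 2))%R _ (fun x => `|E x * g (x ^+ 2)|)%R) => //.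
- move=> n; have -> : (fun x => E x * a n (x ^+ 2))%R = (fun x => \sum_(y <- finmap.enum_fset (fset_set (range (a n))))
      y * (E x * \1_(a n @^-1` [set y]) (x ^+ 2)))%R.
    apply/funext => x; rewrite fimfunE fsbig_finite//= big_distrr/=.
    by apply: eq_bigr => y _; rewrite mulrCA.
  by apply: closure_sum => y; apply: closureZ; exact: closure_borel.
- exact: measurableT_comp.
- by move=> x; apply: (@cvgM R); [exact: cvg_cst|exact: acvg].
- move=> n x; rewrite !normrM ler_wpM2l// !ger0_norm//.
- by rewrite /n12; under eq_integral do rewrite normr_id real_normK ?num_real//.
Qed.

Lemma closure_sq (g : R -> R) : measurable_fun [set: R] g ->
  N12 (fun x => E x * g (x ^+ 2))%R < +oo -> C (fun x => E x * g (x ^+ 2))%R.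
Proof.
move=> mg goo.
have mEg (f : R -> R) : measurable_fun [set: R] f -> measurable_fun [set: R] (fun x => E x * f (x ^+ 2))%R.
  by move=> mf; apply: measurable_funM => //; exact: (measurableT_comp mf measurable_sq).
have half (f : R -> R) : measurable_fun [set: R] f -> (forall u, 0 <= f u)%R -> (forall u, f u <= `|g u|)%R ->
    C (fun x => E x * f (x ^+ 2))%R.
  move=> mf f0 fg; apply: closure_nneg => //.
  apply: le_lt_trans goo; rewrite -[leRHS]mul1e.
  have fg' x : (`|E x * f (x ^+ 2)| <= `|E x * g (x ^+ 2)|)%R.
    by rewrite !normrM ler_wpM2l// ger0_norm.
  apply: (le_n12 nu) => //; [exact: mEg|exact: mEg|] => x.
  by rewrite mul1r lerD// -(real_normK (num_real (E x * f _)%R)) -(real_normK (num_real (E x * g _)%R)) lerXn2r.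
have mm (f : R -> R) : measurable_fun [set: R] f -> measurable_fun [set: R] (fun u => Num.max (f u) 0)%R.
  by move=> mf; apply: measurable_maxr => //; exact: measurable_cst.
rewrite (_ : (fun x => _) = ((fun x => (E x * Num.max (g (x ^+ 2)) 0)%R) \-
    (fun x => (E x * Num.max (- g (x ^+ 2)) 0)%R))%R).
  apply: closureB.
  - apply: (half (fun u => Num.max (g u) 0)%R); first exact: mm.
      by move=> u; rewrite le_max lexx orbT.
    by move=> u; rewrite ge_max ler_norm/=.
  - apply: (half (fun u => Num.max (- g u) 0)%R); first by apply: (mm (fun u => - g u)%R); exact: measurable_funN.
      by move=> u; rewrite le_max lexx orbT.
    by move=> u; rewrite ge_max -normrN ler_norm/=.
apply/funext => x /=; rewrite -mulrBr; congr (_ * _)%R.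
have [h|h] := leP 0%R (g (x ^+ 2)%R).
  by rewrite (max_r (_ : - g (x ^+ 2) <= 0)%R) ?oppr_le0// subr0.
by rewrite max_l ?oppr_ge0 ?ltW// opprK add0r.
Qed.

End gaussian_totality.

Section plancherel_real.
Variable R : realType.
Variable chi : R.
Hypothesis chi_ge0 : 0 <= chi.
Local Notation nu := (nu chi).
Local Notation N12 := (n12 nu).
Local Notation C := (n12_closure nu (@gspan R)).
Local Open Scope ereal_scope.

(* The even and the odd part of f are of the form g(x^2) and x g(x^2). *)
Lemma gspan_total (f : R -> R) : measurable_fun [set: R] f -> N12 f < +oo -> C f.
Proof.
move=> mf foo.
have mopp : measurable_fun [set: R] (fun x : R => - x)%R by exact: measurable_funN.
have mfN : measurable_fun [set: R] (fun x => f (- x))%R.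
  exact: (measurableT_comp mf mopp).
have fNoo : N12 (fun x => f (- x))%R < +oo.
  rewrite /n12 (@ge0_integral_nu_opp R chi (fun x => (`|f x| + f x ^+ 2)%:E))//.
  - by apply/measurable_EFinP; exact: (@measurable_n12 _ (measurableTypeR R) R).
  - by move=> x; rewrite lee_fin addr_ge0 ?sqr_ge0.
have msqrt : measurable_fun [set: R] (@Num.sqrt R) by apply: continuous_measurable_fun; exact: sqrt_continuous.
have fs (c : R) : N12 (fun x => 2^-1 * f x + c * f (- x))%R < +oo.
  apply: le_lt_trans (n12D nu _ _) _; [exact: measurable_funM|exact: measurable_funM|].
  have h (u : R) (g : R -> R) : measurable_fun [set: R] g -> N12 g < +oo -> N12 (fun x => u * g x)%R < +oo.
    move=> mg goo; apply: le_lt_trans (n12Z nu u mg) _.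
    by rewrite lte_mul_pinfty// ?lee_fin ?addr_ge0 ?sqr_ge0.
  by rewrite lte_mul_pinfty// lte_add_pinfty ?h.
have e2 (x : R) : (gs 2 x * expR (x ^+ 2) = 1)%R.
  by rewrite /gs -expRD divff// mul1r addNr expR0.
pose fe x := (2^-1 * f x + 2^-1 * f (- x))%R.
pose fo x := (2^-1 * f x + - 2^-1 * f (- x))%R.
have feN x : fe (- x)%R = fe x by rewrite /fe opprK addrC.
have foN x : (fo (- x) = - fo x)%R by rewrite /fo opprK; clear; ring.
have mfe : measurable_fun [set: R] fe by apply: measurable_funD; exact: measurable_funM.
have mfo : measurable_fun [set: R] fo by apply: measurable_funD; exact: measurable_funM.
have mexp : measurable_fun [set: R] (@expR R) by exact: measurable_expR.
have Ce : C fe.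
  have E : fe = (fun x => gen false 2 x * (expR (x ^+ 2) * fe (Num.sqrt (x ^+ 2))))%R.
    apply/funext => x; rewrite /gen expr0 mul1r mulrA e2 mul1r sqrtr_sqr.
    by case: (ger0P x) => // _; rewrite feN.
  rewrite E; apply: (@closure_sq _ _ chi_ge0 false (fun u => expR u * fe (Num.sqrt u))%R).
    by apply: measurable_funM => //; exact: (measurableT_comp mfe msqrt).
  by rewrite -E; exact: fs.
have Co : C fo.
  (* The inverse is written as a power so that [measurable_powR] applies. At x = 0 the right side is
     0, which is correct because an odd function vanishes there. *)
  have E : fo = (fun x => gen true 2 x * (expR (x ^+ 2) * (fo (Num.sqrt (x ^+ 2)) * Num.sqrt (x ^+ 2) `^ (- 1))))%R.
    apply/funext => x; rewrite /gen expr1 -mulrA (mulrA (gs 2 x)) e2 mul1r powR_inv1 ?sqrtr_ge0// sqrtr_sqr.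
    have [->|x0] := eqVneq x 0%R; last first.
      rewrite mulrCA; case: (ger0P x) => _; first by rewrite divff ?mulr1.
      by rewrite foN invrN mulrN divff// mulrN1 opprK.
    by rewrite mul0r; have := foN 0%R; rewrite oppr0 => /eqP; rewrite -subr_eq0 opprK -mulr2n mulrn_eq0/= => /eqP.
  rewrite E; apply: (@closure_sq _ _ chi_ge0 true (fun u => expR u * (fo (Num.sqrt u) * Num.sqrt u `^ (- 1)))%R).
    apply: measurable_funM => //; apply: measurable_funM; first exact: (measurableT_comp mfo msqrt).
    exact: (measurableT_comp (@measurable_powR R _) msqrt).
  by rewrite -E; exact: fs.
rewrite (_ : f = (fun x => 1 * fe x + fo x)%R).
  exact: (@n12_closure_lin _ (measurableTypeR R) R nu _ (@gspan_measurable R) (@gspan_lin R)).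
by apply/funext => x; rewrite /fe /fo; clear; field.
Qed.

Lemma dkernel_isometry (l : R) (f : R -> R) : (l != 0)%R ->
  measurable_fun [set: R] f -> N12 f < +oo ->
  sqn nu (ktr nu (fun y x => dkernel chi (l * y * x))%R f) = (kappa chi l)%:E * sqn nu f.
Proof.
move=> l0 mf foo.
have Q := (@n12_closure_isometry _ (measurableTypeR R) R nu _ (@gspan_measurable R)
  (@gspan_n12 R chi chi_ge0) (@gspan_lin R)
  (fun y x => dkernel chi (l * y * x))%R _ (measurable_dkernel2 chi l)
  (fun y x => norm_dkernel chi_ge0 _) (kappa chi l)).
apply: Q.
- exact: kappa_ge0.
- by move=> g; exact: gspan_isometry.
- exact: gspan_total.
Qed.

End plancherel_real.

(** * Quaternionic kernels *)

Section quaternion_plane.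
Variable R : realType.
Implicit Types p q : quat R.

Definition qnrm q : R := qre q ^+ 2 + qi q ^+ 2 + qj q ^+ 2 + qk q ^+ 2.

Lemma qnrm_ge0 q : 0 <= qnrm q.
Proof. by rewrite !addr_ge0 ?sqr_ge0. Qed.

Lemma qmod_sqr q : qmod q ^+ 2 = qnrm q.
Proof. exact/sqr_sqrtr/qnrm_ge0. Qed.

Lemma qmod_ge0 q : 0 <= qmod q.
Proof. exact: sqrtr_ge0. Qed.

Lemma qmulE p q : p * q = quat_mul p q. Proof. by []. Qed.
Lemma qaddE p q : p + q = quat_add p q. Proof. by []. Qed.
Lemma qoppE p : - p = quat_opp p. Proof. by []. Qed.
Lemma qscaleE (r : R) p : r *: p = quat_scale r p. Proof. by []. Qed.
Lemma qoneE : 1 = Quat 1 0 0 0 :> quat R. Proof. by []. Qed.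
Lemma qzeroE : 0 = Quat 0 0 0 0 :> quat R. Proof. by []. Qed.
Definition quatE := (qmulE, qaddE, qoppE, qscaleE, qoneE, qzeroE).

Lemma qnrmM p q : qnrm (p * q) = qnrm p * qnrm q.
Proof. rewrite !quatE /qnrm/=; ring. Qed.

Lemma qnrmZ (r : R) q : qnrm (r *: q) = r ^+ 2 * qnrm q.
Proof. rewrite !quatE /qnrm/=; ring. Qed.

(* Multiplication by c on the left ([true]) or on the right ([false]). *)
Definition qact (s : bool) (c q : quat R) : quat R := if s then c * q else q * c.

Lemma qnrm_act s c q : qnrm (qact s c q) = qnrm c * qnrm q.
Proof. by case: s; rewrite /qact qnrmM// mulrC. Qed.

Variable a : quat R.

(* u + v a, for a pure quaternion a. *)
Definition plane (u v : R) : quat R := Quat u (v * qi a) (v * qj a) (v * qk a).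

Hypotheses (a_pure : pure_quat a) (a_sqr : a ^+ 2 = -1).

Lemma pure_unit : qi a ^+ 2 + qj a ^+ 2 + qk a ^+ 2 = 1.
Proof.
have := congr1 (@qre R) a_sqr; rewrite expr2 !quatE/= a_pure => h.
by rewrite -[RHS]opprK -h; ring.
Qed.

Lemma planeM u v u' v' :
  plane u v * plane u' v' = plane (u * u' - v * v') (u * v' + v * u').
Proof.
rewrite !quatE /plane; apply: quatP => /=; [|ring..].
rewrite -[v * v']mulr1 -pure_unit; ring.
Qed.

Lemma qnrm_plane u v : qnrm (plane u v) = u ^+ 2 + v ^+ 2.
Proof. rewrite /qnrm/= -[X in _ = _ + X]mulr1 -pure_unit; ring. Qed.

(** Multiplication on the right reverses the order of the factors; commutativity of the plane R + R
    a restores it. *)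
Lemma qact_planeM s u v u' v' q :
  qact s (plane u v * plane u' v') q = qact s (plane u v) (qact s (plane u' v') q).
Proof.
case: s; rewrite /qact ?mulrA//.
by rewrite -!mulrA; congr (_ * _); rewrite !planeM; congr plane; ring.
Qed.

Lemma planeE u v : plane u v = u *: (1 : quat R) + v *: a.
Proof. by rewrite !quatE; apply: quatP => /=; rewrite ?a_pure; ring. Qed.

Lemma qact_plane s u v q : qact s (plane u v) q = u *: q + v *: qact s a q.
Proof.
by case: s; rewrite /qact planeE !quatE; apply: quatP => /=; ring.
Qed.

(** Inside R + R a the element a is an imaginary unit, so the exponential series separates into the
    cosine and the sine series. *)
Lemma plane_expE (r : R) (k : nat) :
  k`!%:R^-1 *: (r *: a) ^+ k = plane (cos_coeff r k) (sin_coeff r k).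
Proof.
have H n : (r *: a) ^+ n = plane ((~~ odd n)%:R * (-1) ^+ n./2 * r ^+ n)
                                 ((odd n)%:R * (-1) ^+ n.-1./2 * r ^+ n).
  elim: n => [|n ih]; first by rewrite expr0 planeE expr0 !mul1r !mul0r scale0r addr0 scale1r.
  have E : r *: a = plane 0 r by rewrite planeE scale0r add0r.
  rewrite exprSr ih E planeM !mulr0 sub0r addr0 exprSr -[n]odd_double_half.
  case: (odd n); rewrite ?add1n ?add0n /= ?doubleK ?uphalf_double ?odd_double/=; congr plane; rewrite ?exprS; ring.
rewrite H cos_coeffE sin_coeffE !quatE; apply: quatP => /=; ring.
Qed.

Lemma qexp_plane (r : R) : qexp (r *: a) = plane (cos r) (sin r).
Proof.
rewrite /qexp /qlim; under eq_fun do under eq_bigr do rewrite plane_expE.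
have E n : \sum_(0 <= k < n) plane (cos_coeff r k) (sin_coeff r k) =
    plane (series (cos_coeff r) n) (series (sin_coeff r) n).
  elim: n => [|n ih]; first by rewrite /series/= !big_geq// planeE !scale0r addr0.
  by rewrite big_nat_recr//= ih /series/= !big_nat_recr//= !planeE !scalerDl addrACA.
have cc : series (cos_coeff r) n @[n --> \oo] --> cos r.
  by rewrite cos.unlock; exact: is_cvg_series_cos_coeff.
have cs : series (sin_coeff r) n @[n --> \oo] --> sin r.
  by rewrite sin.unlock; exact: is_cvg_series_sin_coeff.
under eq_fun do rewrite E.
apply: quatP => /=.
- exact: (cvg_lim _ cc).
- by apply: (cvg_lim _ (cvgM cs (cvg_cst (qi a)))).
- by apply: (cvg_lim _ (cvgM cs (cvg_cst (qj a)))).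
- by apply: (cvg_lim _ (cvgM cs (cvg_cst (qk a)))).
Qed.

End quaternion_plane.

Section dunkl_kernel_plane.
Variable R : realType.
Variable chi : R.
Hypothesis chi_ge0 : 0 <= chi.
Local Notation leb := (@lebesgue_measure R).
Local Notation om := (om chi).
Local Open Scope ereal_scope.

(** On [-1, 1] the base 1 - t^2 is nonnegative, so [powR] and [rpow] agree; outside, [bw] vanishes.
    The density formula holds for nonnegative functions and is applied to the positive and the
    negative part. *)
Lemma Rintegral_om (g : R -> R) : measurable_fun [set: R] g ->
  (\int[leb]_(t in `[(-1)%R, 1%R]) ((1 - t ^+ 2) `^ (chi - 2^-1) * g t) = \int[om]_t g t)%R.
Proof.
move=> mg; rewrite /Rintegral; congr fine.
have mE : measurable_fun [set: R] (EFin \o g) by exact/measurable_EFinP.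
rewrite integral_mkcond (_ : _ \_ _ = (fun t => (bw chi t * g t)%:E)); last first.
  apply/funext => t; rewrite patchE /bw /rpow; case: ifPn => [|] t1.
    rewrite ifT//; move: t1; rewrite inE/= in_itv/= -ler_norml subr_ge0 => t1.
    by rewrite -real_normK ?num_real// exprn_ile1.
  rewrite ifF ?mul0r//; apply/negP => h; move/negP: t1; apply; rewrite inE/= in_itv/=.
  by rewrite -ler_norml -(@expr_le1 _ 2)// real_normK ?num_real// -subr_ge0.
rewrite integralE [RHS]integralE; congr (_ - _).
- rewrite ge0_integral_om//; last exact: measurable_funepos.
  apply: eq_integral => t _; rewrite !funeposE/= -!EFin_max -EFinM; congr EFin.
  by rewrite mulrC maxr_pMl ?bw_ge0// mul0r mulrC.
- rewrite ge0_integral_om//; last exact: measurable_funeneg.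
  apply: eq_integral => t _; rewrite !funenegE/= -!EFin_max -EFinM; congr EFin.
  by rewrite -mulrN mulrC maxr_pMl ?bw_ge0// mul0r mulrC.
Qed.

Lemma Rintegral_om_odd (f : R -> R) : measurable_fun [set: R] f ->
  (forall x, f (- x)%R = - f x)%R -> (\int[om]_x f x = 0)%R.
Proof.
move=> mf fN; rewrite /Rintegral integralE.
have mE : measurable_fun [set: R] (EFin \o f) by exact/measurable_EFinP.
have -> : \int[om]_x (EFin \o f)^\- x = \int[om]_x (EFin \o f)^\+ x.
  have mp := measurable_funepos mE; have mn := measurable_funeneg mE.
  rewrite (ge0_integral_om chi mp (fun=> _))// (ge0_integral_om chi mn (fun=> _))//.
  rewrite -(ge0_integral_opp (f := fun x => (EFin \o f)^\- x * (bw chi x)%:E)).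
  - by apply: eq_integral => x _; rewrite bwN funenegE funeposE /= fN opprK.
  - by apply: emeasurable_funM => //; apply/measurable_EFinP; exact: measurable_bw.
  - by move=> x; rewrite mule_ge0// lee_fin bw_ge0.
have : 0 <= \int[om]_x (EFin \o f)^\+ x by exact: integral_ge0.
by case: (\int[om]_x _) => //= r _; rewrite subrr.
Qed.

(** The weight is even and t cos(z t) is odd, so only the summand 1 of 1 + t survives; against the
    sine it is the summand t. *)
Lemma Rintegral_om_cos (z : R) : (\int[om]_t ((1 + t) * cos (z * t)) = Ac chi z)%R.
Proof.
have mc : measurable_fun [set: R] (fun t => cos (z * t))%R by exact: measurable_cosM.
under eq_Rintegral do rewrite mulrDl mul1r.
rewrite RintegralD//.
- rewrite [X in (_ + X)%R](Rintegral_om_odd (f := fun t => t * cos (z * t))%R) ?addr0//.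
  + exact: measurable_funM.
  + by move=> x; rewrite mulrN cosN mulNr.
- apply: (integrable_om chi_ge0 (C := 1%R)) => // t _; exact: norm_cos_le1.
- apply: (integrable_om chi_ge0 (C := 1%R)) => //; first exact: measurable_funM.
  by move=> t t1; rewrite normrM mulr_ile1// norm_cos_le1.
Qed.

Lemma Rintegral_om_sin (z : R) : (\int[om]_t ((1 + t) * sin (z * t)) = Bc chi z)%R.
Proof.
have mc : measurable_fun [set: R] (fun t => sin (z * t))%R by exact: measurable_sinM.
under eq_Rintegral do rewrite mulrDl mul1r.
rewrite RintegralD//.
- rewrite [X in (X + _)%R](Rintegral_om_odd (f := fun t => sin (z * t))%R) ?add0r//.
  by move=> x; rewrite mulrN sinN.
- apply: (integrable_om chi_ge0 (C := 1%R)) => // t _; exact: norm_sin_le1.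
- apply: (integrable_om chi_ge0 (C := 1%R)) => //; first exact: measurable_funM.
  by move=> t t1; rewrite normrM mulr_ile1// norm_sin_le1.
Qed.

Variable a : quat R.
Hypotheses (a_pure : pure_quat a) (a_sqr : (a ^+ 2 = -1)%R).

Lemma dunkl_kernel_plane (u v : R) :
  dunkl_kernel chi u (v *: a)%R = plane a (dkc chi * Ac chi (u * v)) (dkc chi * Bc chi (u * v)).
Proof.
have mc : measurable_fun [set: R] (fun t => cos (u * v * t))%R by exact: measurable_cosM.
have ms : measurable_fun [set: R] (fun t => sin (u * v * t))%R by exact: measurable_sinM.
have m1 : measurable_fun [set: R] (fun t : R => 1 + t)%R by exact: measurable_funD.
rewrite /dunkl_kernel -/(dkc chi).
have E (t : R) : qexp ((u * t) *: (v *: a))%R = plane a (cos (u * v * t)) (sin (u * v * t)).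
  by rewrite scalerA mulrAC qexp_plane.
have H (c : R) : (\int[leb]_(t in `[(-1)%R, 1%R])
    ((1 - t ^+ 2) `^ (chi - 2^-1) * (1 + t) * (sin (u * v * t) * c)) = Bc chi (u * v) * c)%R.
  under eq_Rintegral do rewrite -mulrA (mulrA (1 + _)%R).
  rewrite (Rintegral_om (g := fun t => (1 + t) * sin (u * v * t) * c)%R).
    rewrite RintegralZr ?Rintegral_om_sin//.
    apply: (integrable_om chi_ge0 (C := 2%R)) => //; first exact: measurable_funM.
    move=> t t1; rewrite normrM -[2%R]mulr1 ler_pM//; last exact: norm_sin_le1.
    by rewrite (le_trans (ler_normD _ _))// normr1 -[X in (_ <= X)%R]/(1 + 1)%R lerD2l.
  by apply: measurable_funM => //; exact: measurable_funM.
rewrite (_ : (fun t : R => _) = fun t : R => ((1 - t ^+ 2) `^ (chi - 2^-1) * (1 + t)) *: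
    plane a (cos (u * v * t)) (sin (u * v * t)))%R; last by apply/funext => t; rewrite -E.
apply: quatP; rewrite /=.
- congr (_ * _)%R; under eq_Rintegral do rewrite -mulrA.
  rewrite (Rintegral_om (g := fun t => (1 + t) * cos (u * v * t))%R) ?Rintegral_om_cos//.
  exact: measurable_funM.
- by rewrite H mulrA.
- by rewrite H mulrA.
- by rewrite H mulrA.
Qed.

Definition cs_phase (theta x y : R) : R := (- (2^-1 * (x ^+ 2 + y ^+ 2) * cot theta))%R.

(* All factors of the two kernels lie in the commutative plane R + R a, so the
   left and the right kernel coincide. *)
Definition frac_plane (theta x y : R) : quat R :=
  (plane a (cos (cs_phase theta x y)) (sin (cs_phase theta x y)) *
   plane a (dkc chi * Ac chi (- (y / sin theta) * x)) (dkc chi * Bc chi (- (y / sin theta) * x)))%R.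

Lemma frac_kernel_leftE theta x y : frac_kernel_left a chi theta x y = frac_plane theta x y.
Proof.
by rewrite /frac_kernel_left /chirp dunkl_kernel_plane qexp_plane// [(x * _)%R]mulrC.
Qed.

Lemma frac_kernel_rightE theta x y : frac_kernel_right a chi theta x y = frac_plane theta x y.
Proof.
rewrite /frac_kernel_right /chirp dunkl_kernel_plane qexp_plane// [(x * _)%R]mulrC /frac_plane.
by rewrite !planeM//; congr plane; clear; ring.
Qed.

End dunkl_kernel_plane.

Section quaternion_integral.
Variable R : realType.

(* The coordinates, indexed in the order 1, i, j, k. *)
Definition qc (c : bool * bool) (q : quat R) : R :=
  match c with
  | (false, false) => qre q | (false, true) => qi q
  | (true, false) => qj q | (true, true) => qk q
  end.

Lemma qcP (p q : quat R) : (forall c, qc c p = qc c q) -> p = q.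
Proof.
move=> h; apply: quatP.
- exact: (h (false, false)).
- exact: (h (false, true)).
- exact: (h (true, false)).
- exact: (h (true, true)).
Qed.

Lemma qcB c (p q : quat R) : qc c (p - q) = qc c p - qc c q.
Proof. by case: c => -[] []. Qed.

Lemma qc_sqr c (q : quat R) : qc c q ^+ 2 <= qnrm q.
Proof.
have := (sqr_ge0 (qre q), sqr_ge0 (qi q), sqr_ge0 (qj q), sqr_ge0 (qk q)).
by case: c => -[] [] /=; rewrite /qnrm => -[[[? ?] ?] ?]; lra.
Qed.

Lemma norm_qc c (q : quat R) : `|qc c q| <= qmod q.
Proof. by rewrite -ler_sqr ?nnegrE ?qmod_ge0// real_normK ?num_real// qmod_sqr qc_sqr. Qed.

Lemma qmod_le_sum (q : quat R) : qmod q <= `|qre q| + `|qi q| + `|qj q| + `|qk q|.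
Proof.
rewrite -ler_sqr ?nnegrE ?qmod_ge0 ?addr_ge0// qmod_sqr /qnrm.
rewrite -(real_normK (num_real (qre q))) -(real_normK (num_real (qi q))).
rewrite -(real_normK (num_real (qj q))) -(real_normK (num_real (qk q))).
move: (normr_ge0 (qre q)) (normr_ge0 (qi q)) (normr_ge0 (qj q)) (normr_ge0 (qk q)).
move: `|_| `|_| `|_| `|_|; clear => x y z t x0 y0 z0 t0.
rewrite -subr_ge0.
rewrite (_ : _ - _ = 2 * (x * y + x * z + x * t + y * z + y * t + z * t)); last by ring.
by rewrite mulr_ge0// !addr_ge0// mulr_ge0.
Qed.

Lemma qmodM (p q : quat R) : qmod (p * q) = qmod p * qmod q.
Proof. by rewrite /qmod -!/(qnrm _) qnrmM sqrtrM// qnrm_ge0. Qed.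

Context d (T : measurableType d) (m : {measure set T -> \bar R}).
Implicit Types f g : T -> quat R.

Lemma qmeasurableP f : qmeasurable f <-> (forall c, measurable_fun [set: T] (fun x => qc c (f x))).
Proof.
split; first by case=> ? ? ? ?; case=> -[] [].
move=> h; split.
- exact: (h (false, false)).
- exact: (h (false, true)).
- exact: (h (true, false)).
- exact: (h (true, true)).
Qed.

Lemma measurable_qnrm f : qmeasurable f -> measurable_fun [set: T] (fun x => qnrm (f x)).
Proof.
by case=> ? ? ? ?; apply: measurable_funD; [apply: measurable_funD; [apply: measurable_funD|]|];
  exact: measurable_funX.
Qed.

Lemma measurable_qmod f : qmeasurable f -> measurable_fun [set: T] (fun x => qmod (f x)).
Proof.
move=> mf; apply: (measurableT_comp _ (measurable_qnrm mf)).
by apply: continuous_measurable_fun; exact: sqrt_continuous.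
Qed.

Lemma qmeasurableM f g : qmeasurable f -> qmeasurable g -> qmeasurable (fun x => f x * g x).
Proof.
move=> [? ? ? ?] [? ? ? ?]; split.
- by rewrite /=; do 3 (apply: measurable_funB; [|exact: measurable_funM]); exact: measurable_funM.
- apply: measurable_funB; last exact: measurable_funM.
  by do 2 (apply: measurable_funD; [|exact: measurable_funM]); exact: measurable_funM.
- apply: measurable_funD; last exact: measurable_funM.
  apply: measurable_funD; last exact: measurable_funM.
  by apply: measurable_funB; exact: measurable_funM.
- apply: measurable_funD; last exact: measurable_funM.
  apply: measurable_funB; last exact: measurable_funM.
  by apply: measurable_funD; exact: measurable_funM.
Qed.

Lemma qmeasurable_act s f g : qmeasurable f -> qmeasurable g -> qmeasurable (fun x => qact s (f x) (g x)).
Proof. by move=> mf mg; case: s; exact: qmeasurableM. Qed.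

Lemma qmeasurable_cst (q : quat R) : qmeasurable (fun _ : T => q).
Proof. by split; exact: measurable_cst. Qed.

Lemma qmeasurableB f g : qmeasurable f -> qmeasurable g -> qmeasurable (f \- g).
Proof. by move=> [? ? ? ?] [? ? ? ?]; split; exact: measurable_funB. Qed.

Lemma qmeasurableZ (k : T -> R) f : measurable_fun [set: T] k -> qmeasurable f ->
  qmeasurable (fun x => k x *: f x).
Proof. by move=> ? [? ? ? ?]; split; exact: measurable_funM. Qed.

Definition qintegrable f := forall c, m.-integrable [set: T] (EFin \o (fun x => qc c (f x))).

Lemma qintegrable_le f (h : T -> R) (C : R) : qmeasurable f ->
  m.-integrable [set: T] (EFin \o h) -> (forall x, qmod (f x) <= C * h x) -> qintegrable f.
Proof.
move=> /qmeasurableP mf ih fh c.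
have ih' : m.-integrable [set: T] (fun x => C%:E * (EFin \o h) x)%E by exact: integrableZl.
apply: (le_integrable measurableT _ _ ih'); first exact/measurable_EFinP.
move=> x _ /=; rewrite lee_fin (le_trans (norm_qc _ _))// (le_trans (fh x))//.
exact: ler_norm.
Qed.

Lemma Rintegral_lin4 (f1 f2 f3 f4 : T -> R) (a1 a2 a3 a4 : R) :
  m.-integrable setT (EFin \o f1) -> m.-integrable setT (EFin \o f2) ->
  m.-integrable setT (EFin \o f3) -> m.-integrable setT (EFin \o f4) ->
  \int[m]_x (a1 * f1 x + a2 * f2 x + a3 * f3 x + a4 * f4 x) =
  a1 * \int[m]_x f1 x + a2 * \int[m]_x f2 x + a3 * \int[m]_x f3 x + a4 * \int[m]_x f4 x.
Proof.
move=> i1 i2 i3 i4.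
have Z (r : R) (g : T -> R) : m.-integrable setT (EFin \o g) -> m.-integrable setT (EFin \o (fun x => r * g x)).
  by move=> ig; exact: (integrableZl measurableT r ig).
have D (g h : T -> R) : m.-integrable setT (EFin \o g) -> m.-integrable setT (EFin \o h) ->
    m.-integrable setT (EFin \o (fun x => g x + h x)).
  by move=> ig ih; exact: (integrableD measurableT ig ih).
have j1 := Z a1 _ i1; have j2 := Z a2 _ i2; have j3 := Z a3 _ i3; have j4 := Z a4 _ i4.
have j12 := D _ _ j1 j2; have j123 := D _ _ j12 j3.
rewrite (RintegralD measurableT j123 j4) (RintegralD measurableT j12 j3) (RintegralD measurableT j1 j2).
by rewrite !RintegralZl.
Qed.

(** Each coordinate of a product with the fixed q is a real linear combination of the coordinates of
    f; the eight cases list the coefficients. *)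
Lemma qintegral_act s q f : qintegrable f ->
  qintegral m setT (fun x => qact s q (f x)) = qact s q (qintegral m setT f).
Proof.
move=> fi.
have i0 := fi (false, false); have i1 := fi (false, true).
have i2 := fi (true, false); have i3 := fi (true, true).
have H (F : T -> R) a0 a1 a2 a3 r :
    (forall x, F x = a0 * qre (f x) + a1 * qi (f x) + a2 * qj (f x) + a3 * qk (f x)) ->
    r = a0 * \int[m]_x qre (f x) + a1 * \int[m]_x qi (f x) + a2 * \int[m]_x qj (f x) + a3 * \int[m]_x qk (f x) ->
    \int[m]_x F x = r.
  by move=> FE ->; rewrite -Rintegral_lin4//; apply: eq_Rintegral => x _; rewrite FE.
case: s; rewrite /qact; apply: quatP => /=.
- by apply: (H _ (qre q) (- qi q) (- qj q) (- qk q)) => [x|]; clear; ring.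
- by apply: (H _ (qi q) (qre q) (- qk q) (qj q)) => [x|]; clear; ring.
- by apply: (H _ (qj q) (qk q) (qre q) (- qi q)) => [x|]; clear; ring.
- by apply: (H _ (qk q) (- qj q) (qi q) (qre q)) => [x|]; clear; ring.
- by apply: (H _ (qre q) (- qi q) (- qj q) (- qk q)) => [x|]; clear; ring.
- by apply: (H _ (qi q) (qre q) (qk q) (- qj q)) => [x|]; clear; ring.
- by apply: (H _ (qj q) (- qk q) (qre q) (qi q)) => [x|]; clear; ring.
- by apply: (H _ (qk q) (qj q) (- qi q) (qre q)) => [x|]; clear; ring.
Qed.

Lemma qintegralD f g : qintegrable f -> qintegrable g ->
  qintegral m setT (fun x => f x + g x) = qintegral m setT f + qintegral m setT g.
Proof.
move=> fi gi; apply: quatP => /=.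
- exact: (RintegralD measurableT (fi (false, false)) (gi (false, false))).
- exact: (RintegralD measurableT (fi (false, true)) (gi (false, true))).
- exact: (RintegralD measurableT (fi (true, false)) (gi (true, false))).
- exact: (RintegralD measurableT (fi (true, true)) (gi (true, true))).
Qed.

Lemma qc_qintegral c f : qc c (qintegral m setT f) = \int[m]_x qc c (f x).
Proof. by case: c => -[] []. Qed.

Definition qsq f : \bar R := (\int[m]_x (qnrm (f x))%:E)%E.

Lemma qsqE f : qmeasurable f ->
  (qsq f = sqn m (fun x => qre (f x)) + sqn m (fun x => qi (f x)) +
           sqn m (fun x => qj (f x)) + sqn m (fun x => qk (f x)))%E.
Proof.
case=> m0 m1 m2 m3; rewrite /qsq /sqn.
have s0 := measurable_sqr m0; have s1 := measurable_sqr m1.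
have s2 := measurable_sqr m2; have s3 := measurable_sqr m3.
have z (g : T -> R) x : (0 <= (g x ^+ 2)%:E)%E by rewrite lee_fin sqr_ge0.
have s01 := emeasurable_funD s0 s1; have s012 := emeasurable_funD s01 s2.
have D (g h : T -> \bar R) : measurable_fun setT g -> measurable_fun setT h ->
    (forall x, 0 <= g x)%E -> (forall x, 0 <= h x)%E ->
    (\int[m]_x g x + \int[m]_x h x = \int[m]_x (g x + h x))%E.
  by move=> mg mh g0 h0; rewrite ge0_integralD.
have z01 x : (0 <= (qre (f x) ^+ 2)%:E + (qi (f x) ^+ 2)%:E)%E by rewrite -EFinD lee_fin addr_ge0 ?sqr_ge0.
have z012 x : (0 <= (qre (f x) ^+ 2)%:E + (qi (f x) ^+ 2)%:E + (qj (f x) ^+ 2)%:E)%E.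
  by rewrite -!EFinD lee_fin !addr_ge0 ?sqr_ge0.
rewrite (D _ _ s0 s1 (z (fun x => qre (f x))) (z (fun x => qi (f x)))).
rewrite (D _ _ s01 s2 z01 (z (fun x => qj (f x)))).
by rewrite (D _ _ s012 s3 z012 (z (fun x => qk (f x)))).
Qed.

End quaternion_integral.

Section quaternion_integral_linear.
Context d (T : measurableType d) (R : realType) (m : {measure set T -> \bar R}).
Implicit Types f g : T -> quat R.

Lemma qcZ c (r : R) (q : quat R) : qc c (r *: q) = r * qc c q.
Proof. by case: c => -[] []. Qed.

Lemma qcD c (p q : quat R) : qc c (p + q) = qc c p + qc c q.
Proof. by case: c => -[] []. Qed.

Lemma qcN c (q : quat R) : qc c (- q) = - qc c q.
Proof. by case: c => -[] []. Qed.

Lemma qmodZ (r : R) (q : quat R) : qmod (r *: q) = `|r| * qmod q.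
Proof. by rewrite /qmod -!/(qnrm _) qnrmZ sqrtrM ?sqr_ge0// sqrtr_sqr. Qed.

Lemma qnrm_parallelogram (p q : quat R) : qnrm (p + q) + qnrm (p - q) = 2 * qnrm p + 2 * qnrm q.
Proof. by rewrite !quatE /qnrm/=; ring. Qed.

Lemma qactN s c (q : quat R) : qact s c (- q) = - qact s c q.
Proof. by case: s; rewrite /qact ?mulrN ?mulNr. Qed.

Lemma qmodN (q : quat R) : qmod (- q) = qmod q.
Proof. by rewrite /qmod -!/(qnrm _) !quatE /qnrm/= !sqrrN. Qed.

Lemma qintegrableD f g : qintegrable m f -> qintegrable m g -> qintegrable m (fun x => f x + g x).
Proof.
move=> fi gi c; under eq_fun do rewrite qcD.
exact: (integrableD measurableT (fi c) (gi c)).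
Qed.

Lemma integrable_lin4 (f1 f2 f3 f4 : T -> R) (a1 a2 a3 a4 : R) :
  m.-integrable setT (EFin \o f1) -> m.-integrable setT (EFin \o f2) ->
  m.-integrable setT (EFin \o f3) -> m.-integrable setT (EFin \o f4) ->
  m.-integrable setT (EFin \o (fun x => a1 * f1 x + a2 * f2 x + a3 * f3 x + a4 * f4 x)).
Proof.
move=> i1 i2 i3 i4.
have Z (r : R) (g : T -> R) : m.-integrable setT (EFin \o g) -> m.-integrable setT (EFin \o (fun x => r * g x)).
  by move=> ig; exact: (integrableZl measurableT r ig).
have D (g h : T -> R) : m.-integrable setT (EFin \o g) -> m.-integrable setT (EFin \o h) ->
    m.-integrable setT (EFin \o (fun x => g x + h x)).
  by move=> ig ih; exact: (integrableD measurableT ig ih).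
by apply: (D _ _ (D _ _ (D _ _ _ _) _) _); exact: Z.
Qed.

Lemma qintegrable_act s q f : qintegrable m f -> qintegrable m (fun x => qact s q (f x)).
Proof.
move=> fi.
have i0 := fi (false, false); have i1 := fi (false, true).
have i2 := fi (true, false); have i3 := fi (true, true).
have H (F : T -> R) a0 a1 a2 a3 :
    (forall x, F x = a0 * qre (f x) + a1 * qi (f x) + a2 * qj (f x) + a3 * qk (f x)) ->
    m.-integrable setT (EFin \o F).
  by move=> /funext ->; exact: integrable_lin4.
case: s => -[[] []]; rewrite /qact /=.
- by apply: (H _ (qk q) (- qj q) (qi q) (qre q)) => x; clear; ring.
- by apply: (H _ (qj q) (qk q) (qre q) (- qi q)) => x; clear; ring.
- by apply: (H _ (qi q) (qre q) (- qk q) (qj q)) => x; clear; ring.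
- by apply: (H _ (qre q) (- qi q) (- qj q) (- qk q)) => x; clear; ring.
- by apply: (H _ (qk q) (qj q) (- qi q) (qre q)) => x; clear; ring.
- by apply: (H _ (qj q) (- qk q) (qre q) (qi q)) => x; clear; ring.
- by apply: (H _ (qi q) (qre q) (qk q) (- qj q)) => x; clear; ring.
- by apply: (H _ (qre q) (- qi q) (- qj q) (- qk q)) => x; clear; ring.
Qed.

Lemma qmeasurable_comp d' (T' : measurableType d') (phi : T' -> T) f :
  measurable_fun setT phi -> qmeasurable f -> qmeasurable (fun x => f (phi x)).
Proof.
by move=> mphi [h0 h1 h2 h3]; split;
  [exact: (measurableT_comp h0)|exact: (measurableT_comp h1)
  |exact: (measurableT_comp h2)|exact: (measurableT_comp h3)].
Qed.

End quaternion_integral_linear.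

Section qintegral_parameter.
Context d1 d2 (T1 : measurableType d1) (T2 : measurableType d2) (R : realType).
Variable m : {sigma_finite_measure set T2 -> \bar R}.

Lemma qmeasurable_qintegral_param (F : T1 -> T2 -> quat R) :
  qmeasurable (fun z : T1 * T2 => F z.1 z.2) ->
  qmeasurable (fun x => qintegral m setT (F x)).
Proof.
by move=> [h0 h1 h2 h3]; split; [exact: (measurable_Rintegral_param m (F := fun x y => qre (F x y)))
 |exact: (measurable_Rintegral_param m (F := fun x y => qi (F x y)))
 |exact: (measurable_Rintegral_param m (F := fun x y => qj (F x y)))
 |exact: (measurable_Rintegral_param m (F := fun x y => qk (F x y)))].
Qed.

End qintegral_parameter.

(** * The one-sided transform of quaternion-valued functions *)

Section frac_dunkl_line.
Variable R : realType.
Variables (chi theta : R) (a : quat R) (s : bool).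
Hypotheses (chi_ge0 : 0 <= chi) (sin_neq0 : sin theta != 0).
Hypotheses (a_pure : pure_quat a) (a_sqr : a ^+ 2 = -1).
Local Notation nu := (nu chi).
Local Notation N12 := (n12 nu).
Local Notation K := (frac_plane chi a theta).

(* The one-sided transform without its constant factor. *)
Definition ftr (f : R -> quat R) (y : R) : quat R :=
  qintegral nu setT (fun x => qact s (K x y) (f x)).

Definition ftr_bound : R := `|dkc chi| * (wtot chi + wtot chi).

Lemma qnrm_frac_plane x y : qnrm (K x y) =
  (dkc chi * Ac chi (- (y / sin theta) * x)) ^+ 2 + (dkc chi * Bc chi (- (y / sin theta) * x)) ^+ 2.
Proof. by rewrite qnrmM !qnrm_plane// cos2Dsin2 mul1r. Qed.

Lemma qmod_frac_plane x y : qmod (K x y) <= ftr_bound.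
Proof.
have b0 : 0 <= ftr_bound by exact: le_trans (norm_dkernel chi_ge0 0).
rewrite -ler_sqr ?nnegrE ?qmod_ge0// qmod_sqr qnrm_frac_plane.
have hA := norm_Ac chi_ge0 (- (y / sin theta) * x).
have hB := norm_Bc chi_ge0 (- (y / sin theta) * x).
set u := _ * Ac _ _; set v := _ * Bc _ _.
have hu : `|u| <= `|dkc chi| * wtot chi by rewrite normrM ler_wpM2l.
have hv : `|v| <= `|dkc chi| * wtot chi by rewrite normrM ler_wpM2l.
rewrite /ftr_bound mulrDr; move: (`|dkc chi| * wtot chi) hu hv => w hu hv.
have w0 : 0 <= w by exact: le_trans hu.
rewrite -(real_normK (num_real u)) -(real_normK (num_real v)).
move: (normr_ge0 u) (normr_ge0 v) hu hv w0; move: `|u| `|v|; clear => p q p0 q0 pw qw w0.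
rewrite -subr_ge0 (_ : _ - _ = (w - p) * (w + p) + (w - q) * (w + q) + 2 * (w * w)); last by ring.
by rewrite !addr_ge0// mulr_ge0 ?subr_ge0 ?addr_ge0 ?mulr_ge0.
Qed.

Lemma qmeasurable_plane d (T : measurableType d) (u v : T -> R) :
  measurable_fun [set: T] u -> measurable_fun [set: T] v ->
  qmeasurable (fun z => plane a (u z) (v z)).
Proof. by move=> mu mv; split => //=; exact: measurable_funM. Qed.

Lemma qmeasurable_frac_plane : qmeasurable (fun z : R * R => K z.1 z.2).
Proof.
have mph : measurable_fun [set: R * R] (fun z => cs_phase theta z.1 z.2).
  apply: measurable_funN; apply: measurable_funM => //; apply: measurable_funM => //.
  by apply: measurable_funD; exact: measurable_funX.
have mz : measurable_fun [set: R * R] (fun z => - (z.2 / sin theta) * z.1).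
  by apply: measurable_funM => //; apply: measurable_funN; exact: measurable_funM.
apply: qmeasurableM; apply: qmeasurable_plane.
- by apply: (measurableT_comp _ mph); exact: continuous_measurable_fun (@continuous_cos R).
- by apply: (measurableT_comp _ mph); exact: continuous_measurable_fun (@continuous_sin R).
- by apply: measurable_funM => //; exact: (measurableT_comp (measurable_Ac chi) mz).
- by apply: measurable_funM => //; exact: (measurableT_comp (measurable_Bc chi) mz).
Qed.

Lemma qmeasurable_frac_section y : qmeasurable (fun x => K x y).
Proof.
have mp : measurable_fun [set: R] (fun x : R => (x, y)).
  exact: measurable_fun_pair.
by case: qmeasurable_frac_plane => h0 h1 h2 h3; split;
  [exact: (measurableT_comp h0 mp)|exact: (measurableT_comp h1 mp)
  |exact: (measurableT_comp h2 mp)|exact: (measurableT_comp h3 mp)].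
Qed.

Definition chirped (f : R -> quat R) (x : R) : quat R :=
  qact s (plane a (cos (cs_phase theta x 0)) (sin (cs_phase theta x 0))) (f x).

Lemma qnrm_chirped f x : qnrm (chirped f x) = qnrm (f x).
Proof. by rewrite /chirped qnrm_act qnrm_plane// cos2Dsin2 mul1r. Qed.

Lemma cs_phaseD x y : cs_phase theta x y = cs_phase theta x 0 + cs_phase theta 0 y.
Proof. by rewrite /cs_phase; ring. Qed.

(** The phase of the chirp is a function of x plus a function of y. The x-part is absorbed into
    [chirped f], the y-part moves to the front, where it does not change the modulus. *)
Lemma qact_frac_plane f x y :
  qact s (K x y) (f x) =
  qact s (plane a (cos (cs_phase theta 0 y)) (sin (cs_phase theta 0 y)))
   ((dkc chi * Ac chi (- (y / sin theta) * x)) *: chirped f x +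
    qact s a ((dkc chi * Bc chi (- (y / sin theta) * x)) *: chirped f x)).
Proof.
set A := dkc chi * _; set B := dkc chi * _.
have -> : A *: chirped f x + qact s a (B *: chirped f x) = qact s (plane a A B) (chirped f x).
  rewrite qact_plane//; congr (_ + _).
  by case: s; rewrite /qact !quatE; apply: quatP => /=; ring.
rewrite /chirped -[qact s (plane a A B) _]qact_planeM// planeM// -qact_planeM//.
congr (qact s _ _); rewrite /frac_plane -/A -/B cs_phaseD cosD sinD !planeM//.
by clearbody A B; congr plane; clear; ring.
Qed.

Lemma addee_inj (x y : \bar R) : (0 <= x -> 0 <= y -> x + x = y + y -> x = y)%E.
Proof.
move: x y => [x| |] [y| |]//= _ _ [h]; congr EFin; lra.
Qed.

(** The measure [nu] is invariant under reflection, so twice the square norm is the integral of the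
    symmetrised square. *)
Lemma qsq_nu_symm (F G : R -> quat R) : qmeasurable F -> qmeasurable G ->
  (forall y, qnrm (F y) + qnrm (F (- y)) = qnrm (G y) + qnrm (G (- y))) ->
  qsq nu F = qsq nu G.
Proof.
have H (U : R -> quat R) : qmeasurable U -> (qsq nu U + qsq nu U =
    \int[nu]_y ((qnrm (U y))%:E + (qnrm (U (- y)))%:E))%E.
  move=> mU; have mqU := @measurable_qnrm R _ (measurableTypeR R) U mU.
  have mE : measurable_fun [set: R] (fun y => (qnrm (U y))%:E) by exact/measurable_EFinP.
  have mN : measurable_fun [set: R] (fun y => (qnrm (U (- y)))%:E).
    apply/measurable_EFinP; apply: (measurableT_comp mqU); exact: measurable_funN.
  have z y : (0 <= (qnrm (U y))%:E)%E by rewrite lee_fin qnrm_ge0.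
  rewrite (ge0_integralD nu measurableT (fun y _ => z y) mE (fun y _ => z (- y)) mN).
  congr (_ + _)%E; rewrite /qsq.
  by rewrite (@ge0_integral_nu_opp R chi (fun y => (qnrm (U y))%:E)).
move=> mF mG FG; apply: addee_inj.
- by apply: integral_ge0 => y _; rewrite lee_fin qnrm_ge0.
- by apply: integral_ge0 => y _; rewrite lee_fin qnrm_ge0.
- by rewrite !H//; apply: eq_integral => y _; rewrite -!EFinD FG.
Qed.

Lemma qmeasurable_ftr (f : R -> quat R) : qmeasurable f -> qmeasurable (ftr f).
Proof.
move=> mf; apply: (@qmeasurable_qintegral_param _ _ _ (measurableTypeR R) R nu
  (fun y x => qact s (K x y) (f x))).
apply: qmeasurable_act; last exact: (qmeasurable_comp measurable_snd mf).
exact: (qmeasurable_comp (@measurable_swap _ _ _ _) qmeasurable_frac_plane).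
Qed.

Lemma ftr_isometry (f : R -> quat R) : qmeasurable f ->
  (N12 (fun x => qmod (f x)) < +oo)%E ->
  qsq nu (ftr f) = ((kappa chi (- (sin theta)^-1))%:E * qsq nu f)%E.
Proof.
move=> mf foo.
pose l := - (sin theta)^-1; have l0 : l != 0 by rewrite oppr_eq0 invr_eq0.
have lE x y : - (y / sin theta) * x = l * y * x by rewrite /l; ring.
pose h := chirped f.
have mph : measurable_fun [set: R] (fun x => cs_phase theta x 0).
  apply: measurable_funN; apply: measurable_funM => //; apply: measurable_funM => //.
  by apply: measurable_funD => //; exact: measurable_funX.
have mh : qmeasurable h.
  apply: qmeasurable_act => //; apply: qmeasurable_plane.
  - by apply: (measurableT_comp _ mph); exact: continuous_measurable_fun (@continuous_cos R).
  - by apply: (measurableT_comp _ mph); exact: continuous_measurable_fun (@continuous_sin R).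
have mhc c : measurable_fun [set: R] (fun x => qc c (h x)).
  exact: (qmeasurableP h).1.
have hf x : qmod (h x) = qmod (f x) by rewrite /qmod -!/(qnrm _) qnrm_chirped.
have hc c : (N12 (fun x => qc c (h x)) < +oo)%E.
  apply: le_lt_trans foo; rewrite -[leRHS]mul1e.
  apply: (@le_n12 _ (measurableTypeR R) R nu _ _ 1 ler01 (mhc c)).
    exact: (@measurable_qmod R _ (measurableTypeR R) f mf).
  move=> x; rewrite mul1r (ger0_norm (qmod_ge0 (f x))) -(hf x) lerD ?norm_qc//.
  by rewrite qmod_sqr qc_sqr.
have hi : nu.-integrable [set: R] (EFin \o (fun x => qmod (f x))).
  by apply: (@n12_integrable _ (measurableTypeR R) R nu) => //; exact: (@measurable_qmod R _ (measurableTypeR R) f mf).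
pose A (y x : R) : R := dkc chi * Ac chi (l * y * x).
pose B (y x : R) : R := dkc chi * Bc chi (l * y * x).
(* P is even and Q is odd in y. Their kernels are real, hence P and Q can be computed coordinate by
   coordinate, unlike [ftr f]. *)
pose P y := qintegral nu setT (fun x => A y x *: h x).
pose Q y := qintegral nu setT (fun x => B y x *: h x).
have PE c y : qc c (P y) = \int[nu]_x qc c (A y x *: h x) by exact: qc_qintegral.
have QE c y : qc c (Q y) = \int[nu]_x qc c (B y x *: h x) by exact: qc_qintegral.
have mly (y : R) : measurable_fun [set: R] (fun x => l * y * x) by exact: measurable_funM.
have mA y : measurable_fun [set: R] (A y).
  by apply: measurable_funM => //; exact: (measurableT_comp (measurable_Ac chi) (mly y)).
have mB y : measurable_fun [set: R] (B y).
  by apply: measurable_funM => //; exact: (measurableT_comp (measurable_Bc chi) (mly y)).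
have iA y : qintegrable nu (fun x => A y x *: h x).
  apply: (@qintegrable_le R _ (measurableTypeR R) nu _ (fun x => qmod (f x)) (`|dkc chi| * wtot chi)) => //.
    exact: (@qmeasurableZ R _ (measurableTypeR R) (A y) h (mA y) mh).
  by move=> x; rewrite qmodZ hf ler_wpM2r ?qmod_ge0// normrM ler_wpM2l// norm_Ac.
have iB y : qintegrable nu (fun x => B y x *: h x).
  apply: (@qintegrable_le R _ (measurableTypeR R) nu _ (fun x => qmod (f x)) (`|dkc chi| * wtot chi)) => //.
    exact: (@qmeasurableZ R _ (measurableTypeR R) (B y) h (mB y) mh).
  by move=> x; rewrite qmodZ hf ler_wpM2r ?qmod_ge0// normrM ler_wpM2l// norm_Bc.
have GE y : qnrm (ftr f y) = qnrm (P y + qact s a (Q y)).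
  rewrite /ftr; under eq_fun do rewrite qact_frac_plane.
  under eq_fun do rewrite lE.
  have ia := qintegrable_act s a (iB y).
  rewrite qintegral_act; last exact: (qintegrableD (iA y) ia).
  rewrite qnrm_act qnrm_plane// cos2Dsin2 mul1r (qintegralD (iA y) ia).
  by rewrite qintegral_act.
have PN y : P (- y) = P y.
  rewrite /P; congr qintegral; apply/funext => x.
  by rewrite /A mulrN mulNr AcN.
clearbody P Q.
have QN y : Q (- y) = - Q y.
  have H c : qc c (Q (- y)) = - qc c (Q y).
    rewrite QE (QE c y) -[RHS]mulN1r.
    apply: etrans (RintegralZl (-1) measurableT (iB y c)).
    apply: eq_Rintegral => x _; rewrite !qcZ /B mulrN mulNr BcN//.
    by rewrite mulrN mulNr mulN1r.
  by apply: qcP => c; rewrite H qcN.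
(* The real transform of one coordinate of h is the same coordinate of P + Q, and the real isometry
   applies to it. *)
pose T c := ktr nu (fun y x => dkernel chi (l * y * x)) (fun x => qc c (h x)).
have TE c y : T c y = qc c (P y) + qc c (Q y).
  rewrite PE QE.
  apply: etrans (RintegralD measurableT (iA y c) (iB y c)).
  by apply: eq_Rintegral => x _; rewrite !qcZ -mulrDl -mulrDr.
have mT c : measurable_fun [set: R] (T c).
  exact: (@measurable_ktr _ (measurableTypeR R) R nu _ (measurable_dkernel2 chi l) _ (mhc c)).
have TI c : sqn nu (T c) = ((kappa chi l)%:E * sqn nu (fun x => qc c (h x)))%E.
  exact: dkernel_isometry.
have mftr := qmeasurable_ftr mf.
have -> : qsq nu f = qsq nu h by apply: eq_integral => x _; rewrite qnrm_chirped.
clear PE QE; clearbody T h; clear iA iB mA mB mly mhc hf.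
move: (ftr f) (kappa chi l) (kappa_ge0 chi l) GE TI mftr; clear mf foo hi A B mph.
move=> G k k0 GE TI mftr.
pose W y := Quat (T (false, false) y) (T (false, true) y) (T (true, false) y) (T (true, true) y).
have mW : qmeasurable W by split; exact: mT.
have a1 : qnrm a = 1.
  by rewrite /qnrm a_pure expr0n add0r pure_unit.
(* The sum over y and -y is 2|P|^2 + 2|Q|^2 on both sides: for G by the parallelogram identity and
   |a| = 1, for W = P + Q in each coordinate. *)
have -> : qsq nu G = qsq nu W.
  apply: (qsq_nu_symm mftr mW) => y.
  rewrite !GE PN QN qactN qnrm_parallelogram qnrm_act a1 mul1r.
  rewrite {3 4}/qnrm/= !TE PN QN !qcN/= /qnrm; clear; ring.
rewrite (qsqE nu mW) (qsqE nu mh) (TI (false, false)) (TI (false, true)) (TI (true, false)) (TI (true, true)).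
have z c := sqn_ge0 nu (fun x => qc c (h x)).
move: (z (false, false)) (z (false, true)) (z (true, false)) (z (true, true)) => /=; clear.
move: (sqn _ _) (sqn _ _) (sqn _ _) (sqn _ _) => u v w t u0 v0 w0 t0.
by rewrite !ge0_muleDr ?adde_ge0.
Qed.

End frac_dunkl_line.

(** * The planar transform *)

Section qintegral_bounds.
Context d (T : measurableType d) (R : realType) (m : {measure set T -> \bar R}).
Implicit Types F G : T -> quat R.

Lemma qintegral_ae_eq F G : qmeasurable F -> qmeasurable G ->
  (\forall x \ae m, F x = G x) -> qintegral m setT F = qintegral m setT G.
Proof.
move=> mF mG FG; apply: qcP => c; rewrite !qc_qintegral /Rintegral; congr fine.
apply: ae_eq_integral => //.
- by apply/measurable_EFinP; exact: (qmeasurableP F).1.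
- by apply/measurable_EFinP; exact: (qmeasurableP G).1.
- by apply: filterS FG => x /= -> _.
Qed.

(** The crude constant 4 counts the coordinates; the bound only serves to prove finiteness. *)
Lemma norm_qintegral F : qmeasurable F ->
  ((qmod (qintegral m setT F))%:E <= 4%:E * \int[m]_x (qmod (F x))%:E)%E.
Proof.
move=> mF.
have mq : measurable_fun setT (fun x => (qmod (F x))%:E).
  by apply/measurable_EFinP; exact: measurable_qmod.
have q0 : (0 <= \int[m]_x (qmod (F x))%:E)%E.
  by apply: integral_ge0 => x _; rewrite lee_fin qmod_ge0.
have H c : (`|qc c (qintegral m setT F)|%:E <= \int[m]_x (qmod (F x))%:E)%E.
  have mc : measurable_fun setT (fun x => (qc c (F x))%:E).
    by apply/measurable_EFinP; exact: (qmeasurableP F).1.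
  apply: (@le_trans _ _ `|\int[m]_x (qc c (F x))%:E|%E).
    by rewrite qc_qintegral /Rintegral; case: (\int[m]_x _)%E => //=; rewrite normr0 leey.
  apply: le_trans (le_abse_integral m measurableT mc) _.
  apply: ge0_le_integral => //.
  - exact: measurableT_comp.
  - by move=> x _; rewrite lee_fin norm_qc.
apply: (@le_trans _ _ (`|qre (qintegral m setT F)|%:E + `|qi (qintegral m setT F)|%:E +
    `|qj (qintegral m setT F)|%:E + `|qk (qintegral m setT F)|%:E)%E).
  by rewrite -!EFinD lee_fin qmod_le_sum.
have E4 (x : \bar R) : (0 <= x -> 4%:E * x = x + x + x + x)%E.
  case: x => [r| |]//= _; last by rewrite gt0_muley.
  by rewrite -EFinM -!EFinD; congr EFin; ring.
rewrite E4//.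
apply: leeD; last exact: (H (true, true)).
apply: leeD; last exact: (H (true, false)).
by apply: leeD; [exact: (H (false, false))|exact: (H (false, true))].
Qed.

Lemma qsq_ge0 F : (0 <= qsq m F)%E.
Proof. by apply: integral_ge0 => x _; rewrite lee_fin qnrm_ge0. Qed.

Lemma n12_qmodE F : qmeasurable F ->
  (\int[m]_x (`|qmod (F x)| + qmod (F x) ^+ 2)%:E = \int[m]_x (qmod (F x))%:E + qsq m F)%E.
Proof.
move=> mF.
have mq : measurable_fun setT (fun x => (qmod (F x))%:E).
  by apply/measurable_EFinP; exact: measurable_qmod.
have mn : measurable_fun setT (fun x => (qnrm (F x))%:E).
  by apply/measurable_EFinP; exact: measurable_qnrm.
rewrite /qsq -ge0_integralD//.
- by apply: eq_integral => x _; rewrite ger0_norm ?qmod_ge0// qmod_sqr.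
- by move=> x _; rewrite lee_fin qmod_ge0.
- by move=> x _; rewrite lee_fin qnrm_ge0.
Qed.

End qintegral_bounds.

Section two_sided.
Context d1 d2 (T1 : measurableType d1) (T2 : measurableType d2) (R : realType).
Variables (m1 : {sigma_finite_measure set T1 -> \bar R}).
Variables (m2 : {sigma_finite_measure set T2 -> \bar R}).
Local Notation m := (m1 \x m2)%E.

Lemma qintegral_prod (F : T1 * T2 -> quat R) : qintegrable m F ->
  qintegral m setT F = qintegral m1 setT (fun x => qintegral m2 setT (fun y => F (x, y))).
Proof.
move=> Fi; apply: qcP => c; rewrite !qc_qintegral /Rintegral; congr fine.
rewrite -(integral12_prod_meas1 (Fi c)).
have mF := measurable_fubini_F (Fi c).
apply: ae_eq_integral => //.
  apply/measurable_EFinP.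
  under eq_fun do rewrite qc_qintegral.
  by apply: measurableT_comp => //; exact: mF.
(* Only almost every section is integrable, and there [fine] recovers the inner integral. *)
apply: filterS (ae_integrable1 (Fi c)) => x ix _.
rewrite qc_qintegral /fubini_F /Rintegral fineK//.
exact: (integrable_fin_num measurableT ix).
Qed.

Variables (k1 : T1 -> T1 -> quat R) (k2 : T2 -> T2 -> quat R) (M1 M2 kap1 kap2 : R).
Hypotheses (mk1 : qmeasurable (fun z : T1 * T1 => k1 z.1 z.2))
  (mk2 : qmeasurable (fun z : T2 * T2 => k2 z.1 z.2)).
Hypotheses (k1_le : forall x y, qmod (k1 x y) <= M1) (k2_le : forall x y, qmod (k2 x y) <= M2).
Hypotheses (kap1_ge0 : 0 <= kap1) (kap2_ge0 : 0 <= kap2).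
Hypothesis iso1 : forall f, qmeasurable f -> (n12 m1 (fun x => qmod (f x)) < +oo)%E ->
  qsq m1 (fun y => qintegral m1 setT (fun x => k1 x y * f x)) = (kap1%:E * qsq m1 f)%E.
Hypothesis iso2 : forall f, qmeasurable f -> (n12 m2 (fun x => qmod (f x)) < +oo)%E ->
  qsq m2 (fun y => qintegral m2 setT (fun x => f x * k2 x y)) = (kap2%:E * qsq m2 f)%E.

Variable f : T1 * T2 -> quat R.
Hypothesis mf : qmeasurable f.
Hypothesis f_int : m.-integrable setT (EFin \o (fun x => qmod (f x))).
Hypothesis f_sq : (qsq m f < +oo)%E.

Definition two_sided (y : T1 * T2) : quat R :=
  qintegral m setT (fun x => k1 x.1 y.1 * f x * k2 x.2 y.2).

(** The right transform in the second variable alone, the intermediate stage of the composition. *)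
Let g x1 y2 := qintegral m2 setT (fun x2 => f (x1, x2) * k2 x2 y2).

Let mk1y y : qmeasurable (fun x => k1 x y).
Proof. by apply: (qmeasurable_comp (phi := fun x => (x, y)) _ mk1); exact: measurable_fun_pair. Qed.

Let mk2y y : qmeasurable (fun x => k2 x y).
Proof. by apply: (qmeasurable_comp (phi := fun x => (x, y)) _ mk2); exact: measurable_fun_pair. Qed.

Let mf1 x1 : qmeasurable (fun x2 => f (x1, x2)).
Proof. by apply: (qmeasurable_comp (phi := fun x2 => (x1, x2)) _ mf); exact: measurable_fun_pair. Qed.

Let mg : qmeasurable (fun z : T1 * T2 => g z.1 z.2).
Proof.
apply: (qmeasurable_qintegral_param m2 (F := fun (z : T1 * T2) x2 => f (z.1, x2) * k2 x2 z.2)).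
apply: qmeasurableM.
- apply: (qmeasurable_comp (phi := fun z : (T1 * T2) * T2 => (z.1.1, z.2)) _ mf); apply: measurable_fun_pair => //.
  exact: (measurableT_comp measurable_fst measurable_fst).
- apply: (qmeasurable_comp (phi := fun z : (T1 * T2) * T2 => (z.2, z.1.2)) _ mk2); apply: measurable_fun_pair => //.
  exact: (measurableT_comp measurable_snd measurable_fst).
Qed.

Let mg2 y2 : qmeasurable (fun x1 => g x1 y2).
Proof. by apply: (qmeasurable_comp (phi := fun x1 => (x1, y2)) _ mg); exact: measurable_fun_pair. Qed.

Let integral_gee0_abs d (T : measurableType d) (mu : {measure set T -> \bar R}) (h : T -> R) :
  (forall x, 0 <= h x) -> (\int[mu]_x `|(h x)%:E| = \int[mu]_x (h x)%:E)%E.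
Proof. by move=> h0; apply: eq_integral => z _; rewrite gee0_abs// lee_fin. Qed.

Let integrable_qnrm (F : T1 * T2 -> quat R) : qmeasurable F -> (qsq m F < +oo)%E ->
  m.-integrable setT (fun z => (qnrm (F z))%:E).
Proof.
move=> mF Foo; apply/integrableP; split.
  by apply/measurable_EFinP; exact: measurable_qnrm.
by rewrite integral_gee0_abs// => z; exact: qnrm_ge0.
Qed.

(** The one-variable isometry asks for a finite gauge, that is for the L^1 and the L^2 condition on
    the section; each holds almost everywhere by Fubini. *)
Let f_section : \forall x1 \ae m1, (n12 m2 (fun x2 => qmod (f (x1, x2))) < +oo)%E.
Proof.
have h2 := ae_integrable1 (integrable_qnrm mf f_sq).
apply: filterS2 (ae_integrable1 f_int) h2 => x1 /integrableP[_ i1] /integrableP[_ i2].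
rewrite /n12 n12_qmodE// lte_add_pinfty//.
- by apply: le_lt_trans i1; rewrite integral_gee0_abs// => x; exact: qmod_ge0.
- by apply: le_lt_trans i2; rewrite integral_gee0_abs// => x; exact: qnrm_ge0.
Qed.

Lemma qsq_prod1 (F : T1 * T2 -> quat R) : qmeasurable F ->
  (qsq m F = \int[m1]_x qsq m2 (fun y => F (x, y)))%E.
Proof.
move=> mF; rewrite /qsq (fubini_tonelli1 (fun z => (qnrm (F z))%:E))//.
- by apply/measurable_EFinP; exact: measurable_qnrm.
- by move=> z; rewrite lee_fin qnrm_ge0.
Qed.

Lemma qsq_prod2 (F : T1 * T2 -> quat R) : qmeasurable F ->
  (qsq m F = \int[m2]_y qsq m1 (fun x => F (x, y)))%E.
Proof.
move=> mF; rewrite /qsq (fubini_tonelli2 (fun z => (qnrm (F z))%:E))//.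
- by apply/measurable_EFinP; exact: measurable_qnrm.
- by move=> z; rewrite lee_fin qnrm_ge0.
Qed.

Lemma measurable_qsq1 (F : T1 * T2 -> quat R) : qmeasurable F ->
  measurable_fun setT (fun x => qsq m2 (fun y => F (x, y))).
Proof.
move=> mF; apply: (measurable_fun_fubini_tonelli_F (m2 := m2) (fun z => (qnrm (F z))%:E)).
- by apply/measurable_EFinP; exact: measurable_qnrm.
- by move=> z; rewrite lee_fin qnrm_ge0.
Qed.

Lemma measurable_qsq2 (F : T1 * T2 -> quat R) : qmeasurable F ->
  measurable_fun setT (fun y => qsq m1 (fun x => F (x, y))).
Proof.
move=> mF; apply: (measurable_fun_fubini_tonelli_G (m1 := m1) (fun z => (qnrm (F z))%:E)).
- by apply/measurable_EFinP; exact: measurable_qnrm.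
- by move=> z; rewrite lee_fin qnrm_ge0.
Qed.

Let qsq_g : qsq m (fun z => g z.1 z.2) = (kap2%:E * qsq m f)%E.
Proof.
rewrite !qsq_prod1// -ge0_integralZl_EFin//.
- apply: ge0_ae_eq_integral => //.
  + exact: (measurable_qsq1 mg).
  + by apply: emeasurable_funM => //; exact: (measurable_qsq1 mf).
  + by move=> x _; exact: qsq_ge0.
  + by move=> x _; rewrite mule_ge0 ?qsq_ge0.
  + apply: filterS f_section => x fx _; exact: (iso2 (mf1 x) fx).
- by move=> x _; exact: qsq_ge0.
- exact: (measurable_qsq1 mf).
Qed.

(** The kernel [k2] is bounded, so the L^1 norm of f controls this integral for every y2. *)
Let g_int y2 : (\int[m1]_x1 (qmod (g x1 y2))%:E < +oo)%E.
Proof.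
have mq : measurable_fun setT (fun z => (qmod (f z))%:E).
  by apply/measurable_EFinP; exact: measurable_qmod.
have q0 z : (0 <= (qmod (f z))%:E)%E by rewrite lee_fin qmod_ge0.
have mI : measurable_fun setT (fun x1 => \int[m2]_x2 (qmod (f (x1, x2)))%:E)%E.
  exact: (measurable_fun_fubini_tonelli_F (m2 := m2) (fun z => (qmod (f z))%:E)).
have I0 x1 : (0 <= \int[m2]_x2 (qmod (f (x1, x2)))%:E)%E by exact: integral_ge0.
apply: (@le_lt_trans _ _ (\int[m1]_x1 ((4 * `|M2|)%:E * \int[m2]_x2 (qmod (f (x1, x2)))%:E)))%E.
  apply: ge0_le_integral => //.
  - by move=> x _; rewrite lee_fin qmod_ge0.
  - by apply/measurable_EFinP; apply: measurable_qmod; exact: mg2.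
  - exact: emeasurable_funM.
  - move=> x1 _; apply: le_trans (norm_qintegral _ _) _; first exact: qmeasurableM.
    rewrite EFinM -muleA lee_pmul2l// -ge0_integralZl_EFin//; last first.
      by apply/measurable_EFinP; exact: measurable_qmod.
    apply: ge0_le_integral => //.
    + by move=> x _; rewrite lee_fin qmod_ge0.
    + by apply/measurable_EFinP; apply: measurable_qmod; exact: qmeasurableM.
    + apply: emeasurable_funM => //.
      by apply/measurable_EFinP; exact: measurable_qmod.
    + move=> x _; rewrite -EFinM lee_fin qmodM mulrC ler_wpM2r ?qmod_ge0//.
      exact: le_trans (k2_le _ _) (ler_norm _).
have c0 : 0 <= 4 * `|M2| by rewrite mulr_ge0.
rewrite (ge0_integralZl_EFin m1 measurableT (fun x _ => I0 x) mI c0).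
rewrite lte_mul_pinfty ?lee_fin//.
have := fubini_tonelli1 (m1 := m1) (m2 := m2) _ mq q0; rewrite /fubini_F => <-.
have /integrableP[_] := f_int; apply: le_lt_trans.
by rewrite integral_gee0_abs// => x; exact: qmod_ge0.
Qed.

(** The L^1 half is [g_int]; the L^2 half holds almost everywhere because [qsq_g] makes g square
    integrable on the product. *)
Let g_section : \forall y2 \ae m2, (n12 m1 (fun x1 => qmod (g x1 y2)) < +oo)%E.
Proof.
have goo : (qsq m (fun z => g z.1 z.2) < +oo)%E by rewrite qsq_g lte_mul_pinfty.
have hi := integrable_qnrm mg goo.
apply: filterS (ae_integrable2 hi) => y2 /integrableP[_ h].
rewrite /n12 n12_qmodE// lte_add_pinfty//; apply: le_lt_trans h.
by rewrite integral_gee0_abs// => x; exact: qnrm_ge0.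
Qed.

(** The left factor [k1 x1 y.1] is constant in the inner variable and leaves the inner integral by
    linearity, for almost every x1. *)
Let two_sidedE y : two_sided y = qintegral m1 setT (fun x1 => k1 x1 y.1 * g x1 y.2).
Proof.
have mF : qmeasurable (fun x : T1 * T2 => k1 x.1 y.1 * f x * k2 x.2 y.2).
  apply: qmeasurableM; last exact: (qmeasurable_comp measurable_snd (mk2y y.2)).
  apply: qmeasurableM => //; exact: (qmeasurable_comp measurable_fst (mk1y y.1)).
rewrite /two_sided qintegral_prod; last first.
  apply: (qintegrable_le (C := M1 * M2) mF f_int) => x; rewrite !qmodM mulrAC.
  by rewrite ler_wpM2r ?qmod_ge0// ler_pM ?qmod_ge0.
apply: qintegral_ae_eq.
- apply: (qmeasurable_qintegral_param m2 (F := fun x1 x2 => k1 x1 y.1 * f (x1, x2) * k2 x2 y.2)).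
  have mid : measurable_fun [set: T1 * T2] (fun z : T1 * T2 => (z.1, z.2)).
    exact: measurable_fun_pair.
  exact: (qmeasurable_comp mid mF).
- exact: qmeasurableM.
apply: filterS f_section => x1 fx1.
have hi : qintegrable m2 (fun x2 => f (x1, x2) * k2 x2 y.2).
  apply: (qintegrable_le (h := fun x2 => qmod (f (x1, x2))) (C := M2)).
  - exact: qmeasurableM.
  - by apply: n12_integrable => //; exact: measurable_qmod.
  - by move=> x2; rewrite qmodM mulrC ler_wpM2r ?qmod_ge0.
apply: etrans (qintegral_act true (k1 x1 y.1) hi); congr qintegral; apply/funext => x2.
by rewrite /qact mulrA.
Qed.

Lemma qmeasurable_two_sided : qmeasurable two_sided.
Proof.
rewrite (_ : two_sided = fun y => qintegral m1 setT (fun x1 => k1 x1 y.1 * g x1 y.2)); last first.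
  by apply/funext => y; exact: two_sidedE.
apply: (qmeasurable_qintegral_param m1 (F := fun (y : T1 * T2) x1 => k1 x1 y.1 * g x1 y.2)).
apply: qmeasurableM.
- apply: (qmeasurable_comp (phi := fun z : (T1 * T2) * T1 => (z.2, z.1.1)) _ mk1); apply: measurable_fun_pair => //.
  exact: (measurableT_comp measurable_fst measurable_fst).
- apply: (qmeasurable_comp (phi := fun z : (T1 * T2) * T1 => (z.2, z.1.2)) _ mg).
  apply: measurable_fun_pair => //.
  exact: (measurableT_comp measurable_snd measurable_fst).
Qed.

(** For [qsq_g] the outer variable was x1; here it is y2. In both cases the inner integral is a
    one-variable isometry on almost every section. *)
Lemma two_sided_isometry : qsq m two_sided = ((kap1 * kap2)%:E * qsq m f)%E.
Proof.
rewrite EFinM -muleA -qsq_g !qsq_prod2//; last exact: qmeasurable_two_sided.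
rewrite -ge0_integralZl_EFin//.
- apply: ge0_ae_eq_integral => //.
  + exact: (measurable_qsq2 qmeasurable_two_sided).
  + by apply: emeasurable_funM => //; exact: (measurable_qsq2 mg).
  + by move=> x _; exact: qsq_ge0.
  + by move=> x _; rewrite mule_ge0 ?qsq_ge0.
  + apply: filterS g_section => y2 gy _.
    rewrite -(iso1 (mg2 y2) gy); apply: eq_integral => y1 _.
    by rewrite two_sidedE.
- by move=> x _; exact: qsq_ge0.
- exact: (measurable_qsq2 mg).
Qed.

End two_sided.

Lemma qintegralB d (T : measurableType d) (R : realType) (m : {measure set T -> \bar R})
  (f g : T -> quat R) : qintegrable m f -> qintegrable m g ->
  qintegral m setT (fun x => f x - g x) = qintegral m setT f - qintegral m setT g.
Proof.
move=> fi gi; apply: qcP => c; rewrite qcB !qc_qintegral.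
rewrite -(RintegralB measurableT (fi c) (gi c)).
by apply: eq_Rintegral => x _; rewrite qcB.
Qed.

Section square_norm.
Context d (T : measurableType d) (R : realType) (m : {measure set T -> \bar R}).
Implicit Types f g : T -> quat R.
Local Notation L p := (qLp m p).

Lemma sqn_qmod f : sqn m (fun x => qmod (f x)) = qsq m f.
Proof. by apply: eq_integral => x _; rewrite qmod_sqr. Qed.

Lemma qLnorm2E f : (qsq m f < +oo)%E -> qLnorm m 2 f = (Num.sqrt (fine (qsq m f)))%:E.
Proof.
by rewrite -sqn_qmod => foo; rewrite /qLnorm -(Lnorm2E foo).
Qed.

Lemma qLp2P f : L 2 f <-> qmeasurable f /\ (qsq m f < +oo)%E.
Proof.
split=> -[mf foo]; split=> //; last by rewrite qLnorm2E ?ltry.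
move: foo; rewrite /qLnorm unlock /=.
rewrite (_ : (\int[m]_x _)%E = qsq m f); last first.
  by apply: eq_integral => x _; rewrite powR_mulrn// real_normK ?num_real// qmod_sqr.
by case: (qsq m f) => [r _|/=|_]; rewrite ?ltry// invr_eq0 pnatr_eq0.
Qed.

Lemma qLp1_integrable f : L 1 f -> m.-integrable setT (EFin \o (fun x => qmod (f x))).
Proof.
move=> [mf]; rewrite /qLnorm Lnorm1 => foo; apply/integrableP; split=> //.
by apply/measurable_EFinP; exact: measurable_qmod.
Qed.

Lemma integrable_qLp1 f : qmeasurable f ->
  m.-integrable setT (EFin \o (fun x => qmod (f x))) -> L 1 f.
Proof. by move=> mf /integrableP[_ foo]; split=> //; rewrite /qLnorm Lnorm1. Qed.

End square_norm.

(** * The planar measure as a product *)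

Section dunkl_plane.
Variable R : realType.
Variables chi1 chi2 : R.
Local Notation leb := (@lebesgue_measure R).
Local Notation nu1 := (nu chi1).
Local Notation nu2 := (nu chi2).
Local Notation mu := (dunkl_measure chi1 chi2).
Local Open Scope ereal_scope.

Lemma nuE chi (A : set (measurableTypeR R)) :
  nu chi A = \int[leb]_x ((dw chi x * \1_A x)%R)%:E.
Proof.
rewrite /nu/= /wleb integral_mkcond; apply: eq_integral => x _.
rewrite patchE indicE; case: ifPn => xA; last by rewrite mulr0.
by rewrite mulr1 ger0_norm// dw_ge0.
Qed.

(** The weight is a product of functions of one variable, so the measures agree on rectangles;
    uniqueness of the product measure does the rest. *)
Lemma dunkl_measure_prod (A : set (measurableTypeR R * measurableTypeR R)) :
  measurable A -> mu A = (nu1 \x nu2) A.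
Proof.
move=> mA; apply/esym; apply: product_measure_unique => // B C mB mC.
have mw chi (D : set (measurableTypeR R)) : measurable D ->
    measurable_fun [set: R] (fun x => ((dw chi x * \1_D x)%R)%:E).
  move=> mD; apply/measurable_EFinP/measurable_funM; first exact: measurable_dw.
  exact: measurable_indic.
have w0 chi (D : set (measurableTypeR R)) x : 0 <= ((dw chi x * \1_D x)%R)%:E.
  by rewrite lee_fin mulr_ge0 ?dw_ge0.
apply: (etrans _ (esym (congr2 (fun u v => u * v) (nuE chi1 B) (nuE chi2 C)))).
rewrite /= /dunkl_measure integral_mkcond.
rewrite (_ : _ \_ _ = (fun z => ((dw chi1 z.1 * \1_B z.1)%R)%:E * ((dw chi2 z.2 * \1_C z.2)%R)%:E)); last first.
  apply/funext => -[x y]; rewrite patchE in_setX !indicE/= -EFinM /dunkl_weight /dw/=.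
  by case: (x \in B); case: (y \in C); rewrite /= ?mulr1 ?mulr0 ?mul0r.
rewrite (fubini_tonelli1 (m1 := leb) (m2 := leb)
  (fun z => ((dw chi1 z.1 * \1_B z.1)%R)%:E * ((dw chi2 z.2 * \1_C z.2)%R)%:E)).
- rewrite /fubini_F /=.
  under eq_integral => x _ do
    rewrite (ge0_integralZl leb measurableT (mw chi2 C mC) (fun y _ => w0 chi2 C y) (w0 chi1 B x)).
  rewrite (ge0_integralZr leb measurableT (mw chi1 B mB) (fun y _ => w0 chi1 B y))//.
  exact: integral_ge0.
- apply: emeasurable_funM.
  + exact: (measurableT_comp (mw chi1 B mB) measurable_fst).
  + exact: (measurableT_comp (mw chi2 C mC) measurable_snd).
- by move=> z; rewrite mule_ge0.
Qed.

Lemma integral_dunkl_measure (f : R * R -> \bar R) :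
  \int[mu]_x f x = \int[nu1 \x nu2]_x f x.
Proof. by apply: eq_measure_integral => A mA _; exact: dunkl_measure_prod. Qed.

Lemma qsq_dunkl_measure (f : R * R -> quat R) : qsq mu f = qsq (nu1 \x nu2) f.
Proof. exact: integral_dunkl_measure. Qed.

Lemma qintegral_dunkl_measure (f : R * R -> quat R) :
  qintegral mu setT f = qintegral (nu1 \x nu2) setT f.
Proof. by apply: qcP => c; rewrite !qc_qintegral /Rintegral integral_dunkl_measure. Qed.

Lemma integrable_dunkl_measure (f : R * R -> \bar R) :
  mu.-integrable setT f -> (nu1 \x nu2).-integrable setT f.
Proof. by move=> /integrableP[mf foo]; apply/integrableP; rewrite -integral_dunkl_measure. Qed.

End dunkl_plane.

Section frac_constant.
Variable R : realType.

(** For l = -1/sin theta the factor [kappa] is bigD^2 |sin theta|^(2 chi + 2), while the constant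
    has modulus 1/(bigD |sin theta|^(chi + 1)), its exponential being unimodular. *)
Lemma qnrm_frac_const (q : quat R) (chi theta : R) : 0 <= chi -> sin theta != 0 ->
  pure_quat q -> q ^+ 2 = -1 ->
  qnrm (frac_const q chi theta) * kappa chi (- (sin theta)^-1) = 1.
Proof.
move=> chi0 s0 q0 q2; rewrite /frac_const qnrmZ qexp_plane// qnrm_plane// cos2Dsin2 mulr1.
have g0 : 0 < bigD chi by rewrite mulr_gt0 ?powR_gt0// Gamma_gt0//; lra.
rewrite /kappa -/(bigD chi) normrN normfV.
have n0 : 0 < `|sin theta| by rewrite normr_gt0.
have -> : 2 * chi + 2 = (chi + 1) * 2 by ring.
have E : `|sin theta|^-1 `^ (chi + 1) = (`|sin theta| `^ (chi + 1))^-1.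
  by rewrite -(powR_inv1 (ltW n0)) -powRrM mulN1r powRN.
rewrite powRrM powR_mulrn ?powR_ge0// E.
move: (lt0r_neq0 (powR_gt0 (chi + 1) n0)) (lt0r_neq0 g0).
move: (_ `^ _) (bigD _) => u v u0 v0.
by field; rewrite u0 v0.
Qed.

End frac_constant.

Section frac_dunkl_plane.
Variable R : realType.
Variables (chi1 chi2 theta1 theta2 : R) (a b : quat R).
Hypotheses (chi1_ge0 : 0 <= chi1) (chi2_ge0 : 0 <= chi2).
Hypotheses (sin1_neq0 : sin theta1 != 0) (sin2_neq0 : sin theta2 != 0).
Hypotheses (a_pure : pure_quat a) (a_sqr : a ^+ 2 = -1).
Hypotheses (b_pure : pure_quat b) (b_sqr : b ^+ 2 = -1).
Local Notation nu1 := (nu chi1).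
Local Notation nu2 := (nu chi2).
Local Notation mu := (dunkl_measure chi1 chi2).
Local Notation F0 := (frac_dunkl chi1 chi2 theta1 theta2 a b).
Local Notation L p := (qLp mu p).

Let k1 (x y : measurableTypeR R) : quat R := frac_plane chi1 a theta1 x y.
Let k2 (x y : measurableTypeR R) : quat R := frac_plane chi2 b theta2 x y.
Let kap1 := kappa chi1 (- (sin theta1)^-1).
Let kap2 := kappa chi2 (- (sin theta2)^-1).
Let C := frac_const a chi1 theta1 * frac_const b chi2 theta2.

Lemma frac_dunklE f y : F0 f y = C * @two_sided _ _ (measurableTypeR R) (measurableTypeR R) R nu1 nu2 k1 k2 f y.
Proof.
rewrite /frac_dunkl /two_sided qintegral_dunkl_measure; congr (_ * qintegral _ _ _).
by apply/funext => x; rewrite frac_kernel_leftE// frac_kernel_rightE.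
Qed.

Let mk1 : qmeasurable (fun z : measurableTypeR R * measurableTypeR R => k1 z.1 z.2).
Proof. exact: qmeasurable_frac_plane. Qed.

Let mk2 : qmeasurable (fun z : measurableTypeR R * measurableTypeR R => k2 z.1 z.2).
Proof. exact: qmeasurable_frac_plane. Qed.

Let iso1 (f : measurableTypeR R -> quat R) : qmeasurable f ->
  (n12 nu1 (fun x => qmod (f x)) < +oo)%E ->
  qsq nu1 (fun y => qintegral nu1 setT (fun x => k1 x y * f x)) = (kap1%:E * qsq nu1 f)%E.
Proof. by move=> mf foo; exact: (ftr_isometry true chi1_ge0 sin1_neq0 a_pure a_sqr mf foo). Qed.

Let iso2 (f : measurableTypeR R -> quat R) : qmeasurable f ->
  (n12 nu2 (fun x => qmod (f x)) < +oo)%E ->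
  qsq nu2 (fun y => qintegral nu2 setT (fun x => f x * k2 x y)) = (kap2%:E * qsq nu2 f)%E.
Proof. by move=> mf foo; exact: (ftr_isometry false chi2_ge0 sin2_neq0 b_pure b_sqr mf foo). Qed.

Let k1_le x y : qmod (k1 x y) <= ftr_bound chi1.
Proof. exact: qmod_frac_plane. Qed.

Let k2_le x y : qmod (k2 x y) <= ftr_bound chi2.
Proof. exact: qmod_frac_plane. Qed.

Lemma frac_dunkl_isometry f : L 1 f -> L 2 f -> qmeasurable (F0 f) /\ qsq mu (F0 f) = qsq mu f.
Proof.
move=> f1 f2; have mf := f1.1.
have fi := integrable_dunkl_measure (qLp1_integrable f1).
have fs : (qsq (nu1 \x nu2) f < +oo)%E by rewrite -qsq_dunkl_measure; apply: ((qLp2P _ _).1 f2).2.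
have mS := @qmeasurable_two_sided _ _ _ _ R nu1 nu2 k1 k2 _ _ mk1 mk2 k1_le k2_le f mf fi fs.
have S2 := @two_sided_isometry _ _ _ _ R nu1 nu2 k1 k2 _ _ _ _ mk1 mk2 k1_le k2_le (kappa_ge0 chi1 _) (kappa_ge0 chi2 _) iso1 iso2 f mf fi fs.
have E : F0 f = (fun y => C * two_sided nu1 nu2 k1 k2 f y) by apply/funext => y; exact: frac_dunklE.
split; first by rewrite E; apply: qmeasurableM => //; exact: qmeasurable_cst.
have mT : measurable_fun [set: measurableTypeR R * measurableTypeR R]
    (fun y => (qnrm (two_sided nu1 nu2 k1 k2 f y))%:E).
  by apply/measurable_EFinP; exact: measurable_qnrm.
rewrite E !qsq_dunkl_measure.
transitivity ((qnrm C)%:E * qsq (nu1 \x nu2)%E (two_sided nu1 nu2 k1 k2 f))%E.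
  rewrite /qsq -(ge0_integralZl_EFin _ measurableT _ mT (qnrm_ge0 C)).
    by apply: eq_integral => y _; rewrite qnrmM EFinM.
  by move=> y _; rewrite lee_fin qnrm_ge0.
have mul11 (u v w t : R) : u * v = 1 -> w * t = 1 -> u * w * (v * t) = 1.
  by move=> h1 h2; rewrite mulrACA h1 h2 mulr1.
have CE : qnrm C * (kap1 * kap2) = 1.
  have E1 : qnrm (frac_const a chi1 theta1) * kap1 = 1 by exact: qnrm_frac_const.
  have E2 : qnrm (frac_const b chi2 theta2) * kap2 = 1 by exact: qnrm_frac_const.
  by rewrite /C qnrmM; exact: mul11.
by rewrite S2 muleA -EFinM -/kap1 -/kap2 CE mul1e.
Qed.

Let frac_integrable f y : L 1 f ->
  qintegrable (nu1 \x nu2)%E (fun x : measurableTypeR R * measurableTypeR R => k1 x.1 y.1 * f x * k2 x.2 y.2).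
Proof.
move=> f1; have mf := f1.1.
have mk1y : qmeasurable (fun x : measurableTypeR R => k1 x y.1).
  exact: qmeasurable_frac_section.
have mk2y : qmeasurable (fun x : measurableTypeR R => k2 x y.2).
  exact: qmeasurable_frac_section.
apply: (@qintegrable_le R _ _ (nu1 \x nu2)%E _ (fun x => qmod (f x)) (ftr_bound chi1 * ftr_bound chi2)).
- apply: qmeasurableM; last exact: (qmeasurable_comp measurable_snd mk2y).
  apply: qmeasurableM; last exact: mf.
  exact: (qmeasurable_comp measurable_fst mk1y).
- exact: integrable_dunkl_measure (qLp1_integrable f1).
- move=> x; rewrite (qmodM (k1 x.1 y.1 * f x)) (qmodM (k1 x.1 y.1)) [leLHS]mulrAC.
  apply: (ler_wpM2r (qmod_ge0 _)).
  exact: (ler_pM (qmod_ge0 _) (qmod_ge0 _) (k1_le _ _) (k2_le _ _)).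
Qed.

Lemma frac_dunklB f g y : L 1 f -> L 1 g -> F0 (f \- g) y = F0 f y - F0 g y.
Proof.
move=> f1 g1; rewrite !frac_dunklE -mulrBr /two_sided; congr (_ * _).
rewrite -(qintegralB (frac_integrable y f1) (frac_integrable y g1)).
by congr (qintegral _ _ _); apply/funext => x; rewrite /= mulrBr mulrBl.
Qed.

End frac_dunkl_plane.

(** * Extension to square integrable functions *)

Section square_integrable.
Context d (T : measurableType d) (R : realType) (m : {measure set T -> \bar R}).
Implicit Types f g h u v w : T -> quat R.
Local Notation L p := (qLp m p).

Lemma qmodD (p q : quat R) : qmod (p + q) <= qmod p + qmod q.
Proof.
rewrite -ler_sqr ?nnegrE ?addr_ge0 ?qmod_ge0// sqrrD !qmod_sqr.
(* With the conjugate of p, the Euclidean inner product is the real part of c q, and Cauchy-Schwarz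
   follows from multiplicativity of the modulus. *)
pose c := Quat (qre p) (- qi p) (- qj p) (- qk p).
have cp : qmod c = qmod p by rewrite /qmod /= !sqrrN.
have h : qre (c * q) <= qmod p * qmod q.
  rewrite -cp -qmodM; have := norm_qc (false, false) (c * q).
  by apply: le_trans; exact: ler_norm.
have -> : qnrm (p + q) = qnrm p + 2 * qre (c * q) + qnrm q.
  by rewrite !quatE /qnrm /=; ring.
by rewrite lerD2r lerD2l mulr_natl lerMn2r.
Qed.

Lemma qmodB (p q : quat R) : qmod (p - q) <= qmod p + qmod q.
Proof. by rewrite -(qmodN q) qmodD. Qed.

Lemma qmod_distrC (p q : quat R) : qmod (p - q) = qmod (q - p).
Proof. by rewrite -qmodN opprB. Qed.

(** The real-valued L^2 norm. It is 0 when the square integral is infinite, hence the assumptions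
    [L 2] on its lemmas. *)
Definition q2 f : R := Num.sqrt (fine (qsq m f)).

Lemma q2_ge0 f : 0 <= q2 f. Proof. exact: sqrtr_ge0. Qed.

Lemma qLp2_fin f : L 2 f -> (qsq m f < +oo)%E.
Proof. by move/qLp2P => []. Qed.

Lemma qsq_q2 f : L 2 f -> qsq m f = (q2 f ^+ 2)%:E.
Proof.
move=> /qLp2_fin foo; rewrite /q2 sqr_sqrtr ?fine_ge0 ?qsq_ge0//.
by rewrite fineK// ge0_fin_numE ?qsq_ge0.
Qed.

Lemma qLnorm_q2 f : L 2 f -> qLnorm m 2 f = (q2 f)%:E.
Proof. by move=> /qLp2_fin foo; rewrite qLnorm2E. Qed.

Lemma q2_triangle u v w : qmeasurable u -> L 2 v -> L 2 w ->
  (forall x, qmod (u x) <= qmod (v x) + qmod (w x)) -> L 2 u /\ q2 u <= q2 v + q2 w.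
Proof.
move=> mu v2 w2 uvw.
have tri x : `|qmod (u x)| <= `|qmod (v x)| + `|qmod (w x)|.
  by rewrite !ger0_norm ?qmod_ge0.
have := @sqn_triangle _ _ _ m _ _ _ (measurable_qmod mu) (measurable_qmod v2.1) (measurable_qmod w2.1) tri.
rewrite !sqn_qmod => /(_ (qLp2_fin v2) (qLp2_fin w2))[h1 h2].
by split=> //; exact/qLp2P.
Qed.

Lemma qLp2B f g : L 2 f -> L 2 g -> L 2 (f \- g).
Proof.
move=> f2 g2; have [] // := @q2_triangle (f \- g) f g _ f2 g2.
- exact: qmeasurableB f2.1 g2.1.
- by move=> x; exact: qmodB.
Qed.

Lemma q2_dist f g h : L 2 f -> L 2 g -> L 2 h -> q2 (f \- h) <= q2 (f \- g) + q2 (g \- h).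
Proof.
move=> f2 g2 h2.
have [] // := @q2_triangle (f \- h) (f \- g) (g \- h) _ (qLp2B f2 g2) (qLp2B g2 h2).
- exact: qmeasurableB f2.1 h2.1.
- by move=> x; rewrite /= -(subrKA (g x)) qmodD.
Qed.

Lemma q2_distrC f g : q2 (f \- g) = q2 (g \- f).
Proof.
rewrite /q2 /qsq; congr (Num.sqrt (fine _)); apply: eq_integral => x _ /=.
by rewrite -!qmod_sqr qmod_distrC.
Qed.

Lemma q2_sub f g : L 2 f -> L 2 g -> q2 f <= q2 (f \- g) + q2 g.
Proof.
move=> f2 g2; have [] // := @q2_triangle f (f \- g) g f2.1 (qLp2B f2 g2) g2.
by move=> x; rewrite /= -{1}(subrK (g x) (f x)) qmodD.
Qed.

Lemma qsq_ae_eq f g : qmeasurable f -> qmeasurable g -> (\forall x \ae m, f x = g x) ->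
  qsq m f = qsq m g.
Proof.
move=> mf mg fg; apply: ge0_ae_eq_integral => //.
- by apply/measurable_EFinP; exact: measurable_qnrm.
- by apply/measurable_EFinP; exact: measurable_qnrm.
- by move=> x _; rewrite lee_fin qnrm_ge0.
- by move=> x _; rewrite lee_fin qnrm_ge0.
- by apply: filterS fg => x -> _.
Qed.

Lemma q2_eq0_ae f g : L 2 f -> L 2 g -> q2 (f \- g) = 0 -> \forall x \ae m, f x = g x.
Proof.
move=> f2 g2 fg0; have mfg := qmeasurableB f2.1 g2.1.
have : qsq m (f \- g) = 0%E by rewrite (qsq_q2 (qLp2B f2 g2)) fg0 expr0n.
rewrite /qsq => h.
have mE : measurable_fun setT (fun x => (qnrm ((f \- g) x))%:E).
  by apply/measurable_EFinP; exact: measurable_qnrm.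
have h' : (\int[m]_x `|(qnrm ((f \- g) x))%:E| = 0)%E.
  by rewrite -[RHS]h; apply: eq_integral => x _; rewrite gee0_abs// lee_fin qnrm_ge0.
have /(ae_eq_integral_abs m measurableT mE) := h'.
apply: filterS => x /(_ I) /= [] h0.
apply/eqP; rewrite -subr_eq0; apply/eqP; apply: qcP => c.
apply/eqP; rewrite (_ : qc c 0 = 0); last by case: c => -[] [].
by rewrite -sqrf_eq0 eq_le sqr_ge0 andbT -h0 qc_sqr.
Qed.

(** Only small values are removed: where |f| >= 1/(n+1) one has |f| <= (n+1) |f|^2, which already
    puts the truncation in L^1. *)
Definition qtrunc f (n : nat) (x : T) : quat R :=
  if n.+1%:R^-1 <= qmod (f x) then f x else 0.

Lemma qmeasurable_if (b : T -> bool) f g : measurable_fun setT b ->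
  qmeasurable f -> qmeasurable g -> qmeasurable (fun x => if b x then f x else g x).
Proof.
move=> mb /qmeasurableP mf /qmeasurableP mg; apply/qmeasurableP => c.
under eq_fun do rewrite (fun_if (qc c)).
exact: measurable_fun_ifT.
Qed.

Lemma qmeasurable_qtrunc f n : qmeasurable f -> qmeasurable (qtrunc f n).
Proof.
move=> mf; apply: (@qmeasurable_if (fun x => n.+1%:R^-1 <= qmod (f x)) f (fun=> 0)) => //.
by apply: measurable_fun_ler => //; exact: measurable_qmod.
Qed.

Lemma qnrm_qtruncB f n x : qnrm (f x - qtrunc f n x) <= qnrm (f x).
Proof.
rewrite /qtrunc; case: ifP => _; last by rewrite subr0.
by rewrite subrr -qmod_sqr /qmod/= !expr0n/= !addr0 sqrtr0 expr0n qnrm_ge0.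
Qed.

Lemma qLp_qtrunc f n : L 2 f -> L 1 (qtrunc f n) /\ L 2 (qtrunc f n).
Proof.
move=> f2; have mt := qmeasurable_qtrunc n f2.1; split.
  apply: integrable_qLp1 => //.
  apply: (@integrable_leC _ _ _ m _ (fun x => qnrm (f x)) n.+1%:R) => //.
  - exact: measurable_qmod.
  - exact: measurable_qnrm f2.1.
  - by move=> x; exact: qnrm_ge0.
  - move=> x; rewrite ger0_norm ?qmod_ge0// /qtrunc; case: ifPn => [h|_].
      rewrite -qmod_sqr expr2 mulrA ler_peMl ?qmod_ge0//.
      by rewrite -ler_pdivrMl// mulr1.
    by rewrite /qmod/= !expr0n/= !addr0 sqrtr0 mulr_ge0// qnrm_ge0.
  - exact: qLp2_fin.
apply/qLp2P; split=> //; apply: le_lt_trans (qLp2_fin f2).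
apply: ge0_le_integral => //.
- by move=> x _; rewrite lee_fin qnrm_ge0.
- by apply/measurable_EFinP; exact: measurable_qnrm.
- by apply/measurable_EFinP; exact: measurable_qnrm f2.1.
- move=> x _; rewrite lee_fin /qtrunc; case: ifP => // _.
  by rewrite {1}/qnrm/= !expr0n/= !addr0 qnrm_ge0.
Qed.

Lemma qLp12_dense f (e : R) : L 2 f -> 0 < e ->
  exists h, [/\ L 1 h, L 2 h & q2 (f \- h) < e].
Proof.
move=> f2 e0; have mf := f2.1.
have mfn n : qmeasurable (f \- qtrunc f n) by apply: qmeasurableB => //; exact: qmeasurable_qtrunc.
have : (qsq m (f \- qtrunc f n)%R @[n --> \oo] --> \int[m]_x (cst 0 x))%E.
  apply: (@dominated_cvg _ _ _ m _ measurableT _ _ (fun x => (qnrm (f x))%:E)) => //.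
  - by move=> n; apply/measurable_EFinP; exact: measurable_qnrm.
  - move=> x _; apply: cvg_near_cst.
    have [fx0|fx0] := eqVneq (qmod (f x)) 0.
      apply: nearW => n /=; congr EFin; apply/eqP.
      rewrite eq_le qnrm_ge0 andbT (le_trans (qnrm_qtruncB f n x))//.
      by rewrite -qmod_sqr fx0 expr0n.
    have fx_gt0 : 0 < qmod (f x) by rewrite lt_neqAle eq_sym fx0 qmod_ge0.
    near=> n; rewrite /= /qtrunc ifT.
      by rewrite subrr /qnrm/= expr0n/= !addr0.
    apply: ltW; near: n.
    have : n.+1%:R^-1 @[n --> \oo] --> (0 : R) by exact: cvg_harmonic.
    by move/cvgrPdist_lt/(_ _ fx_gt0); apply: filterS => n; rewrite sub0r normrN ger0_norm.
  - apply/integrableP; split; first by apply/measurable_EFinP; exact: measurable_qnrm.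
    under eq_integral do rewrite gee0_abs ?lee_fin ?qnrm_ge0//.
    exact: qLp2_fin.
  - by move=> n x _; rewrite gee0_abs ?lee_fin ?qnrm_ge0//= qnrm_qtruncB.
rewrite integral0 => /fine_cvgP[fin].
have e20 : 0 < e ^+ 2 by rewrite exprn_gt0.
move=> /cvgrPdist_lt/(_ _ e20) [N _ HN].
have [h1 h2] := qLp_qtrunc N f2.
exists (qtrunc f N); split=> //.
have := HN N (leqnn _); rewrite /= sub0r normrN ger0_norm ?fine_ge0 ?qsq_ge0// => h.
rewrite /q2 -(ger0_norm (ltW e0)) -sqrtr_sqr ltr_sqrt//.
Unshelve. all: by end_near. Qed.

End square_integrable.

(** * Completeness of L^2 *)

Section riesz_fischer.
Context d (T : measurableType d) (R : realType) (m : {measure set T -> \bar R}).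
Local Notation L p := (qLp m p).
Local Notation N2 := (q2 m).

Lemma cvg_geometric_steps (a : nat -> R) (C z : R) : 0 <= C -> 0 <= z < 1 ->
  (forall n, `|a n.+1 - a n| <= C * z ^+ n) -> cvgn a.
Proof.
move=> C0 /andP[z0 z1] aC.
have : cvgn (series (telescope a)).
  apply: normed_cvg; apply: (@series_le_cvg _ _ (geometric C z)).
  - by move=> n /=.
  - by move=> n; rewrite /= mulr_ge0// exprn_ge0.
  - by move=> n; rewrite /= aC.
  - by apply: is_cvg_geometric_series; rewrite ger0_norm.
move=> c; have : cvgn (fun n => a 0%N + series (telescope a) n).
  by apply: is_cvgD => //; exact: is_cvg_cst.
rewrite (_ : (fun n => _) = a)//.
by apply/funext => n; rewrite [RHS]eq_sum_telescope.
Qed.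

Lemma cvg_qnrm (u : nat -> quat R) (q : quat R) :
  (forall c, qc c (u n) @[n --> \oo] --> qc c q) -> qnrm (u n) @[n --> \oo] --> qnrm q.
Proof.
move=> h.
have h0 := h (false, false); have h1 := h (false, true).
have h2 := h (true, false); have h3 := h (true, true).
have s (x : nat -> R) (y : R) : x n @[n --> \oo] --> y -> x n ^+ 2 @[n --> \oo] --> y ^+ 2.
  by move=> xy; exact: (cvgM xy xy).
exact: (cvgD (cvgD (cvgD (s _ _ h0) (s _ _ h1)) (s _ _ h2)) (s _ _ h3)).
Qed.

Variable u : nat -> T -> quat R.
Hypothesis u2 : forall n, L 2 (u n).
Hypothesis u_cauchy : forall n k, N2 (u (k + n) \- u n) <= 2 * 4^-1 ^+ n.

Let v n := u n.+1 \- u n.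
(* The weights 4^n turn finiteness of W into geometric decay of the steps. *)
Let w n x : \bar R := (4 ^+ n * qnrm (v n x))%:E.
Let W x : \bar R := (\sum_(0 <= n <oo) w n x)%E.

Let v2 n : L 2 (v n).
Proof. exact: qLp2B. Qed.

Let w_ge0 n x : (0 <= w n x)%E.
Proof. by rewrite lee_fin mulr_ge0 ?exprn_ge0 ?qnrm_ge0. Qed.

Let mw n : measurable_fun setT (w n).
Proof.
apply/measurable_EFinP; apply: measurable_funM => //.
exact: measurable_qnrm (v2 n).1.
Qed.

Let mW : measurable_fun setT W.
Proof. by apply: ge0_emeasurable_sum => n x. Qed.

Let W_ge0 x : (0 <= W x)%E.
Proof. by apply: nneseries_ge0 => n _ _; exact: w_ge0. Qed.

(** The Cauchy rate gives 4^n (2 * 4^-n)^2 = 4 * 4^-n, which is summable. *)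
Let int_w n : (\int[m]_x w n x <= (geometric 4 4^-1 n)%:E)%E.
Proof.
rewrite /w (_ : (fun x => _) = (fun x => (4 ^+ n)%:E * (qnrm (v n x))%:E)%E); last first.
  by apply/funext => x; rewrite EFinM.
rewrite ge0_integralZl_EFin//; last 2 first.
- by move=> x _; rewrite lee_fin qnrm_ge0.
- by apply/measurable_EFinP; exact: measurable_qnrm (v2 n).1.
have -> : (\int[m]_x (qnrm (v n x))%:E)%E = (N2 (v n) ^+ 2)%:E := qsq_q2 (v2 n).
rewrite -EFinM lee_fin /=.
have h : N2 (v n) ^+ 2 <= (2 * 4^-1 ^+ n) ^+ 2.
  have v1 : N2 (v n) <= 2 * 4^-1 ^+ n by exact: (u_cauchy n 1).
  by rewrite lerXn2r ?nnegrE ?q2_ge0 ?mulr_ge0 ?exprn_ge0.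
apply: le_trans (ler_wpM2l (exprn_ge0 n (ler0n R 4)) h) _.
have e : 4 ^+ n * 4^-1 ^+ n = 1 :> R by rewrite -exprMn divff// expr1n.
by rewrite exprMn expr2 (expr2 (_ ^+ n)) mulrCA (mulrA (4 ^+ n)) e mul1r; rewrite -natrM.
Qed.

Let int_W : (\int[m]_x W x < +oo)%E.
Proof.
rewrite integral_nneseries//.
apply: (@le_lt_trans _ _ (\sum_(0 <= n <oo) (geometric 4 (4^-1 : R) n)%:E)%E).
  by apply: lee_nneseries => // n _ _; apply: integral_ge0.
have c : cvgn (series (geometric 4 (4^-1 : R))).
  by apply: is_cvg_geometric_series; rewrite ger0_norm// invf_lt1// ltr1n.
rewrite (_ : (fun n => _) = EFin \o series (geometric 4 (4^-1 : R))); last first.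
  by apply/funext => n; rewrite /= sumEFin.
by rewrite EFin_lim// ltry.
Qed.

Let b x := (W x < +oo)%E.
(** Setting the sequence to 0 on the null set where W is infinite makes it converge everywhere, so
    that the limit is measurable. *)
Let u' n x := if b x then u n x else 0.

Let b_ae : \forall x \ae m, b x.
Proof.
have Wi : m.-integrable setT W.
  by apply/integrableP; split => //; under eq_integral do rewrite gee0_abs//.
apply: filterS (integrable_ae measurableT Wi) => x /(_ I).
by rewrite /b ge0_fin_numE.
Qed.

Let mb : measurable_fun setT b.
Proof. exact: measurable_fun_lte. Qed.

Let mu' n : qmeasurable (u' n).
Proof.
apply: (@qmeasurable_if _ _ _ b (u n) (fun=> 0)) => //; first exact: (u2 n).1.
Qed.

Let u'_ae n : \forall x \ae m, u' n x = u n x.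
Proof. by apply: filterS b_ae => x; rewrite /u' => ->. Qed.

(** Where W is finite, 4^n |v_n|^2 <= W, so the steps are at most sqrt(W) 2^-n. *)
Let u'_cvg c x : cvgn (fun n => qc c (u' n x)).
Proof.
rewrite /u'; case: (boolP (b x)) => [bx|_]; last exact: is_cvg_cst.
pose r := fine (W x).
have rE : W x = r%:E by rewrite /r fineK// ge0_fin_numE.
have r0 : 0 <= r by rewrite /r fine_ge0.
apply: (@cvg_geometric_steps _ (Num.sqrt r) 2^-1).
- exact: sqrtr_ge0.
- by rewrite invr_ge0 ler0n invf_lt1// ltr1n.
move=> n; rewrite -qcB -[u n.+1 x - u n x]/(v n x).
have h : 4 ^+ n * qnrm (v n x) <= r.
  rewrite -lee_fin -rE -[leLHS]/(w n x).
  apply: le_trans (nneseries_lim_ge n.+1 (fun k _ _ => w_ge0 k x)).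
  rewrite big_nat_recr//= leeDr// sume_ge0// => k _; exact: w_ge0.
rewrite -ler_sqr ?nnegrE ?mulr_ge0 ?sqrtr_ge0 ?exprn_ge0// real_normK ?num_real//.
rewrite exprMn sqr_sqrtr// -exprM mulnC exprM.
apply: le_trans (qc_sqr c (v n x)) _.
have -> : (2^-1 ^+ 2 : R) = 4^-1 by rewrite exprVn -natrX.
by rewrite exprVn ler_pdivlMr ?exprn_gt0// mulrC.
Qed.

Let G x := qlim (fun n => u' n x).

Let G_cvg c x : qc c (u' n x) @[n --> \oo] --> qc c (G x).
Proof.
have -> : qc c (G x) = limn (fun n => qc c (u' n x)) by case: c => -[] [].
exact: u'_cvg.
Qed.

Let mG : qmeasurable G.
Proof.
apply/qmeasurableP => c; apply: (@measurable_fun_cvg _ _ _ _ (fun n x => qc c (u' n x))).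
- by move=> n; exact: (qmeasurableP (u' n)).1.
- by move=> x _; exact: G_cvg.
Qed.

(** Fatou's lemma in k at fixed n, applied to [u'], which converges at every point; almost
    everywhere equality leads back to u. *)
Let qsq_G n : (qsq m (G \- u n)%R <= ((2 * 4^-1 ^+ n) ^+ 2)%:E)%E.
Proof.
have -> : qsq m (G \- u n) = qsq m (G \- u' n).
  apply: qsq_ae_eq.
  - exact: qmeasurableB mG (u2 n).1.
  - exact: qmeasurableB mG (mu' n).
  - by apply: filterS (u'_ae n) => x /= ->.
have G_cvgn x : (qnrm (u' (k + n)%N x - u' n x))%:E @[k --> \oo] --> (qnrm (G x - u' n x))%:E.
  apply: cvg_EFin; first exact: nearW.
  apply: cvg_qnrm => c; under eq_fun do rewrite qcB; rewrite qcB.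
  by apply: cvgB; [rewrite (cvg_shiftn n (fun k => qc c (u' k x)))|exact: cvg_cst].
apply: (@le_trans _ _ (\int[m]_x limn_einf (fun k => (qnrm (u' (k + n)%N x - u' n x))%:E))%E).
  rewrite le_eqVlt; apply/orP; left; apply/eqP.
  by apply: eq_integral => x _; apply/esym; exact: (cvg_limn_einf_sup (G_cvgn x)).1.
apply: le_trans (fatou m measurableT _ _) _.
- by move=> k; apply/measurable_EFinP; apply: measurable_qnrm; exact: qmeasurableB (mu' _) (mu' _).
- by move=> k x _; rewrite lee_fin qnrm_ge0.
apply: limn_einf_le => k.
apply: (@le_trans _ _ (qsq m (u (k + n)%N \- u n)%R)).
  rewrite le_eqVlt; apply/orP; left; apply/eqP.
  apply: (@qsq_ae_eq _ _ _ m (u' (k + n)%N \- u' n)).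
  - exact: qmeasurableB (mu' _) (mu' _).
  - exact: qmeasurableB (u2 _).1 (u2 _).1.
  - by apply: filterS2 (u'_ae n) (u'_ae (k + n)%N) => x /= -> ->.
rewrite (qsq_q2 (qLp2B (u2 (k + n)%N) (u2 n))) lee_fin.
by rewrite lerXn2r ?nnegrE ?q2_ge0// mulr_ge0// exprn_ge0.
Qed.

Lemma riesz_fischer : exists G, L 2 G /\ forall n, N2 (G \- u n) <= 2 * 4^-1 ^+ n.
Proof.
have G2 n : L 2 (G \- u n).
  apply/qLp2P; split; first exact: qmeasurableB mG (u2 n).1.
  by apply: le_lt_trans (qsq_G n) _; rewrite ltry.
exists G; split.
  have [] // := @q2_triangle _ _ _ m G (G \- u 0%N) (u 0%N) mG (G2 0%N) (u2 0%N).
  by move=> x; rewrite /= -{1}(subrK (u 0%N x) (G x)) qmodD.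
move=> n; rewrite -ler_sqr ?nnegrE ?q2_ge0 ?mulr_ge0 ?exprn_ge0//.
by rewrite -lee_fin -(qsq_q2 (G2 n)).
Qed.

End riesz_fischer.

(** * Extension of an isometry by density *)

Section isometric_extension.
Context d (T : measurableType d) (R : realType) (m : {measure set T -> \bar R}).
Local Notation L p := (qLp m p).
Local Notation N2 := (q2 m).
Variable F0 : (T -> quat R) -> T -> quat R.
Hypothesis F0_L2 : forall f, L 1 f -> L 2 f -> L 2 (F0 f).
Hypothesis F0_q2 : forall f g, L 1 f -> L 2 f -> L 1 g -> L 2 g -> N2 (F0 f \- F0 g) = N2 (f \- g).
Hypothesis F0_norm : forall f, L 1 f -> L 2 f -> N2 (F0 f) = N2 f.

(** The pair (f, G) lies in the L^2 closure of the graph of [F0]. A relation is used because G is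
    determined only almost everywhere. *)
Definition is_limit_value (f G : T -> quat R) := forall e : R, 0 < e ->
  exists h, [/\ L 1 h, L 2 h, N2 (f \- h) < e & N2 (G \- F0 h) < e].

Lemma limit_value_exists f : L 2 f -> exists G, L 2 G /\ is_limit_value f G.
Proof.
move=> f2.
(* With error 4^-n for each approximant, two of them from rank n on differ by at most 2 * 4^-n, the
   rate asked for by [riesz_fischer]. *)
have /choice[h hP] n : exists h, [/\ L 1 h, L 2 h & N2 (f \- h) < 4^-1 ^+ n].
  by apply: qLp12_dense => //; exact: exprn_gt0.
have h1 n : L 1 (h n) by case: (hP n).
have h2 n : L 2 (h n) by case: (hP n).
have fh n : N2 (f \- h n) < 4^-1 ^+ n by case: (hP n).
have [G [G2 GP]] : exists G, L 2 G /\ forall n, N2 (G \- F0 (h n)) <= 2 * 4^-1 ^+ n.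
  apply: riesz_fischer => [n|n k]; first exact: F0_L2.
  rewrite F0_q2//; apply: le_trans (q2_dist (h2 _) f2 (h2 _)) _.
  rewrite mulr_natl mulr2n lerD// ?(ltW (fh n))//.
  rewrite q2_distrC (le_trans (ltW (fh _)))// exprD ler_piMl ?exprn_ge0//.
  by rewrite exprn_ile1// invf_le1// ler1n.
exists G; split => // e e0.
have : (2 * 4^-1 ^+ n)%R @[n --> \oo] --> (0 : R).
  rewrite -(mulr0 2); apply: cvgM; first exact: cvg_cst.
  by apply: cvg_expr; rewrite ger0_norm// invf_lt1// ltr1n.
move=> /cvgrPdist_lt/(_ _ e0)[N _ /(_ N (leqnn _))].
rewrite sub0r normrN ger0_norm ?mulr_ge0 ?exprn_ge0// => Ne.
exists (h N); split=> //; last exact: le_lt_trans Ne.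
apply: lt_le_trans (fh N) _; apply: le_trans (ltW Ne).
by rewrite mulr_natl mulr2n lerDl exprn_ge0.
Qed.

(** Limit values inherit the isometry as a contraction. This gives continuity of the extension and,
    at distance 0, uniqueness almost everywhere. The four approximations of f, F, g and G cost e/4
    each. *)
Lemma limit_value_dist f g F G : L 2 f -> L 2 g -> L 2 F -> L 2 G ->
  is_limit_value f F -> is_limit_value g G -> N2 (G \- F) <= N2 (g \- f).
Proof.
move=> f2 g2 F2 G2 fF gG; apply/ler_addgt0Pr => e e0.
have e4 : 0 < e / 4 by rewrite divr_gt0.
have [h [h1 h2 fh Fh]] := fF _ e4.
have [k [k1 k2 gk Gk]] := gG _ e4.
have t1 := q2_dist G2 (F0_L2 k1 k2) F2.
have t2 := q2_dist (F0_L2 k1 k2) (F0_L2 h1 h2) F2.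
have t3 := q2_dist k2 g2 h2.
have t4 := q2_dist g2 f2 h2.
rewrite F0_q2// in t2.
rewrite q2_distrC in Fh; rewrite q2_distrC in gk.
have e4E : e / 4 + e / 4 + e / 4 + e / 4 = e by field.
lra.
Qed.

Lemma q2_subrr f : N2 (f \- f) = 0.
Proof.
rewrite /q2 /qsq (_ : (\int[m]_x _)%E = 0%E) ?sqrtr0//.
rewrite -[RHS](integral0 m setT); apply: eq_integral => x _ /=.
by rewrite subrr /qnrm/= expr0n/= !addr0.
Qed.

Lemma limit_value_self f : L 1 f -> L 2 f -> is_limit_value f (F0 f).
Proof.
move=> f1 f2 e e0; exists f; split=> //.
- by rewrite q2_subrr.
- by rewrite q2_subrr.
Qed.

Definition extends (F : (T -> quat R) -> T -> quat R) := [/\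
  forall f, L 2 f -> L 2 (F f),
  forall f, L 2 f -> forall e : R, 0 < e -> exists2 d : R, 0 < d &
    forall g, L 2 g -> N2 (g \- f) < d -> N2 (F g \- F f) < e &
  forall f, L 1 f -> L 2 f -> \forall y \ae m, F f y = F0 f y].

Lemma extension_exists : exists F, extends F.
Proof.
(* The condition on f stands under the existential quantifier so that the choice is total; outside
   L^2 the witness is arbitrary. *)
have /choice[F FP] f : exists G, L 2 f -> L 2 G /\ is_limit_value f G.
  have [f2|nf2] := pselect (L 2 f); last by exists f.
  by have [G GP] := limit_value_exists f2; exists G.
exists F; split.
- by move=> f f2; have [] := FP _ f2.
(* The extension is 1-Lipschitz, so the modulus of continuity is e itself. *)
- move=> f f2 e e0; exists e => // g g2; apply: le_lt_trans.
  have [Ff2 fF] := FP _ f2; have [Gg2 gG] := FP _ g2.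
  exact: limit_value_dist fF gG.
- move=> f f1 f2; have [Ff2 fF] := FP _ f2.
  apply: (q2_eq0_ae Ff2 (F0_L2 f1 f2)); apply/eqP; rewrite eq_le q2_ge0 andbT.
  apply: le_trans (limit_value_dist f2 f2 (F0_L2 f1 f2) Ff2 (limit_value_self f1 f2) fF) _.
  by rewrite q2_subrr.
Qed.

(** Continuity at f and agreement with [F0] on a dense set determine the norm, so the result covers
    every extension and not just the constructed one. *)
Lemma extension_isometry F : extends F -> forall f, L 2 f -> N2 (F f) = N2 f.
Proof.
move=> [FL2 Fcont FE] f f2; apply/eqP; rewrite -subr_eq0 -normr_le0.
apply/ler_addgt0Pr => e e0; rewrite add0r.
have e2 : 0 < e / 2 by rewrite divr_gt0.
have [d0 d0_gt0 dP] := Fcont _ f2 _ e2.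
(* The bound d0 brings F h within e/2 of F f, and the bound e/2 does the same for h and f. *)
have md : 0 < Num.min d0 (e / 2) by rewrite lt_min d0_gt0.
have [h [h1 h2 fh]] := qLp12_dense f2 md.
move: fh; rewrite lt_min => /andP[fhd fhe].
have Fhf : N2 (F h \- F f) < e / 2 by apply: dP => //; rewrite q2_distrC.
have Fh : N2 (F h) = N2 h.
  rewrite -(F0_norm h1 h2) /q2 (@qsq_ae_eq _ _ _ m (F h) (F0 h))//.
  - exact: (FL2 _ h2).1.
  - exact: (F0_L2 h1 h2).1.
  - exact: FE.
have t1 := q2_sub (FL2 _ f2) (FL2 _ h2); have t2 := q2_sub (FL2 _ h2) (FL2 _ f2).
have t3 := q2_sub f2 h2; have t4 := q2_sub h2 f2.
rewrite (q2_distrC _ (F f)) in t1; rewrite (q2_distrC _ h) in t4.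
have e2E : e / 2 + e / 2 = e by field.
by rewrite ler_norml; apply/andP; split; lra.
Qed.

End isometric_extension.

Lemma qLp1B d (T : measurableType d) (R : realType) (m : {measure set T -> \bar R})
  (f g : T -> quat R) : qLp m 1 f -> qLp m 1 g -> qLp m 1 (f \- g).
Proof.
move=> f1 g1; have mfg := qmeasurableB f1.1 g1.1.
apply: integrable_qLp1 => //.
have i := integrableD measurableT (qLp1_integrable f1) (qLp1_integrable g1).
apply: (le_integrable measurableT _ _ i).
  by apply/measurable_EFinP; exact: measurable_qmod.
move=> x _ /=; rewrite lee_fin (ger0_norm (qmod_ge0 _)) (le_trans (qmodB _ _))//.
exact: ler_norm.
Qed.

(** Subtracting a multiple of pi brings theta into [0, pi), and sin is positive on ]0, pi[. The
    square of sin is used because it has period pi, which avoids signs. *)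
Lemma sin_eq0_Zpi (R : realType) (theta : R) : sin theta = 0 -> exists k : int, theta = k%:~R * pi.
Proof.
move=> s0.
have sqn_per (n : nat) (x : R) : sin (x + n%:R * pi) ^+ 2 = sin x ^+ 2.
  elim: n => [|n ih]; first by rewrite mul0r addr0.
  by rewrite -natr1 mulrDl mul1r addrA sinDpi sqrrN.
pose k := Num.floor (theta / pi).
have sk : sin (theta - k%:~R * pi) = 0.
  apply/eqP; rewrite -sqrf_eq0; apply/eqP; rewrite -[RHS](expr0n R 2) -s0.
  case: k => n.
    by rewrite -pmulrn -(sqn_per n (theta - _)) subrK.
  by rewrite NegzE mulrNz mulNr opprK sqn_per.
have pi0 : 0 < pi :> R := pi_gt0 R.
have /andP[kl kr] := floor_itv (theta / pi).
rewrite -/k ler_pdivlMr// in kl; rewrite -/k ltr_pdivrMr// intrD mulrDl mul1r in kr.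
exists k; apply/eqP; rewrite -subr_eq0 eq_le subr_ge0 kl andbT leNgt; apply/negP => h.
have : 0 < sin (theta - k%:~R * pi) by apply: sin_gt0_pi; rewrite h ltrBlDl.
by rewrite sk ltxx.
Qed.

(** The L^2 transform enters through its specification [is_frac_dunkl_L2]. The second clause
    provides a map that satisfies it, so the third, about all such maps, is not vacuous; the first
    is the identity for the integral formula itself. *)
Theorem theorem3p8 (R : realType) (chi1 chi2 theta1 theta2 : R) (a b : quat R)
  (chi1_ge0 : 0 <= chi1) (chi2_ge0 : 0 <= chi2)
  (theta1_nZpi : forall k : int, theta1 <> k%:~R * pi)
  (theta2_nZpi : forall k : int, theta2 <> k%:~R * pi)
  (a_pure : pure_quat a) (a_sqr : a ^+ 2 = -1)
  (b_pure : pure_quat b) (b_sqr : b ^+ 2 = -1) :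
  let mu := dunkl_measure chi1 chi2 in
  let F0 := frac_dunkl chi1 chi2 theta1 theta2 a b in
  [/\ forall f : R * R -> quat R, qLp mu 1 f -> qLp mu 2 f ->
        qLp mu 2 (F0 f) /\ (qLnorm mu 2 (F0 f) ^+ 2 = qLnorm mu 2 f ^+ 2)%E,
      exists F, is_frac_dunkl_L2 chi1 chi2 theta1 theta2 a b F &
      forall F, is_frac_dunkl_L2 chi1 chi2 theta1 theta2 a b F ->
        forall f : R * R -> quat R, qLp mu 2 f ->
          (qLnorm mu 2 (F f) ^+ 2 = qLnorm mu 2 f ^+ 2)%E].
Proof.
move=> mu F0.
have s1 : sin theta1 != 0.
  by apply/eqP => /sin_eq0_Zpi[k /theta1_nZpi].
have s2 : sin theta2 != 0.
  by apply/eqP => /sin_eq0_Zpi[k /theta2_nZpi].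
have iso f (f1 : qLp mu 1 f) (f2 : qLp mu 2 f) : qmeasurable (F0 f) /\ qsq mu (F0 f) = qsq mu f.
  exact: frac_dunkl_isometry.
have F0_L2 f (f1 : qLp mu 1 f) (f2 : qLp mu 2 f) : qLp mu 2 (F0 f).
  have [mF EF] := iso f f1 f2; apply/qLp2P; split=> //.
  by rewrite EF; exact: qLp2_fin.
have F0_norm f (f1 : qLp mu 1 f) (f2 : qLp mu 2 f) : q2 mu (F0 f) = q2 mu f.
  by rewrite /q2 (iso f f1 f2).2.
have F0_q2 f g (f1 : qLp mu 1 f) (f2 : qLp mu 2 f) (g1 : qLp mu 1 g) (g2 : qLp mu 2 g) :
    q2 mu (F0 f \- F0 g) = q2 mu (f \- g).
  rewrite -(F0_norm _ (qLp1B f1 g1) (qLp2B f2 g2)); congr (q2 mu _).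
  by apply/funext => y; rewrite /= /F0 frac_dunklB.
have sqrE f g (f2 : qLp mu 2 f) (g2 : qLp mu 2 g) : q2 mu f = q2 mu g ->
    (qLnorm mu 2 f ^+ 2 = qLnorm mu 2 g ^+ 2)%E.
  by move=> fg; rewrite (qLnorm_q2 f2) (qLnorm_q2 g2) fg.
split.
- by move=> f f1 f2; split; [exact: F0_L2|apply: sqrE; [exact: F0_L2|exact: f2|exact: F0_norm]].
- have [F [FL Fc FE]] := extension_exists F0_L2 F0_q2.
  exists F; split=> // f f2 e e0.
  have [d d0 dP] := Fc f f2 e e0.
  exists d => // g g2; rewrite (qLnorm_q2 (qLp2B g2 f2)) lte_fin => /(dP g g2).
  by rewrite (qLnorm_q2 (qLp2B (FL _ g2) (FL _ f2))) lte_fin.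
- move=> F [FL Fc FE] f f2; apply: sqrE => //; first exact: FL.
  apply: (extension_isometry F0_L2 F0_norm) => //; split=> // {f2}f f2 e e0.
  have [d d0 dP] := Fc f f2 e e0.
  exists d => // g g2 gf; rewrite -lte_fin -(qLnorm_q2 (qLp2B (FL _ g2) (FL _ f2))).
  by apply: dP => //; rewrite (qLnorm_q2 (qLp2B g2 f2)) lte_fin.
Qed.
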